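(* Let $\alpha>0$, $1<p\le\infty$, $x\in\mathbb{R}$, and let $w_x$ be a function of modulus of continuity type such that the class $\Omega_{\alpha,p}(w_x)$ is nonempty. Let $A=(a_{n,k})_{n,k\ge0}$ be an infinite matrix of nonnegative real numbers such that $\sum_{k=0}^\infty a_{n,k}=1$ for every $n=0,1,2,\dots$ and $\lim_{n\to\infty}a_{n,0}=0$. Suppose that $(a_{n,k})_{k=0}^\infty\in GM({}_2\beta)$ for all $n$, uniformly in $n$, i.e. there are constants $c>1$ and $K_0\ge 0$ such that $$\sum_{k=m}^{2m-1}|a_{n,k}-a_{n,k+1}|\le K_0\sum_{k=[m/c]}^{[cm]}\frac{a_{n,k}}{k}\qquad\text{for all } n\ge0,\ m\ge1 .$$ If $f\in\Omega_{\alpha,p}(w_x)$ and $q>0$, then, with this $c$, there is a constant $K>0$, not depending on $n$, such that for all $n=0,1,2,\dots$ $$\left\{\sum_{k=0}^\infty a_{n,k}\left|S_{\frac{\alpha k}{2}}f(x)-f(x)\right|^q\right\}^{1/q}\le K\left\{\sum_{k=0}^\infty a_{n,k}\left[w_x\!\left(\frac{\pi}{k+1}\right)+E_{\frac{\alpha k}{2^{1+[c]}}}(f)_{S^p}\right]^q\right\}^{1/q}.$$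
   Context: $[y]$ denotes the integer part of $y$. In the sum $\sum_{k=[m/c]}^{[cm]}a_{n,k}/k$ a term with $k=0$ (possible only if $m<c$) is omitted. **Stepanov class.** For $1<p\le\infty$, $S^p$ is the class of all almost periodic functions on $\mathbb{R}$ in the sense of Stepanov, with the norm $\|f\|_{S^p}=\sup_{u}\left\{\frac1\pi\int_u^{u+\pi}|f(t)|^p\,dt\right\}^{1/p}$ for $1<p<\infty$ and $\|f\|_{S^\infty}=\sup_u|f(u)|$. **Fourier series.** The Fourier series of $f\in S^p$ is $\sum_{\nu=-\infty}^{\infty}A_\nu(f)e^{i\lambda_\nu x}$ with $A_\nu(f)=\lim_{L\to\infty}\frac1L\int_0^L f(t)e^{-i\lambda_\nu t}\,dt$, where it is assumed that $0=\lambda_0<\lambda_\nu<\lambda_{\nu+1}$ for $\nu\in\mathbb{N}=\{1,2,\dots\}$, $\lim_{\nu\to\infty}\lambda_\nu=\infty$, $\lambda_{-\nu}=-\lambda_\nu$ and $|A_\nu(f)|+|A_{-\nu}(f)|>0$. For $\gamma\ge0$ the partial sums are $S_\gamma f(x)=\sum_{|\lambda_\nu|\le\gamma}A_\nu(f)e^{i\lambda_\nu x}$. **The class $\Omega_{\alpha,p}$.** For fixed $\alpha>0$, $\Omega_{\alpha,p}$ is the set of functions of class $S^p$, bounded on $(-\infty,\infty)$, whose Fourier exponents (the numbers $\lambda_\nu$ in the Fourier series $\sum_{\nu=-\infty}^{\infty}A_\nu(f)e^{i\lambda_\nu x}$ of $f$, with $0=\lambda_0<\lambda_\nu<\lambda_{\nu+1}$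 for $\nu\in\mathbb{N}$, $\lim_{\nu\to\infty}\lambda_\nu=\infty$, $\lambda_{-\nu}=-\lambda_\nu$ and $|A_\nu(f)|+|A_{-\nu}(f)|>0$) satisfy $\lambda_{\nu+1}-\lambda_\nu\ge\alpha$ for all $\nu\in\mathbb{N}$. **Best approximation.** For $\sigma\ge0$, $B_\sigma$ is the set of entire functions of exponential type $\sigma$ (i.e. at most $\sigma$) bounded on the real axis, and $E_\sigma(f)_{S^p}=\inf_{g_\sigma\in B_\sigma}\|f-g_\sigma\|_{S^p}$. **Local moduli.** $\varphi_x(t)=f(x+t)+f(x-t)-2f(x)$ and, for $\delta>0$, $w_xf(\delta)_p=\left\{\frac1\delta\int_0^\delta|\varphi_x(t)|^p\,dt\right\}^{1/p}$ (for $p=\infty$, such $p$-th power integral means over $(0,\delta)$ are read as the essential supremum over $(0,\delta)$). **Function of modulus of continuity type.** A nondecreasing continuous function $w_x$ on $[0,+\infty)$ with $w_x(0)=0$ and $w_x(\delta_1+\delta_2)\le w_x(\delta_1)+w_x(\delta_2)$ for all $\delta_1,\delta_2\ge0$. **The class $\Omega_{\alpha,p}(w_x)$.** The set of all $f\in\Omega_{\alpha,p}$ for which there is a constant $C>0$ such that for all $\gamma,\delta>0$ (and both choices of sign) $$\left[\frac1\delta\int_0^\delta|\varphi_x(t)-\varphi_x(t\pm\gamma)|^p\,dt\right]^{1/p}\le C\,w_x(\gamma)\quad\text{and}\quad w_xf(\delta)_p\le C\,w_x(\delta).$$ **Constants.** The paper writes the estimate with $\ll$, where $I_1\ll I_2$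 means $I_1\le KI_2$ for a positive constant $K$ that may depend on parameters (such as $\alpha,p,q,c,K_0$ and the constant $C$ of the class), but not on $n$. *)

(* Defs.v *)
(* MathComp-Analysis, over an arbitrary [R : realType]; complex numbers are
   [R[i]] (mathcomp-real-closed).  The topology of the complex plane is carried
   by [R[i]^o]. *)
From HB Require Import structures.
From mathcomp Require Import all_boot all_order all_algebra.
From mathcomp Require Import all_classical all_reals all_analysis.
From mathcomp Require Import ess_sup_inf complex.

Set Implicit Arguments.
Unset Strict Implicit.
Unset Printing Implicit Defensive.

Import Order.TTheory GRing.Theory Num.Theory.
Import numFieldNormedType.Exports.

Local Open Scope classical_set_scope.
Local Open Scope ring_scope.
Local Open Scope complex_scope.

Section Definitions.
Variable R : realType.
Local Notation mu := (@lebesgue_measure R).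

(* The real-valued modulus; [`|z|] itself lives in [R[i]]. *)
Definition cabs (z : R[i]) : R := complex.Re `|z|.

Definition expi (theta : R) : R[i] := cos theta +i* sin theta.

Definition cintegral (D : set R) (h : R -> R[i]) : R[i] :=
  (\int[mu]_(t in D) complex.Re (h t)) +i* (\int[mu]_(t in D) complex.Im (h t)).

(* The sigma-algebra carrying [lebesgue_measure] consists of the Borel sets, so
   Lebesgue measurability is expressed as being a.e. equal to a Borel function. *)
Definition lebesgue_measurable (f : R -> R[i]) : Prop :=
  exists g : R -> R[i],
    [/\ measurable_fun setT (fun t => complex.Re (g t)),
        measurable_fun setT (fun t => complex.Im (g t)) &
        {ae mu, forall t, f t = g t}].

Definition Sp_norm (p : \bar R) (f : R -> R[i]) : \bar R :=
  match p with
  | r%:E => ereal_sup (range (fun u : R =>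
      (((pi^-1)%:E * \int[mu]_(t in `[u, (u + pi)%R]) (cabs (f t) `^ r)%:E)
        `^ r^-1)%E))
  | +oo%E => ereal_sup (range (fun u : R => (cabs (f u))%:E))
  | -oo%E => 0%E
  end.

Definition trig_poly (N : nat) (c : 'I_N -> R[i]) (lam : 'I_N -> R) (t : R) :
  R[i] := \sum_(j < N) c j * expi (lam j * t).

(* Almost periodicity in the sense of Stepanov: f belongs to the closure of the
   trigonometric polynomials for the S^p-norm.  For p = +oo these are the
   uniformly almost periodic functions of Bohr. *)
Definition stepanov (p : \bar R) : set (R -> R[i]) :=
  [set f | lebesgue_measurable f /\
    forall eps : R, 0 < eps ->
      exists N (c : 'I_N -> R[i]) (lam : 'I_N -> R),
        (Sp_norm p (fun t => (f t - trig_poly c lam t)%R) <= eps%:E)%E].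

Definition fourier_coef (f : R -> R[i]) (lam : R) : R[i] :=
  lim ((((L^-1)%:C * cintegral `[0, L] (fun t => f t * expi (- (lam * t))))
        : (R[i])^o) @[L --> +oo]).

(* [lam] enumerates the Fourier exponents of [f]; the last clause says that the
   series over [lam] contains every nonzero term.  No condition is put on the
   coefficient of index 0. *)
Definition fourier_exponents (f : R -> R[i]) (lam : int -> R) : Prop :=
  [/\ lam 0 = 0 /\ (forall nu : int, lam (- nu) = - lam nu),
      forall nu : nat, (0 < nu)%N -> 0 < lam nu /\ lam nu < lam nu.+1,
      lam (n%:Z) @[n --> \oo] --> +oo,
      forall nu : nat, (0 < nu)%N ->
        0 < cabs (fourier_coef f (lam nu)) + cabs (fourier_coef f (lam (- nu%:Z)))
    & forall l : R, fourier_coef f l != 0 -> exists nu : int, l = lam nu].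

(* The index set is finite because |lam| tends to +oo. *)
Definition fourier_sum (f : R -> R[i]) (lam : int -> R) (gamma x : R) : R[i] :=
  \sum_(nu \in [set nu : int | `|lam nu| <= gamma])
    fourier_coef f (lam nu) * expi (lam nu * x).

Definition Omega (alpha : R) (p : \bar R) : set (R -> R[i]) :=
  [set f | [/\ stepanov p f,
      exists M : R, forall t, cabs (f t) <= M &
      exists2 lam, fourier_exponents f lam &
        forall nu : nat, (0 < nu)%N -> alpha <= lam nu.+1 - lam nu]].

Definition entire (g : R[i] -> R[i]) : Prop :=
  forall z : R[i], derivable (g : (R[i])^o -> (R[i])^o) z 1.

(* Exponential type at most [sigma]. *)
Definition exp_type (sigma : R) (g : R[i] -> R[i]) : Prop :=
  forall eps : R, 0 < eps -> exists M : R,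
    forall z, cabs (g z) <= M * expR ((sigma + eps) * cabs z).

Definition B_ (sigma : R) : set (R[i] -> R[i]) :=
  [set g | [/\ entire g, exp_type sigma g &
    exists M : R, forall t : R, cabs (g t%:C) <= M]].

Definition best_approx (sigma : R) (p : \bar R) (f : R -> R[i]) : \bar R :=
  ereal_inf [set Sp_norm p (fun t => f t - g t%:C) | g in B_ sigma].

(* For p = +oo the function is extended by 0 outside ]0, delta[, which does not
   change its essential supremum because it is nonnegative. *)
Definition lp_mean (p : \bar R) (delta : R) (h : R -> R[i]) : \bar R :=
  match p with
  | r%:E => (((delta^-1)%:E * \int[mu]_(t in `]0%R, delta[) (cabs (h t) `^ r)%:E)
              `^ r^-1)%E
  | +oo%E => ess_sup mu ((fun t => (cabs (h t))%:E) \_ `]0, delta[)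
  | -oo%E => 0%E
  end.

Definition phi (f : R -> R[i]) (x t : R) : R[i] :=
  f (x + t) + f (x - t) - 2 * f x.

Definition local_modulus (f : R -> R[i]) (x : R) (p : \bar R) (delta : R) :
  \bar R := lp_mean p delta (phi f x).

Definition modulus_type (w : R -> R) : Prop :=
  [/\ {in `[0, +oo[ &, {homo w : s t / s <= t}},
      {within `[0, +oo[, continuous w},
      w 0 = 0 &
      forall d1 d2, 0 <= d1 -> 0 <= d2 -> w (d1 + d2) <= w d1 + w d2].

Definition Omega_w (alpha : R) (p : \bar R) (x : R) (w : R -> R) :
  set (R -> R[i]) :=
  [set f | Omega alpha p f /\ exists2 C : R, 0 < C &
    forall gamma delta : R, 0 < gamma -> 0 < delta ->
      [/\ (lp_mean p delta (fun t => (phi f x t - phi f x (t + gamma))%R)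
            <= (C * w gamma)%:E)%E,
          (lp_mean p delta (fun t => (phi f x t - phi f x (t - gamma))%R)
            <= (C * w gamma)%:E)%E &
          (local_modulus f x p delta <= (C * w delta)%:E)%E]].

Definition GM_2beta (c K0 : R) (b : nat -> R) : Prop :=
  forall m : nat, (1 <= m)%N ->
    \sum_(m <= k < m.*2) `|b k - b k.+1| <=
    K0 * \sum_(Num.truncn (m%:R / c) <= k < (Num.truncn (c * m%:R)).+1
                | (0 < k)%N) b k / k%:R.

End Definitions.

(* Main.v *)
(** Write beta = alpha / 2.  Since exponents are alpha apart, one of the intervals
    (beta (k - 1), beta k] and (beta k, beta (k + 1)) contains no exponent, so the
    partial sum of order beta k is reproduced by a convolution whose Fourier
    multiplier is a trapezoid, and S f(x) - f(x) = int_0^oo phi_x K_j with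
    K_j(t) = c sin (beta t / 2) sin (beta (j + 1/2) t) / t^2, j = k or k - 1.
    That the convolution and the partial sum coincide is Bohr uniqueness: a
    trigonometric polynomial close to a function with small Bohr coefficients is
    small.  For k of size m, the part of the integral near 0 is O(w_x(gamma)),
    gamma = 1 / (beta m); away from 0 a second difference of step gamma turns it
    into sine coefficients of a function bounded by V(t) / t, where the means of
    V^p over [tau, 2 tau] are O(w_x(gamma)^p).  Splitting that function into an
    L^1 and an L^2 part and applying Bessel's inequality shows that the number of
    k in a block with a coefficient exceeding J w_x(gamma) decays exponentially in
    J; hence sum_{m <= k < 2m} |S f(x) - f(x)|^q = O(m w_x(gamma)^q) for every q.
    The GM condition bounds a_{n,k} on the block by the mean of (a_{n,i}) over
    indices i comparable with m, and each i is comparable with boundedly many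
    dyadic m. *)

Require Import Defs.
From HB Require Import structures.
From mathcomp Require Import all_boot all_order all_algebra.
From mathcomp Require Import all_classical all_reals all_analysis.
From mathcomp Require Import complex.
From mathcomp Require Import measurable_realfun ring lra zify.

Set Implicit Arguments.
Unset Strict Implicit.
Unset Printing Implicit Defensive.

Import Order.TTheory GRing.Theory Num.Theory.
Import numFieldNormedType.Exports.

Local Open Scope classical_set_scope.
Local Open Scope ring_scope.

(** * Integrals on the line *)

Section ChangeOfVariables.
Variable R : realType.
Local Notation mu := (@lebesgue_measure R).

(** For a single k there is a logarithmic obstacle. The means of phi_x over (0, t) are controlled by
    w_x(t), which grows with t; only its increments of step gamma keep the size w_x(gamma). After
    the second difference the integrand is dominated by V(t) / t, to which every dyadic scale beyond
    gamma may contribute the same amount O(w_x(gamma)). The loss disappears only on average over k: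
    stopping after J scales costs a multiple of J, and what lies beyond has, up to a bounded part,
    an L^2 mass decaying geometrically in J. A count exponential in J serves all q at once and uses
    only Bessel's inequality, even for p < 2. The slopes of the trapezoids have length exactly beta
    because two cosines whose frequencies differ by beta produce one sine of frequency beta (j +
    1/2), and these sines are orthogonal on [0, 2 pi / beta]. Since f is only almost everywhere
    equal to a Borel function, its value at x is not recovered from a representative and is carried
    along as a separate number. *)

Lemma measurable_affine (a b : R) :
  measurable_fun setT (fun t : measurableTypeR R => (b + a * t : measurableTypeR R)).
Proof.
by apply: measurable_funD => //; exact: measurable_funM.
Qed.

(** Both sides are measures in [A] that agree on half-open intervals, and these determine Lebesgue
    measure. The form with an image measure is the one that integration against [pushforward]
    requires. *)
Lemma lebesgue_measure_affine (a b : R) (A : set R) : 0 < a -> measurable A ->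
  (a%:E * pushforward mu (fun t : R => (b + a * t)%R : measurableTypeR R) A
     = mu A)%E.
Proof.
move=> a0 mA.
pose phi : measurableTypeR R -> measurableTypeR R := fun t : R => b + a * t.
have mphi : measurable_fun setT phi by exact: measurable_affine.
pose aa : {nonneg R} := NngNum (ltW a0).
pose m0 : {measure set (measurableTypeR R) -> \bar R} := mscale aa (pushforward mu phi).
pose m := m0 mphi.
suff -> : mu A = m A by [].
apply: (lebesgue_measure_unique (mu := m)) => // X [[x y]] _ <-.
transitivity (a%:E * mu (phi @^-1` [set` `]x, y]]))%E; last by [].
have -> : phi @^-1` [set` `]x, y]] = [set` `](x - b) / a, (y - b) / a]].
  apply/seteqP; split => t /=; rewrite !in_itv /= ltr_pdivrMr // ler_pdivlMr // /phi;
  by rewrite ltrBlDl lerBrDl mulrC.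
rewrite !lebesgue_measure_itv /= !lte_fin.
have -> : ((x - b) / a < (y - b) / a) = (x < y) by rewrite ltr_pM2r ?invr_gt0 // ltrD2r.
case: ifP => _; last by rewrite mule0.
rewrite -!EFinD -EFinM -mulrBl mulrC divfK ?gt_eqF //; congr (_%:E); lra.
Qed.

Lemma ge0_integral_affine (a b : R) (D : set R) (g : R -> \bar R) :
  0 < a -> measurable D -> measurable_fun setT g -> (forall t, 0 <= g t)%E ->
  (\int[mu]_(t in [set t | D (b + a * t)%R]) g (b + a * t)%R =
   (a^-1)%:E * \int[mu]_(t in D) g t)%E.
Proof.
move=> a0 mD mg g0.
pose phi : measurableTypeR R -> measurableTypeR R := fun t : R => b + a * t.
have mphi : measurable_fun setT phi by exact: measurable_affine.
pose aa : {nonneg R} := NngNum (ltW a0).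
pose m0 : {measure set (measurableTypeR R) -> \bar R} := mscale aa (pushforward mu phi).
pose m := m0 mphi.
have -> : (\int[mu]_(t in D) g t = \int[m]_(t in D) g t)%E.
  apply: eq_measure_integral => A mA _ /=.
  by rewrite -(lebesgue_measure_affine b a0 mA).
rewrite ge0_integral_mscale //; last exact: measurable_funTS.
rewrite muleA -EFinM mulVf ?gt_eqF // mul1e.
rewrite ge0_integral_pushforward //; exact: measurable_funTS.
Qed.

Lemma ge0_integral_shift (b : R) (D : set R) (g : R -> \bar R) :
  measurable D -> measurable_fun setT g -> (forall t, 0 <= g t)%E ->
  (\int[mu]_(t in [set t | D (b + t)%R]) g (b + t)%R =
   \int[mu]_(t in D) g t)%E.
Proof.
move=> mD mg g0.
have := ge0_integral_affine b (@ltr01 R) mD mg g0.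
rewrite invr1 mul1e => <-.
have -> : [set t | D (b + t)] = [set t | D (b + 1 * t)].
  by apply/seteqP; split => t /=; rewrite mul1r.
by apply: eq_integral => t _; rewrite mul1r.
Qed.

Lemma ge0_integral_oppr (D : set R) (g : R -> \bar R) :
  measurable D -> measurable_fun setT g -> (forall t, 0 <= g t)%E ->
  (\int[mu]_(t in [set t | D (- t)%R]) g (- t)%R = \int[mu]_(t in D) g t)%E.
Proof.
move=> mD mg g0.
have := @ge0_integral_pushforward _ _ (measurableTypeR R) (measurableTypeR R) R
  (-%R : measurableTypeR R -> measurableTypeR R) _ mu D g.
move=> <- //; last exact: measurable_funTS.
by apply: eq_measure_integral => A mA _; exact: lebesgue_measureN.
Qed.

Lemma integral_shiftT (b : R) (g : R -> R) :
  mu.-integrable setT (EFin \o g) ->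
  mu.-integrable setT (fun t => (g (b + t))%:E) /\
  \int[mu]_t g (b + t) = \int[mu]_t g t.
Proof.
move=> ig.
have /integrableP[mg gfin] := ig.
pose phi : measurableTypeR R -> measurableTypeR R := fun t : R => b + t.
have mphi : measurable_fun setT phi by apply: measurable_funD.
have igb : mu.-integrable setT (fun t => (g (b + t))%:E).
  apply/integrableP; split.
    exact: (measurableT_comp mg mphi).
  have := @ge0_integral_shift b setT (fun t => `|(g t)%:E|)%E measurableT _ _.
  have -> : [set t | [set: R] (b + t)] = setT by apply/seteqP.
  by move=> -> //; exact: measurableT_comp.
split => //.
rewrite /Rintegral; congr fine.
have := @integral_pushforward _ _ (measurableTypeR R) (measurableTypeR R) R
  phi mphi mu setT (EFin \o g) mg.
rewrite preimage_setT => /(_ igb measurableT) <-.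
apply: eq_measure_integral => A mA _ /=.
have := @lebesgue_measure_affine 1 b A ltr01 mA.
rewrite mul1e => <-; rewrite /pushforward; congr (mu _).
by apply/seteqP; split => t /=; rewrite /phi mul1r.
Qed.

End ChangeOfVariables.

Section BoundedMeasurable.
Variable R : realType.
Local Notation mu := (@lebesgue_measure R).

(** The working class of real functions: stable under sums, products, shifts and reflections, and
    integrable on bounded intervals, so that linearity of the integral is always at hand. Real and
    imaginary parts of functions of the class enter it through [truncated_part]. *)
Definition bounded_meas (f : R -> R) :=
  measurable_fun setT f /\ exists M, forall t, `|f t| <= M.

Lemma bounded_measW (f : R -> R) M : measurable_fun setT f -> (forall t, `|f t| <= M) ->
  bounded_meas f.
Proof. by move=> mf fM; split => //; exists M. Qed.

Lemma bounded_meas_cst c : bounded_meas (fun=> c).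
Proof. by apply: (@bounded_measW _ `|c|). Qed.

Lemma bounded_measD f g : bounded_meas f -> bounded_meas g ->
  bounded_meas (fun t => f t + g t).
Proof.
move=> [mf [M fM]] [mg [N gN]]; apply: (@bounded_measW _ (M + N)).
  exact: measurable_funD.
by move=> t; rewrite (le_trans (ler_normD _ _)) // lerD.
Qed.

Lemma bounded_measM f g : bounded_meas f -> bounded_meas g ->
  bounded_meas (fun t => f t * g t).
Proof.
move=> [mf [M fM]] [mg [N gN]]; apply: (@bounded_measW _ (M * N)).
  exact: measurable_funM.
by move=> t; rewrite normrM ler_pM.
Qed.

Lemma bounded_measN f : bounded_meas f -> bounded_meas (fun t => - f t).
Proof.
move=> [mf [M fM]]; apply: (@bounded_measW _ M) => [|t]; last by rewrite normrN.
exact: measurableT_comp.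
Qed.

Lemma bounded_measB f g : bounded_meas f -> bounded_meas g ->
  bounded_meas (fun t => f t - g t).
Proof. by move=> hf hg; apply: bounded_measD => //; exact: bounded_measN. Qed.

Lemma bounded_meas_norm f : bounded_meas f -> bounded_meas (fun t => `|f t|).
Proof.
move=> [mf [M fM]]; apply: (@bounded_measW _ M) => [|t]; last by rewrite normr_id.
exact: measurableT_comp.
Qed.

Lemma bounded_meas_comp f g : bounded_meas f -> measurable_fun setT g ->
  bounded_meas (fun t => f (g t)).
Proof.
move=> [mf [M fM]] mg; apply: (@bounded_measW _ M) => //.
exact: (measurableT_comp mf mg).
Qed.

Lemma bounded_meas_shift f b : bounded_meas f -> bounded_meas (fun t => f (b + t)).
Proof. by move=> hf; apply: bounded_meas_comp => //; exact: measurable_funD. Qed.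

Lemma bounded_meas_reflect f b :
  bounded_meas f -> bounded_meas (fun t => f (b - t)).
Proof. by move=> hf; apply: bounded_meas_comp => //; exact: measurable_funB. Qed.

Lemma measurable_mulr_id (a : R) : measurable_fun setT (fun t : R => a * t).
Proof. exact: measurable_funM. Qed.

Lemma bounded_meas_cos a : bounded_meas (fun t => cos (a * t)).
Proof.
apply: (@bounded_measW _ 1) => [|t]; last exact: cos_max.
apply: (measurableT_comp (f := @cos R)); last exact: measurable_mulr_id.
by apply: continuous_measurable_fun; exact: continuous_cos.
Qed.

Lemma bounded_meas_sin a : bounded_meas (fun t => sin (a * t)).
Proof.
apply: (@bounded_measW _ 1) => [|t]; last exact: sin_max.
apply: (measurableT_comp (f := @sin R)); last exact: measurable_mulr_id.
by apply: continuous_measurable_fun; exact: continuous_sin.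
Qed.

Lemma bounded_meas_sum (I : Type) (r : seq I) (F : I -> R -> R) :
  (forall i, bounded_meas (F i)) -> bounded_meas (fun t => \sum_(i <- r) F i t).
Proof.
move=> hF; elim: r => [|i r IH].
  by under eq_fun do rewrite big_nil; exact: bounded_meas_cst.
by under eq_fun do rewrite big_cons; exact: bounded_measD.
Qed.

Lemma integrable_bounded_meas (D : set R) (f : R -> R) : measurable D -> (mu D < +oo)%E ->
  bounded_meas f -> mu.-integrable D (EFin \o f).
Proof.
move=> mD Dfin [mf [M fM]]; apply: measurable_bounded_integrable => //.
  exact: measurable_funTS.
exists M; split; first by rewrite realE; case: lerP => //= /ltW ->.
by move=> N MN t _ /=; apply: (le_trans (fM t)); exact: ltW.
Qed.

Lemma itv_fin (a b : R) (x y : bool) :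
  (mu [set` Interval (BSide x a) (BSide y b)] < +oo)%E.
Proof. by rewrite lebesgue_measure_itv /=; case: ifP => // _; rewrite ltry. Qed.

Lemma integrable_itv f (a b : R) (x y : bool) : bounded_meas f ->
  mu.-integrable [set` Interval (BSide x a) (BSide y b)] (EFin \o f).
Proof. by move=> hf; apply: integrable_bounded_meas => //; exact: itv_fin. Qed.

Lemma integrable_bounded_measM (D : set R) (f k : R -> R) : measurable D ->
  mu.-integrable D (EFin \o k) -> bounded_meas f ->
  mu.-integrable D (EFin \o (fun t => f t * k t)).
Proof.
move=> mD ik [mf [M fM]].
have iMk : mu.-integrable D (EFin \o (fun t => M * k t)).
  have : mu.-integrable D (fun t => M%:E * (k t)%:E)%E by apply: integrableZl.
  by apply: eq_integrable => // t _; rewrite EFinM.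
apply: (@le_integrable _ _ _ mu _ mD _ (EFin \o (fun t => M * k t))) iMk.
  apply/measurable_EFinP; apply: measurable_funM; first exact: measurable_funTS.
  by have /integrableP[/measurable_EFinP] := ik.
move=> t _ /=; rewrite lee_fin !normrM ler_wpM2r //.
by rewrite (le_trans (fM t)) // ler_norm.
Qed.

Lemma Rintegral_EFin (D : set R) (f : R -> R) : measurable D ->
  mu.-integrable D (EFin \o f) ->
  ((\int[mu]_(t in D) f t)%:E = \int[mu]_(t in D) (f t)%:E)%E.
Proof. by move=> mD fi; rewrite /Rintegral fineK //; exact: integrable_fin_num. Qed.

Lemma RintD (D : set R) (f g : R -> R) : measurable D ->
  mu.-integrable D (EFin \o f) -> mu.-integrable D (EFin \o g) ->
  \int[mu]_(t in D) (f t + g t) = \int[mu]_(t in D) f t + \int[mu]_(t in D) g t.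
Proof. by move=> mD fi gi; rewrite RintegralD. Qed.

Lemma RintB (D : set R) (f g : R -> R) : measurable D ->
  mu.-integrable D (EFin \o f) -> mu.-integrable D (EFin \o g) ->
  \int[mu]_(t in D) (f t - g t) = \int[mu]_(t in D) f t - \int[mu]_(t in D) g t.
Proof. by move=> mD fi gi; rewrite RintegralB. Qed.

Lemma RintZ (D : set R) c (f : R -> R) : measurable D ->
  mu.-integrable D (EFin \o f) ->
  \int[mu]_(t in D) (c * f t) = c * \int[mu]_(t in D) f t.
Proof. by move=> mD fi; rewrite RintegralZl. Qed.

Lemma intD (D : set R) (f g : R -> R) : measurable D ->
  mu.-integrable D (EFin \o f) -> mu.-integrable D (EFin \o g) ->
  mu.-integrable D (EFin \o (fun t => f t + g t)).
Proof.
move=> mD fi gi.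
have : mu.-integrable D ((EFin \o f) \+ (EFin \o g))%E by apply: integrableD.
by apply: eq_integrable => // t _; rewrite EFinD.
Qed.

Lemma intB (D : set R) (f g : R -> R) : measurable D ->
  mu.-integrable D (EFin \o f) -> mu.-integrable D (EFin \o g) ->
  mu.-integrable D (EFin \o (fun t => f t - g t)).
Proof.
move=> mD fi gi.
have : mu.-integrable D ((EFin \o f) \- (EFin \o g))%E by apply: integrableB.
by apply: eq_integrable => // t _; rewrite EFinB.
Qed.

Lemma Rint_cst (a b c : R) : a <= b -> \int[mu]_(t in `[a, b]) c = c * (b - a).
Proof.
move=> ab; rewrite Rintegral_cst; last exact: measurable_itv.
have := lebesgue_measure_itv `[a, b] => /= ->.
rewrite lte_fin; case: ltP => [_ //|ba] /=.
by have -> : b = a by [apply/eqP; rewrite eq_le ab ba]; rewrite subrr mulr0.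
Qed.

Lemma normr_Rintegral_le (D : set R) (f : R -> R) B : measurable D ->
  mu.-integrable D (EFin \o f) ->
  (\int[mu]_(t in D) (`|f t|)%:E <= B%:E)%E ->
  `|\int[mu]_(t in D) f t| <= B.
Proof.
move=> mD fi; apply: contraTT; rewrite -ltNge -ltNge -lte_fin => h.
apply: (lt_le_trans h); rewrite -(@Rintegral_EFin _ (fun t => `|f t|)) //.
  by rewrite lee_fin le_normr_Rintegral.
exact: integrable_norm.
Qed.

Lemma le_integral_EFin (D : set R) (f g : R -> R) : measurable D ->
  measurable_fun setT f -> measurable_fun setT g -> (forall t, 0 <= f t) ->
  (forall t, D t -> f t <= g t) ->
  (\int[mu]_(t in D) (f t)%:E <= \int[mu]_(t in D) (g t)%:E)%E.
Proof.
move=> mD mf mg f0 fg; apply: ge0_le_integral => //.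
- by move=> t _; rewrite lee_fin.
- by apply/measurable_EFinP; exact: measurable_funTS.
- by apply/measurable_EFinP; exact: measurable_funTS.
Qed.

Lemma subset_integral_EFin (A B : set R) (f : R -> R) : measurable A ->
  measurable B -> A `<=` B -> measurable_fun setT f -> (forall t, 0 <= f t) ->
  (\int[mu]_(t in A) (f t)%:E <= \int[mu]_(t in B) (f t)%:E)%E.
Proof.
move=> mA mB AB mf f0; apply: ge0_subset_integral => //.
- by apply/measurable_EFinP; exact: measurable_funTS.
- by move=> t _; rewrite lee_fin.
Qed.

Lemma integralD_EFin_ge0 (D : set R) (f g : R -> R) : measurable D ->
  measurable_fun setT f -> measurable_fun setT g -> (forall t, 0 <= f t) ->
  (forall t, 0 <= g t) ->
  (\int[mu]_(t in D) (f t + g t)%:E =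
   \int[mu]_(t in D) (f t)%:E + \int[mu]_(t in D) (g t)%:E)%E.
Proof.
move=> mD mf mg f0 g0; under eq_integral do rewrite EFinD.
rewrite ge0_integralD //; try by move=> t _; rewrite lee_fin.
- by apply/measurable_EFinP; exact: measurable_funTS.
- by apply/measurable_EFinP; exact: measurable_funTS.
Qed.

Lemma integralZ_EFin_ge0 (D : set R) c (f : R -> R) : measurable D ->
  measurable_fun setT f -> (forall t, 0 <= f t) -> 0 <= c ->
  (\int[mu]_(t in D) (c * f t)%:E = c%:E * \int[mu]_(t in D) (f t)%:E)%E.
Proof.
move=> mD mf f0 c0; under eq_integral do rewrite EFinM.
rewrite ge0_integralZl_EFin //; first by move=> t _; rewrite lee_fin.
by apply/measurable_EFinP; exact: measurable_funTS.
Qed.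

Lemma ge0_integral_itv_split (a b : R) (c : itv_bound R) (h : R -> R) :
  a <= b -> (BLeft b <= c)%O ->
  measurable_fun setT h -> (forall t, 0 <= h t) ->
  (\int[mu]_(t in [set` Interval (BLeft a) c]) (h t)%:E =
   \int[mu]_(t in `[a, b[) (h t)%:E + 
   \int[mu]_(t in [set` Interval (BLeft b) c]) (h t)%:E)%E.
Proof.
move=> ab bc mh h0.
have -> : [set` Interval (BLeft a) c] = `[a, b[%classic `|` [set` Interval (BLeft b) c].
  by rewrite -itv_bndbnd_setU.
rewrite ge0_integral_setU //.
- by apply/measurable_EFinP; exact: measurable_funTS.
- by move=> t _; rewrite lee_fin.
apply/disj_set2P; apply/seteqP; split => t //= [].
by rewrite !in_itv /= => /andP[_ tb] /andP[bt _]; move: tb; rewrite ltNge bt.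
Qed.

(** On the block from [T * 2 ^+ j] to [T * 2 ^+ j.+1] the weight [v] is at most its left value and
    [h] has integral at most [A * (T * 2 ^+ j)], so the block contributes at most [A * D * x ^+ j];
    the geometric series does the rest. The tail estimates below are all of this shape. *)
Lemma dyadic_integral_le (T A D x : R) (h v : R -> R) :
  0 < T -> 0 <= A -> 0 <= D -> 0 <= x < 1 ->
  measurable_fun setT h -> measurable_fun setT v ->
  (forall t, 0 <= h t) -> (forall t, 0 <= v t) ->
  (forall s t, T <= s -> s <= t -> v t <= v s) ->
  (forall tau, T <= tau -> (\int[mu]_(t in `[tau, (2 * tau)%R[) (h t)%:E <= (A * tau)%:E)%E) ->
  (forall j : nat, T * 2 ^+ j * v (T * 2 ^+ j) <= D * x ^+ j) ->
  (\int[mu]_(t in `[T, +oo[) (h t * v t)%:E <= (A * (D / (1 - x)))%:E)%E.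
Proof.
move=> T0 A0 D0 /andP[x0 x1] mh mv h0 v0 vmono hA hD.
have T2 j : 0 < T * 2 ^+ j by rewrite mulr_gt0 // exprn_gt0.
have TT j : T <= T * 2 ^+ j by rewrite -[leLHS]mulr1 ler_pM2l // exprn_ege1 // ler1n.
have m_hv : measurable_fun setT (fun t => h t * v t) by exact: measurable_funM.
have hv0 t : 0 <= h t * v t by rewrite mulr_ge0.
have fin n : (\int[mu]_(t in `[T, (T * 2 ^+ n)%R[) (h t * v t)%:E
    <= (A * (D * \sum_(j < n) x ^+ j))%:E)%E.
  elim: n => [|n IH].
    by rewrite big_ord0 !mulr0 expr0 mulr1 set_itv_ge ?integral_set0 // bnd_simp ltxx.
  rewrite (@ge0_integral_itv_split T (T * 2 ^+ n)) //.
    rewrite big_ord_recr /= mulrDr mulrDr EFinD; apply: leeD => //.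
    rewrite exprS mulrCA.
    have le1 : (\int[mu]_(t in `[(T * 2 ^+ n)%R, (2 * (T * 2 ^+ n))%R[) (h t * v t)%:E <=
       \int[mu]_(t in `[(T * 2 ^+ n)%R, (2 * (T * 2 ^+ n))%R[)
          ((v (T * 2 ^+ n))%:E * (h t)%:E))%E.
      apply: ge0_le_integral => //.
      - by move=> t _; rewrite lee_fin.
      - by apply/measurable_EFinP; exact: measurable_funTS.
      - apply/measurable_EFinP; apply: measurable_funTS; exact: measurable_funM.
      - move=> t /=; rewrite in_itv /= => /andP[t1 t2].
        by rewrite -EFinM lee_fin mulrC ler_wpM2r // vmono.
    apply: (le_trans le1); rewrite ge0_integralZl_EFin //.
    - apply: (@le_trans _ _ ((v (T * 2 ^+ n))%:E * (A * (T * 2 ^+ n))%:E)%E).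
        by apply: lee_wpmul2l; [rewrite lee_fin | exact: hA].
      by rewrite -EFinM lee_fin mulrCA ler_wpM2l // mulrC.
    - by move=> t _; rewrite lee_fin.
    - by apply/measurable_EFinP; exact: measurable_funTS.
  by rewrite bnd_simp ler_pM2l // ler_eXn2l // ltr1n.
have sumle n : \sum_(j < n) x ^+ j <= (1 - x)^-1.
  rewrite -[leRHS]mul1r ler_pdivlMr ?subr_gt0 //.
  have -> : (\sum_(j < n) x ^+ j) * (1 - x) = 1 - x ^+ n.
    have /= := subrX1 x n; lra.
  by rewrite gerBl exprn_ge0.
(* Monotone convergence along the bounded intervals [[T, T * 2 ^+ n[]. *)
have cvgI := @ge0_nondecreasing_set_cvg_integral _ (measurableTypeR R) R
   (fun n => `[T, T * 2 ^+ n[%classic) (fun t => (h t * v t)%:E) mu.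
have -> : `[T, +oo[%classic = \bigcup_n `[T, (T * 2 ^+ n)[%classic.
  apply/seteqP; split => t /=.
    rewrite in_itv /= andbT => Tt.
    exists (Num.truncn (t / T)).+1 => //=; rewrite in_itv /= Tt /=.
    rewrite mulrC -ltr_pdivrMr //.
    apply: (lt_le_trans (truncnS_gt _)).
    by rewrite -natrX ler_nat ltnW // ltn_expl.
  by move=> [n _] /=; rewrite !in_itv /= andbT => /andP[].
apply: (cvge_to_le (cvgI _ _ _ _)); first 1 last.
- by move=> i; exact: measurable_itv.
- by move=> i; apply/measurable_EFinP; exact: measurable_funTS.
- by move=> i t _; rewrite lee_fin.
- apply: nearW => n; apply: (le_trans (fin n)).
  by rewrite lee_fin ler_wpM2l // ler_wpM2l.
- move=> n m nm; rewrite subsetEset => t /=.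
  rewrite !in_itv /= => /andP[-> /=] /lt_le_trans; apply.
  by rewrite ler_pM2l // ler_eXn2l // ltr1n.
Qed.

End BoundedMeasurable.

(** * Bohr means and uniqueness *)

Section Means.
Variable R : realType.
Local Notation mu := (@lebesgue_measure R).

Definition has_mean (g : R -> R) (m : R) :=
  L^-1 * (\int[mu]_(t in `[0, L]) g t) @[L --> +oo%R] --> m.

Lemma has_mean_unique g m m' : has_mean g m -> has_mean g m' -> m = m'.
Proof. by move=> h h'; apply: (cvg_unique _ h h'). Qed.

Lemma eq_has_mean f g m : f =1 g -> has_mean f m -> has_mean g m.
Proof. by move=> /funext ->. Qed.

Lemma has_meanD f g m n : bounded_meas f -> bounded_meas g ->
  has_mean f m -> has_mean g n -> has_mean (fun t => f t + g t) (m + n).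
Proof.
move=> bf bg hf hg; rewrite /has_mean.
rewrite (_ : (fun L => _) = (fun L => L^-1 * (\int[mu]_(t in `[0, L]) f t) +
    L^-1 * (\int[mu]_(t in `[0, L]) g t))); first exact: cvgD.
by apply/funext => L; rewrite RintD ?mulrDr //; exact: integrable_itv.
Qed.

Lemma has_meanZ c f m : bounded_meas f ->
  has_mean f m -> has_mean (fun t => c * f t) (c * m).
Proof.
move=> bf hf; rewrite /has_mean.
rewrite (_ : (fun L => _) = (fun L => c * (L^-1 * \int[mu]_(t in `[0, L]) f t))).
  by apply: cvgM => //; exact: cvg_cst.
by apply/funext => L; rewrite RintZ; [rewrite mulrCA | | exact: integrable_itv].
Qed.

Lemma has_mean0 : has_mean (fun=> 0) 0.
Proof.
rewrite /has_mean; under eq_fun do rewrite Rintegral_cst // mul0r mulr0.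
exact: cvg_cst.
Qed.

Lemma has_mean_sum (I : eqType) (r : seq I) (F : I -> R -> R) (m : I -> R) :
  (forall i, bounded_meas (F i)) -> (forall i, i \in r -> has_mean (F i) (m i)) ->
  has_mean (fun t => \sum_(i <- r) F i t) (\sum_(i <- r) m i).
Proof.
move=> bF; elim: r => [|i r IH] hF.
  by rewrite big_nil; under eq_fun do rewrite big_nil; exact: has_mean0.
rewrite big_cons; under eq_fun do rewrite big_cons.
apply: has_meanD => //; first exact: bounded_meas_sum.
  by apply: hF; rewrite mem_head.
by apply: IH => j jr; apply: hF; rewrite in_cons jr orbT.
Qed.

Lemma has_mean_le f g m n : bounded_meas f -> bounded_meas g ->
  (forall t, f t <= g t) -> has_mean f m -> has_mean g n -> m <= n.
Proof.
move=> bf bg fg hf hg; apply: (ler_cvg_to hf hg).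
near=> L; rewrite ler_wpM2l ?invr_ge0 //.
by apply: le_Rintegral => //; exact: integrable_itv.
Unshelve. all: by end_near. Qed.

Lemma is_derive_sinM (a t : R) : is_derive t (1 : R) (fun t : R => sin (a * t)) (a * cos (a * t)).
Proof.
have hid : is_derive t (1 : R) (fun t : R => a * t) a.
  have -> : (fun t : R => a * t) = (a \*: (@id R)) by [].
  by apply: is_derive_eq; rewrite /GRing.scale /= mulr1.
by rewrite mulrC; exact: (@is_derive1_comp R (@sin R) (fun t : R => a * t)).
Qed.

Lemma is_derive_cosM (a t : R) : is_derive t (1 : R) (fun t : R => cos (a * t)) (- (a * sin (a * t))).
Proof.
have hid : is_derive t (1 : R) (fun t : R => a * t) a.
  have -> : (fun t : R => a * t) = (a \*: (@id R)) by [].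
  by apply: is_derive_eq; rewrite /GRing.scale /= mulr1.
by rewrite -mulrN mulrC; exact: (@is_derive1_comp R (@cos R) (fun t : R => a * t)).
Qed.

Lemma continuous_mulr_id (a : R) : continuous (fun t : R => a * t).
Proof. by move=> t; apply: cvgM; [exact: cvg_cst | exact: cvg_id]. Qed.

Lemma continuous_sinM (a : R) : continuous (fun t : R => sin (a * t)).
Proof.
move=> t; apply: (continuous_comp (f := fun t => a * t)); first exact: continuous_mulr_id.
exact: continuous_sin.
Qed.

Lemma continuous_cosM (a : R) : continuous (fun t : R => cos (a * t)).
Proof.
move=> t; apply: (continuous_comp (f := fun t => a * t)); first exact: continuous_mulr_id.
exact: continuous_cos.
Qed.

Lemma Rintegral_FTC2 (f F : R -> R) (a b : R) : a < b -> continuous f ->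
  (forall t : R, is_derive t (1 : R) F (f t)) -> \int[mu]_(t in `[a, b]) f t = F b - F a.
Proof.
move=> ab cf dF; rewrite /Rintegral (@continuous_FTC2 _ f F) //.
- exact: continuous_subspaceT.
- have cF t : {for t, continuous F}.
    by apply: differentiable_continuous; apply/derivable1_diffP; have [] := dF t.
  split => //.
  + by apply: cvg_at_right_filter; exact: cF.
  + by apply: cvg_at_left_filter; exact: cF.
- by move=> t _; rewrite derive1E derive_val.
Qed.

Lemma Rintegral_cosM (a x y : R) : a != 0 -> x < y ->
  \int[mu]_(t in `[x, y]) cos (a * t) = (sin (a * y) - sin (a * x)) / a.
Proof.
move=> a0 xy.
have dF (t : R) : is_derive t (1 : R) (fun t => a^-1 * sin (a * t)) (cos (a * t)).
  have -> : (fun t => a^-1 * sin (a * t)) = (a^-1) \*: (fun t => sin (a * t)) by [].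
  have H := is_derive_sinM a t; apply: is_derive_eq.
  by rewrite -[_ *: _]/(_ * _) mulrA mulVf // mul1r.
have := @Rintegral_FTC2 (fun t => cos (a * t)) (fun t => a^-1 * sin (a * t)) x y xy (@continuous_cosM a) dF.
by rewrite -mulrBr mulrC.
Qed.

Lemma Rintegral_sinM (a x y : R) : a != 0 -> x < y ->
  \int[mu]_(t in `[x, y]) sin (a * t) = (cos (a * x) - cos (a * y)) / a.
Proof.
move=> a0 xy.
have dF (t : R) : is_derive t (1 : R) (fun t => - a^-1 * cos (a * t)) (sin (a * t)).
  have -> : (fun t => - a^-1 * cos (a * t)) = (- a^-1) \*: (fun t => cos (a * t)) by [].
  have H := is_derive_cosM a t; apply: is_derive_eq.
  by rewrite -[_ *: _]/(_ * _) mulNr mulrN opprK mulrA mulVf // mul1r.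
have := @Rintegral_FTC2 (fun t => sin (a * t)) (fun t => - a^-1 * cos (a * t)) x y xy (@continuous_sinM a) dF.
by rewrite -mulrBr mulNr -mulrN opprB mulrC.
Qed.

Lemma has_mean_bounded_integral f B : 
  (forall L, 0 < L -> `|\int[mu]_(t in `[0, L]) f t| <= B) -> has_mean f 0.
Proof.
move=> fB; apply/cvgrPdist_le => e e0; near=> L.
have L0 : 0 < L by near: L; exact: nbhs_pinfty_gt.
rewrite sub0r normrN normrM normfV (gtr0_norm L0).
apply: (@le_trans _ _ (L^-1 * B)).
  by apply: ler_wpM2l; [rewrite invr_ge0 ltW | exact: fB].
rewrite mulrC ler_pdivrMr // mulrC -ler_pdivrMr //; near: L; apply: nbhs_pinfty_ge; exact: num_real.
Unshelve. all: by end_near. Qed.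

Lemma has_mean_cos a : has_mean (fun t => cos (a * t)) (a == 0)%:R.
Proof.
have [->|a0] := eqVneq a 0.
  rewrite /has_mean; apply: cvg_near_cst; near=> L.
  have L0 : 0 < L by near: L; exact: nbhs_pinfty_gt.
  under eq_Rintegral do rewrite mul0r cos0.
  by rewrite Rint_cst ?ltW // subr0 mul1r mulVf // gt_eqF.
apply: (@has_mean_bounded_integral _ (2 / `|a|)) => L L0.
rewrite Rintegral_cosM // normrM normfV ler_pM2r ?invr_gt0 ?normr_gt0 //.
by rewrite (le_trans (ler_normB _ _)) // (_ : 2 = 1 + 1) // lerD // sin_max.
Unshelve. all: by end_near. Qed.

Lemma has_mean_sin a : has_mean (fun t => sin (a * t)) 0.
Proof.
have [->|a0] := eqVneq a 0.
  by under eq_fun do rewrite mul0r sin0; exact: has_mean0.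
apply: (@has_mean_bounded_integral _ (2 / `|a|)) => L L0.
rewrite Rintegral_sinM // normrM normfV ler_pM2r ?invr_gt0 ?normr_gt0 //.
by rewrite (le_trans (ler_normB _ _)) // (_ : 2 = 1 + 1) // lerD // cos_max.
Qed.

End Means.

Section BohrUniqueness.
Variable R : realType.
Local Notation mu := (@lebesgue_measure R).

Lemma mul_cos_cos (x y : R) : cos x * cos y = 2^-1 * cos (x - y) + 2^-1 * cos (x + y).
Proof. rewrite cosB cosD; lra. Qed.
Lemma mul_sin_sin (x y : R) : sin x * sin y = 2^-1 * cos (x - y) - 2^-1 * cos (x + y).
Proof. rewrite cosB cosD; lra. Qed.
Lemma mul_sin_cos (x y : R) : sin x * cos y = 2^-1 * sin (x + y) + 2^-1 * sin (x - y).
Proof. rewrite sinB sinD; lra. Qed.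

(** A list of pairs (a, b) stands for the exponential polynomial with terms a exp(i b t); [cos] and
    [sin] give its real and imaginary parts. Frequencies may repeat, so its quadratic mean [sqmean]
    runs over all pairs of equal frequencies. *)
Definition freq_sum (l : seq (R * R)) (g : R -> R) (t : R) :=
  \sum_(p <- l) p.1 * g (p.2 * t).

Definition sqmod (l : seq (R * R)) (t : R) :=
  freq_sum l (@cos R) t ^+ 2 + freq_sum l (@sin R) t ^+ 2.

Definition sqmean (l : seq (R * R)) :=
  \sum_(p <- l) \sum_(p' <- l) p.1 * p'.1 * (p.2 - p'.2 == 0)%:R.

Definition mull (l1 l2 : seq (R * R)) :=
  [seq (p.1 * p'.1, p.2 + p'.2) | p <- l1, p' <- l2].

Definition nonneg (l : seq (R * R)) := forall p, p \in l -> 0 <= p.1.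

Lemma sqmod_ge0 l t : 0 <= sqmod l t.
Proof. by rewrite addr_ge0 // sqr_ge0. Qed.

Lemma sqmodE l t : sqmod l t =
  \sum_(p <- l) \sum_(p' <- l) p.1 * p'.1 * cos ((p.2 - p'.2) * t).
Proof.
rewrite /sqmod /freq_sum !expr2 !big_distrlr -big_split; apply: eq_bigr => p _.
rewrite -big_split; apply: eq_bigr => p' _ /=.
rewrite mulrBl cosB; ring.
Qed.

Lemma bounded_meas_cos_shift (a x : R) : bounded_meas (fun t => cos (a * (t - x))).
Proof.
have -> : (fun t => cos (a * (t - x))) = (fun t => cos (a * (- x + t))).
  by apply/funext => t; rewrite addrC.
exact: (bounded_meas_shift (- x) (bounded_meas_cos a)).
Qed.

Lemma has_mean_cos_shift (a x : R) : has_mean (fun t => cos (a * (t - x))) (a == 0)%:R.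
Proof.
have -> : (fun t => cos (a * (t - x))) =
    (fun t => cos (a * x) * cos (a * t) + sin (a * x) * sin (a * t)).
  by apply/funext => t; rewrite mulrBr cosB mulrC [sin _ * _]mulrC.
have -> : (a == 0)%:R = cos (a * x) * (a == 0)%:R + sin (a * x) * 0.
  by case: eqVneq => [->|]; rewrite ?mul0r ?cos0 ?mulr0 ?mulr1 addr0.
by apply: has_meanD; try apply: has_meanZ;
  try apply: bounded_measM; first [exact: bounded_meas_cst
  | exact: bounded_meas_cos | exact: bounded_meas_sin
  | exact: has_mean_cos | exact: has_mean_sin].
Qed.

Lemma bounded_meas_sqmod l x : bounded_meas (fun t => sqmod l (t - x)).
Proof.
under eq_fun do rewrite sqmodE.
apply: bounded_meas_sum => p; apply: bounded_meas_sum => p'.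
by apply: bounded_measM; [exact: bounded_meas_cst | exact: bounded_meas_cos_shift].
Qed.

Lemma has_mean_sqmod l x : has_mean (fun t => sqmod l (t - x)) (sqmean l).
Proof.
under eq_fun do rewrite sqmodE.
have bc (p p' : R * R) : bounded_meas (fun t => p.1 * p'.1 * cos ((p.2 - p'.2) * (t - x))).
  by apply: bounded_measM; [exact: bounded_meas_cst | exact: bounded_meas_cos_shift].
apply: has_mean_sum => [p|p _]; first exact: bounded_meas_sum.
apply: has_mean_sum => [//|p' _].
by apply: has_meanZ; [exact: bounded_meas_cos_shift | exact: has_mean_cos_shift].
Qed.

Lemma nonneg_mull l1 l2 : nonneg l1 -> nonneg l2 -> nonneg (mull l1 l2).
Proof.
move=> h1 h2 q /allpairsP[[p p'] [/= pl p'l ->]] /=.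
by apply: mulr_ge0; [exact: h1 | exact: h2].
Qed.

Lemma freq_sum_mull_cos l1 l2 t : freq_sum (mull l1 l2) (@cos R) t =
  freq_sum l1 (@cos R) t * freq_sum l2 (@cos R) t -
  freq_sum l1 (@sin R) t * freq_sum l2 (@sin R) t.
Proof.
rewrite /freq_sum big_allpairs_dep !big_distrlr /= -sumrB; apply: eq_bigr => p _.
rewrite -sumrB; apply: eq_bigr => p' _ /=; rewrite mulrDl cosD; ring.
Qed.

Lemma freq_sum_mull_sin l1 l2 t : freq_sum (mull l1 l2) (@sin R) t =
  freq_sum l1 (@sin R) t * freq_sum l2 (@cos R) t +
  freq_sum l1 (@cos R) t * freq_sum l2 (@sin R) t.
Proof.
rewrite /freq_sum big_allpairs_dep !big_distrlr /= -big_split; apply: eq_bigr => p _.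
rewrite -big_split; apply: eq_bigr => p' _ /=; rewrite mulrDl sinD; ring.
Qed.

Lemma sqmod_mull l1 l2 t : sqmod (mull l1 l2) t = sqmod l1 t * sqmod l2 t.
Proof. rewrite /sqmod freq_sum_mull_cos freq_sum_mull_sin; ring. Qed.

(** A geometric sum of exponentials; its squared modulus is [r] times a Fejer kernel. *)
Definition dirichlet (r : nat) (a : R) : seq (R * R) :=
  [seq (1, n%:R * a) | n <- iota 0 r].

Lemma nonneg_dirichlet r a : nonneg (dirichlet r a).
Proof. by move=> p /mapP[n _ ->]. Qed.

(** Real and imaginary parts of (1 - z)(1 + z + ... + z^(r-1)) = 1 - z^r at z = exp(i a t). *)
Lemma dirichlet_telescope r a t :
  (1 - cos (a * t)) * freq_sum (dirichlet r a) (@cos R) t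
    + sin (a * t) * freq_sum (dirichlet r a) (@sin R) t = 1 - cos (r%:R * a * t) /\
  (1 - cos (a * t)) * freq_sum (dirichlet r a) (@sin R) t
    - sin (a * t) * freq_sum (dirichlet r a) (@cos R) t = - sin (r%:R * a * t).
Proof.
have rec n g : freq_sum (dirichlet n.+1 a) g t = freq_sum (dirichlet n a) g t + g (n%:R * a * t).
  rewrite /freq_sum /dirichlet -addn1 iotaD map_cat big_cat /= big_seq1 /=.
  by rewrite mul1r add0n.
elim: r => [|r [IH1 IH2]].
  by rewrite /freq_sum /dirichlet /= !big_nil !mul0r cos0 sin0; split; ring.
have -> : r.+1%:R * a * t = r%:R * a * t + a * t by rewrite -natr1; ring.
rewrite !rec cosD sinD.
have E1 : forall x y z w u v : R, (1 - z) * (x + u) + w * (y + v) =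
  ((1 - z) * x + w * y) + (1 - z) * u + w * v by move=> *; ring.
have E2 : forall x y z w u v : R, (1 - z) * (y + v) - w * (x + u) =
  ((1 - z) * y - w * x) + (1 - z) * v - w * u by move=> *; ring.
rewrite E1 E2 IH1 IH2; split; ring.
Qed.

(** Squared moduli in the telescoped identity, with |1 - exp(i u)|^2 = 2 (1 - cos u) on both
    sides. *)
Lemma sqmod_dirichlet_le r a t : (1 - cos (a * t)) * sqmod (dirichlet r a) t <= 2.
Proof.
have [h1 h2] := dirichlet_telescope r a t.
have c1 := cos2Dsin2 (a * t); have c2 := cos2Dsin2 (r%:R * a * t).
have c3 := cos_geN1 (r%:R * a * t).
rewrite /sqmod; move: h1 h2 c1 c2 c3.
move: (freq_sum _ cos t) (freq_sum _ sin t) (cos (a * t)) (sin (a * t))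
  (cos (r%:R * a * t)) (sin (r%:R * a * t)) => X Y C S C' S' h1 h2 c1 c2 c3.
have : ((1 - C) * X + S * Y) ^+ 2 + ((1 - C) * Y - S * X) ^+ 2 = (1 - C') ^+ 2 + (- S') ^+ 2.
  by rewrite h1 h2.
have -> : ((1 - C) * X + S * Y) ^+ 2 + ((1 - C) * Y - S * X) ^+ 2 =
  (1 - C *+ 2 + (C ^+ 2 + S ^+ 2)) * (X ^+ 2 + Y ^+ 2) by ring.
have -> : (1 - C') ^+ 2 + (- S') ^+ 2 = 1 - C' *+ 2 + (C' ^+ 2 + S' ^+ 2) by ring.
rewrite c1 c2; set Z := X ^+ 2 + Y ^+ 2; lra.
Qed.

Lemma ler_bigsum_single (I : eqType) (r : seq I) (F : I -> R) i :
  i \in r -> (forall j, j \in r -> 0 <= F j) -> F i <= \sum_(j <- r) F j.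
Proof.
move=> ir F0; rewrite (big_rem i) //= lerDl big_seq sumr_ge0 // => j jr.
by apply: F0; exact: mem_rem jr.
Qed.

(* Only the diagonal terms of the Dirichlet sum are kept: the others contribute
   nonnegative means because all coefficients are nonnegative. *)
Lemma sqmean_dirichlet_ge r a l : nonneg l ->
  r%:R * sqmean l <= sqmean (mull (dirichlet r a) l).
Proof.
move=> hl.
have -> : r%:R * sqmean l = \sum_(n <- iota 0 r) sqmean l.
  by rewrite big_const_seq count_predT size_iota iter_addr_0 mulr_natl.
rewrite /sqmean /mull big_allpairs_dep /= big_map.
rewrite big_seq [leRHS]big_seq; apply: ler_sum => n nr.
rewrite big_seq [leRHS]big_seq; apply: ler_sum => p pl.
rewrite big_allpairs_dep /= big_map.
pose F m := \sum_(p' <- l) 1 * p.1 * (1 * p'.1) * (n%:R * a + p.2 - (m%:R * a + p'.2) == 0)%:R.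
have F0 m : 0 <= F m.
  rewrite /F big_seq sumr_ge0 // => p' p'l; rewrite !mul1r.
  by rewrite !mulr_ge0 ?hl ?ler0n.
apply: le_trans (@ler_bigsum_single _ _ F n nr _) => [|m _ //].
rewrite /F big_seq [leRHS]big_seq; apply: ler_sum => p' p'l.
have -> : n%:R * a + p.2 - (n%:R * a + p'.2) = p.2 - p'.2 by ring.
by rewrite !mul1r.
Qed.

(** The squared modulus is, up to a factor, a product of Fejer kernels in the manner of Bochner and
    Fejer, taken over the frequencies themselves instead of a rational basis of them. Without
    independence the mean of the product is not computed, only compared between lists. *)
Definition bohr_list (r : nat) (s : seq R) : seq (R * R) :=
  foldr (fun a acc => mull (dirichlet r a) acc) [:: (1, 0)] s.

Lemma nonneg_bohr_list r s : nonneg (bohr_list r s).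
Proof.
elim: s => [|a s IH] /=; first by move=> p; rewrite inE => /eqP ->.
by apply: nonneg_mull => //; exact: nonneg_dirichlet.
Qed.

Lemma sqmod_bohr_list r s t :
  sqmod (bohr_list r s) t = \prod_(a <- s) sqmod (dirichlet r a) t.
Proof.
elim: s => [|a s IH] /=.
  by rewrite big_nil /sqmod /freq_sum !big_seq1 /= mul0r cos0 sin0; ring.
by rewrite big_cons sqmod_mull IH.
Qed.

Lemma sqmean_bohr_list_gt0 r s : (0 < r)%N -> 0 < sqmean (bohr_list r s).
Proof.
move=> r0; elim: s => [|a s IH] /=.
  by rewrite /sqmean !big_seq1 /= subrr eqxx !mulr1.
apply: lt_le_trans (sqmean_dirichlet_ge _ _ (@nonneg_bohr_list r s)).
by rewrite mulr_gt0 // ltr0n.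
Qed.

Lemma sqmod_bohr_rem r s a t : a \in s ->
  sqmod (bohr_list r s) t = sqmod (mull (dirichlet r a) (bohr_list r (rem a s))) t.
Proof. by move=> /(big_rem a) E; rewrite sqmod_mull !sqmod_bohr_list E. Qed.

(** Deleting one Dirichlet factor divides the mean by at least [r]. Moving [a] to the front permutes
    the terms, so the two kernels coincide as functions and uniqueness of means identifies their
    quadratic means. *)
Lemma sqmean_bohr_rem r s a : a \in s ->
  r%:R * sqmean (bohr_list r (rem a s)) <= sqmean (bohr_list r s).
Proof.
move=> sa; apply: le_trans (sqmean_dirichlet_ge r a (@nonneg_bohr_list r _)) _.
suff -> : sqmean (bohr_list r s) = sqmean (mull (dirichlet r a) (bohr_list r (rem a s))) by [].
apply: (@has_mean_unique _ (fun t => sqmod (bohr_list r s) (t - 0))).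
  exact: has_mean_sqmod.
have -> : (fun t => sqmod (bohr_list r s) (t - 0)) =
    (fun t => sqmod (mull (dirichlet r a) (bohr_list r (rem a s))) (t - 0)).
  by apply/funext => t; exact: sqmod_bohr_rem.
exact: has_mean_sqmod.
Qed.

(** With [sqmean_bohr_rem], this makes the mean of [1 - cos (a * t)] against the kernel at most
    [2 / r] times the mass of the kernel: the quantitative form of concentration at almost
    periods. *)
Lemma one_sub_cos_bohr_le r s a t : a \in s ->
  (1 - cos (a * t)) * sqmod (bohr_list r s) t <= 2 * sqmod (bohr_list r (rem a s)) t.
Proof.
move=> sa; rewrite (sqmod_bohr_rem r t sa) sqmod_mull mulrA ler_wpM2r //.
  exact: sqmod_ge0.
exact: sqmod_dirichlet_le.
Qed.

Definition rpoly (l : seq (R * R * R)) (t : R) :=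
  \sum_(s <- l) (s.1.1 * cos (s.2 * t) + s.1.2 * sin (s.2 * t)).

Lemma bounded_meas_rpoly l : bounded_meas (rpoly l).
Proof.
apply: bounded_meas_sum => s; apply: bounded_measD; apply: bounded_measM;
  first [exact: bounded_meas_cst | exact: bounded_meas_cos | exact: bounded_meas_sin].
Qed.

(** The kernel controls [1 - cos] only. Since sin^2 u is at most 2 (1 - cos u), a weighted
    arithmetic-geometric inequality trades the sine for it at the price [eta]. *)
Lemma normr_sin_le (eta u : R) : 0 < eta -> `|sin u| <= eta + eta^-1 * (1 - cos u).
Proof.
move=> eta0; have c1 := cos2Dsin2 u; have c2 := cos_le1 u; have c3 := cos_geN1 u.
rewrite -(ler_pM2l eta0) mulrDr mulrA mulfV ?gt_eqF // mul1r.
have h : `|sin u| ^+ 2 = sin u ^+ 2 by rewrite real_normK // num_real.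
have := sqr_ge0 (`|sin u| - eta *+ 2); rewrite sqrrB h.
have : sin u ^+ 2 <= 2 * (1 - cos u).
  have -> : sin u ^+ 2 = (1 - cos u) * (1 + cos u) by rewrite sin2cos2; ring.
  rewrite mulrC ler_wpM2r //; lra.
move: (`|sin u|) (sin u ^+ 2) => z y; nra.
Qed.

Lemma rpoly_sub_le l x t (eta : R) : 0 < eta ->
  `|rpoly l x - rpoly l t| <= \sum_(s <- l) (`|s.1.1| + `|s.1.2|) *
     (eta + (1 + eta^-1) * (1 - cos (s.2 * (t - x)))).
Proof.
move=> eta0; rewrite /rpoly -sumrB; apply: (le_trans (ler_norm_sum _ _ _)).
apply: ler_sum => s _.
set u := s.2 * (t - x).
have -> : s.2 * t = s.2 * x + u by rewrite /u; ring.
rewrite cosD sinD.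
have hu := normr_sin_le u eta0; have c2 := cos_le1 u.
have nc := cos_max (s.2 * x); have ns := sin_max (s.2 * x).
have gen (a y z : R) : `|y| <= 1 -> `|z| <= 1 ->
   `|a * (y * (1 - cos u) + z * sin u)| <= `|a| * (eta + (1 + eta^-1) * (1 - cos u)).
  move=> y1 z1; rewrite normrM ler_wpM2l //.
  apply: (le_trans (ler_normD _ _)); rewrite !normrM (ger0_norm (_ : 0 <= 1 - cos u)); last lra.
  have : `|y| * (1 - cos u) <= 1 * (1 - cos u) by rewrite ler_wpM2r //; lra.
  have : `|z| * `|sin u| <= 1 * `|sin u| by rewrite ler_wpM2r.
  lra.
have -> : s.1.1 * cos (s.2 * x) + s.1.2 * sin (s.2 * x) -
  (s.1.1 * (cos (s.2 * x) * cos u - sin (s.2 * x) * sin u) +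
   s.1.2 * (sin (s.2 * x) * cos u + cos (s.2 * x) * sin u)) =
  s.1.1 * (cos (s.2 * x) * (1 - cos u) + sin (s.2 * x) * sin u) +
  s.1.2 * (sin (s.2 * x) * (1 - cos u) + (- cos (s.2 * x)) * sin u) by ring.
rewrite mulrDl; apply: (le_trans (ler_normD _ _)); apply: lerD; apply: gen => //.
by rewrite normrN.
Qed.

(** Expanding the kernel turns the mean of [F] against it into a finite combination of Bohr
    coefficients of [F], hence small with [d] once the kernel is fixed. *)
Lemma has_mean_mul_sqmod (F : R -> R) (m n : R -> R) l x d : bounded_meas F ->
  nonneg l ->
  (forall a, has_mean (fun t => F t * cos (a * t)) (m a)) ->
  (forall a, has_mean (fun t => F t * sin (a * t)) (n a)) ->
  (forall a, `|m a| <= d) -> (forall a, `|n a| <= d) ->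
  exists2 z, has_mean (fun t => F t * sqmod l (t - x)) z &
    `|z| <= \sum_(p <- l) \sum_(p' <- l) p.1 * p'.1 * (d + d).
Proof.
move=> bF hl hm hn md nd.
pose c (p p' : R * R) := p.1 * p'.1 * cos ((p.2 - p'.2) * x).
pose s (p p' : R * R) := p.1 * p'.1 * sin ((p.2 - p'.2) * x).
pose z := \sum_(p <- l) \sum_(p' <- l) (c p p' * m (p.2 - p'.2) + s p p' * n (p.2 - p'.2)).
have bc (p p' : R * R) : bounded_meas (fun t => F t * cos ((p.2 - p'.2) * t)).
  by apply: bounded_measM => //; exact: bounded_meas_cos.
have bs (p p' : R * R) : bounded_meas (fun t => F t * sin ((p.2 - p'.2) * t)).
  by apply: bounded_measM => //; exact: bounded_meas_sin.
exists z.
  have -> : (fun t => F t * sqmod l (t - x)) = (fun t =>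
    \sum_(p <- l) \sum_(p' <- l) (c p p' * (F t * cos ((p.2 - p'.2) * t)) +
                                  s p p' * (F t * sin ((p.2 - p'.2) * t)))).
    apply/funext => t; rewrite sqmodE mulr_sumr; apply: eq_bigr => p _.
    rewrite mulr_sumr; apply: eq_bigr => p' _; rewrite mulrBr cosB /c /s; ring.
  have bt (p p' : R * R) : bounded_meas (fun t => c p p' * (F t * cos ((p.2 - p'.2) * t)) +
                                  s p p' * (F t * sin ((p.2 - p'.2) * t))).
    by apply: bounded_measD; apply: bounded_measM => //; exact: bounded_meas_cst.
  apply: has_mean_sum => [p|p _]; first exact: bounded_meas_sum.
  apply: has_mean_sum => [//|p' _].
  apply: has_meanD.
  - by apply: bounded_measM => //; exact: bounded_meas_cst.
  - by apply: bounded_measM => //; exact: bounded_meas_cst.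
  - exact: has_meanZ.
  - exact: has_meanZ.
apply: (le_trans (ler_norm_sum _ _ _)); rewrite big_seq [leRHS]big_seq.
apply: ler_sum => p pl; apply: (le_trans (ler_norm_sum _ _ _)).
rewrite big_seq [leRHS]big_seq; apply: ler_sum => p' p'l.
have pp : 0 <= p.1 * p'.1 by rewrite mulr_ge0 ?hl.
apply: (le_trans (ler_normD _ _)); rewrite mulrDr /c /s !normrM -!mulrA -!normrM.
have d0 : 0 <= d by apply: le_trans (md 0).
have g (y w : R) : `|y| <= 1 -> `|w| <= d -> `|p.1 * (p'.1 * (y * w))| <= p.1 * (p'.1 * d).
  move=> y1 wd; rewrite mulrA normrM (ger0_norm pp) -mulrA.
  by rewrite !mulrA ler_wpM2l // normrM -[leRHS]mul1r ler_pM.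
by apply: lerD; apply: g => //; [exact: cos_max | exact: sin_max].
Qed.

(* A trigonometric polynomial that is uniformly close to functions with
   arbitrarily small Bohr coefficients is small everywhere: test it against the
   positive kernel [sqmod (bohr_list r s)], which concentrates at common almost
   periods of the frequencies in [s]. *)
Lemma rpoly_le_of_small_means l x kappa :
  (forall d, 0 < d -> exists F m n, [/\ bounded_meas F,
     forall t, `|rpoly l t - F t| <= kappa,
     forall a, has_mean (fun t => F t * cos (a * t)) (m a) /\
               has_mean (fun t => F t * sin (a * t)) (n a) &
     forall a, `|m a| <= d /\ `|n a| <= d]) ->
  `|rpoly l x| <= kappa.
Proof.
move=> H; apply/ler_addgt0Pr => e e0.
pose A := \sum_(s <- l) (`|s.1.1| + `|s.1.2|).
have A0 : 0 <= A by apply: sumr_ge0 => s _; rewrite addr_ge0.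
(* Three errors of size [e / 3]: [eta] pays for the constant term of [normr_sin_le], then [r] for
   the mean of [1 - cos], and finally [d], chosen after the kernel since it depends on [k] and [B],
   for the mean of [F] against it. *)
pose eta := e / (3 * (A + 1)).
have eta0 : 0 < eta by rewrite divr_gt0 // mulr_gt0 // ltr_wpDl.
pose r := (Num.truncn (3 * (A * (2 * (1 + eta^-1))) / e)).+1.
have rr : 3 * (A * (2 * (1 + eta^-1))) / e < r%:R by exact: truncnS_gt.
pose ss := [seq s.2 | s <- l].
pose L := bohr_list r ss.
have k0 : 0 < sqmean L by exact: sqmean_bohr_list_gt0.
set k := sqmean L in k0.
have hL : nonneg L := @nonneg_bohr_list r ss.
pose B := \sum_(p <- L) \sum_(p' <- L) p.1 * p'.1.
have B0 : 0 <= B.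
  rewrite /B big_seq; apply: sumr_ge0 => p pl; rewrite big_seq; apply: sumr_ge0 => p' p'l.
  by rewrite mulr_ge0 ?hL.
pose d := e * k / (3 * (2 * B + 1)).
have d0 : 0 < d by rewrite divr_gt0 ?mulr_gt0 // ltr_wpDl // mulr_ge0.
have [F [m [n [bF FF hmn mnd]]]] := H d d0.
have [z hz zle] := has_mean_mul_sqmod x bF hL (fun a => (hmn a).1) (fun a => (hmn a).2)
  (fun a => (mnd a).1) (fun a => (mnd a).2).
pose rest (s : R * R * R) := bohr_list r (rem s.2 ss).
pose Z t := kappa * sqmod L (t - x) + \sum_(s <- l) (`|s.1.1| + `|s.1.2|) *
     (eta * sqmod L (t - x) + (1 + eta^-1) * (2 * sqmod (rest s) (t - x))).
pose zz := kappa * k + \sum_(s <- l) (`|s.1.1| + `|s.1.2|) *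
     (eta * k + (1 + eta^-1) * (2 * sqmean (rest s))).
have bZ1 c l' : bounded_meas (fun t => c * sqmod l' (t - x)).
  by apply: bounded_measM; [exact: bounded_meas_cst | exact: bounded_meas_sqmod].
have bZ2 (s : R * R * R) : bounded_meas (fun t => eta * sqmod L (t - x) + (1 + eta^-1) * (2 * sqmod (rest s) (t - x))).
  by apply: bounded_measD => //; apply: bounded_measM => //; exact: bounded_meas_cst.
have bZ3 (s : R * R * R) : bounded_meas (fun t => (`|s.1.1| + `|s.1.2|) *
     (eta * sqmod L (t - x) + (1 + eta^-1) * (2 * sqmod (rest s) (t - x)))).
  by apply: bounded_measM => //; exact: bounded_meas_cst.
have bZ : bounded_meas Z by apply: bounded_measD => //; exact: bounded_meas_sum.
have hZ : has_mean Z zz.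
  apply: has_meanD => //; first exact: bounded_meas_sum.
    by apply: has_meanZ; [exact: bounded_meas_sqmod | exact: has_mean_sqmod].
  apply: has_mean_sum => // s _; apply: has_meanZ => //; apply: has_meanD => //.
  - by apply: bounded_measM => //; exact: bounded_meas_cst.
  - by apply: has_meanZ; [exact: bounded_meas_sqmod | exact: has_mean_sqmod].
  - apply: has_meanZ => //; apply: has_meanZ; [exact: bounded_meas_sqmod | exact: has_mean_sqmod].
have bFK : bounded_meas (fun t => F t * sqmod L (t - x)).
  by apply: bounded_measM => //; exact: bounded_meas_sqmod.
have key t : `|rpoly l x - F t| * sqmod L (t - x) <= Z t.
  have K0 := sqmod_ge0 L (t - x).
  have : `|rpoly l x - F t| <= \sum_(s <- l) (`|s.1.1| + `|s.1.2|) *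
     (eta + (1 + eta^-1) * (1 - cos (s.2 * (t - x)))) + kappa.
    have -> : rpoly l x - F t = (rpoly l x - rpoly l t) + (rpoly l t - F t) by ring.
    by apply: (le_trans (ler_normD _ _)); apply: lerD => //; exact: rpoly_sub_le.
  move=> /(ler_wpM2r K0) /le_trans; apply.
  rewrite mulrDl addrC /Z lerD2l mulr_suml big_seq [leRHS]big_seq.
  apply: ler_sum => s sl; rewrite -mulrA ler_wpM2l // ?addr_ge0 //.
  rewrite mulrDl lerD2l -mulrA ler_wpM2l //; first by rewrite addr_ge0 // invr_ge0 ltW.
  by apply: one_sub_cos_bohr_le; apply: map_f.
(* Averaging [key] over [t], with either sign, bounds [rpoly l x] times the mass [k] of the kernel;
   [z], the mean of [F] against it, is made negligible by [d]. *)
have mono sg : `|sg| = 1 -> sg * rpoly l x * k <= zz + sg * z.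
  move=> sg1; apply: (@has_mean_le _ (fun t => sg * rpoly l x * sqmod L (t - x))
     (fun t => Z t + sg * (F t * sqmod L (t - x)))) => //.
  - by apply: bounded_measD => //; apply: bounded_measM => //; exact: bounded_meas_cst.
  - move=> t; rewrite -lerBlDr mulrA -mulrBl -mulrBr.
    apply: le_trans (key t); rewrite ler_wpM2r ?sqmod_ge0 //.
    by rewrite (le_trans (ler_norm _)) // normrM sg1 mul1r.
  - by apply: has_meanZ; [exact: bounded_meas_sqmod | exact: has_mean_sqmod].
  - apply: has_meanD => //; last exact: has_meanZ.
    by apply: bounded_measM => //; exact: bounded_meas_cst.
have zle' : `|z| <= k * (e / 3).
  apply: (le_trans zle).
  have -> : \sum_(p <- L) \sum_(p' <- L) p.1 * p'.1 * (d + d) = B * (d + d).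
    by rewrite /B mulr_suml; apply: eq_bigr => p _; rewrite mulr_suml.
  have -> : k * (e / 3) = (2 * B + 1) * d by rewrite /d; field; rewrite gt_eqF // ltr_wpDl // mulr_ge0.
  have := ltW d0; move: (d) => d'; nra.
have zzle : zz <= k * (kappa + e / 3 + e / 3).
  have : \sum_(s <- l) (`|s.1.1| + `|s.1.2|) *
     (eta * k + (1 + eta^-1) * (2 * sqmean (rest s))) <=
     A * (eta * k + (1 + eta^-1) * (2 * (k / r%:R))).
    rewrite /A mulr_suml big_seq [leRHS]big_seq; apply: ler_sum => s sl.
    rewrite ler_wpM2l ?addr_ge0 // lerD2l ler_wpM2l ?addr_ge0 ?invr_ge0 ?(ltW eta0) //.
    rewrite ler_wpM2l // ler_pdivlMr ?ltr0n // mulrC.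
    by apply: sqmean_bohr_rem; apply: map_f.
  have e1 : A * (eta * k) <= k * (e / 3).
    have -> : k * (e / 3) = (A + 1) * (eta * k) by rewrite /eta; field; rewrite gt_eqF // ltr_wpDl.
    by rewrite ler_wpM2r ?lerDl // mulr_ge0 // ltW.
  have e2 : A * ((1 + eta^-1) * (2 * (k / r%:R))) <= k * (e / 3).
    have -> : A * ((1 + eta^-1) * (2 * (k / r%:R))) = k * (A * (2 * (1 + eta^-1)) / r%:R) by ring.
    rewrite ler_pM2l // ler_pdivrMr ?ltr0n //.
    move: rr; rewrite ltr_pdivrMr // mulrC => /ltW; lra.
  rewrite /zz; rewrite mulrDr => h; lra.
have fin sg : `|sg| = 1 -> sg * rpoly l x <= kappa + e.
  move=> sg1; rewrite -(ler_pM2r k0); apply: (le_trans (mono sg sg1)).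
  have : sg * z <= k * (e / 3).
    by apply: le_trans zle'; rewrite (le_trans (ler_norm _)) // normrM sg1 mul1r.
  move: zzle; have -> : (kappa + e) * k = k * (kappa + e / 3 + e / 3) + k * (e / 3) by field.
  lra.
rewrite ler_norml; apply/andP; split.
  by have := fin (-1); rewrite normrN1 mulN1r => /(_ erefl); lra.
by have := fin 1; rewrite normr1 mul1r => /(_ erefl).
Qed.

End BohrUniqueness.

(** * The trapezoid kernel *)

Section Kernel.
Variable R : realType.
Local Notation mu := (@lebesgue_measure R).

Lemma measurable_inv_sqr : measurable_fun setT (fun t : R => (t ^+ 2)^-1).
Proof.
have -> : (fun t : R => (t ^+ 2)^-1) = (fun t => (t ^+ 2) `^ (-1)).
  by apply/funext => t; rewrite powR_inv1 // sqr_ge0.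
apply: (measurableT_comp (measurable_powR (-1))).
exact: measurable_funX.
Qed.

Lemma measurable_inv : measurable_fun setT (fun t : R => t^-1).
Proof.
have -> : (fun t : R => t^-1) = (fun t => t * (t ^+ 2)^-1).
  apply/funext => t; have [->|t0] := eqVneq t 0; first by rewrite mul0r invr0.
  by rewrite expr2 invfM mulrA mulfV // mul1r.
by apply: measurable_funM => //; exact: measurable_inv_sqr.
Qed.

Lemma sin_lipschitz (x y : R) : `|sin x - sin y| <= `|x - y|.
Proof.
wlog xy : x y / x <= y => [H|].
  case/orP: (le_total x y) => /H //.
  by rewrite distrC [leRHS]distrC.
have [|c _] := @MVT_segment R (@sin R) (@cos R) x y xy.
  by apply: continuous_subspaceT; exact: continuous_sin.
by rewrite distrC [leRHS]distrC => ->; rewrite normrM ler_piMl // cos_max.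
Qed.

Lemma normr_sin_le_id (x : R) : `|sin x| <= `|x|.
Proof. by have := sin_lipschitz x 0; rewrite sin0 !subr0. Qed.

Lemma one_sub_cos (x : R) : 1 - cos x = 2 * sin (x / 2) ^+ 2.
Proof.
have -> : cos x = cos (x / 2 + x / 2) by congr cos; lra.
by rewrite cosD -!expr2 sin2cos2; ring.
Qed.

Lemma one_sub_cos_le (x : R) : 1 - cos x <= x ^+ 2 / 2.
Proof.
rewrite one_sub_cos.
have -> : x ^+ 2 / 2 = 2 * (x / 2) ^+ 2 by field.
rewrite ler_pM2l // -[sin _ ^+ 2]real_normK ?num_real //.
rewrite -[(x / 2) ^+ 2]real_normK ?num_real //.
by rewrite ler_sqr ?nnegrE // normr_sin_le_id.
Qed.

Definition osc (a t : R) := (1 - cos (a * t)) * (t ^+ 2)^-1.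

Lemma osc_ge0 a t : 0 <= osc a t.
Proof. by rewrite mulr_ge0 ?invr_ge0 ?sqr_ge0 // subr_ge0 cos_le1. Qed.

Lemma measurable_osc a : measurable_fun setT (osc a).
Proof.
apply: measurable_funM; last exact: measurable_inv_sqr.
by apply: measurable_funB => //; have [] := bounded_meas_cos a.
Qed.

Lemma osc_le a t : osc a t <= (a ^+ 2 / 2 + 2) * (oneDsqr t)^-1.
Proof.
rewrite ler_pdivlMr; last by rewrite (lt_le_trans ltr01) ?oneDsqr_ge1.
rewrite /osc /oneDsqr; have [->|t0] := eqVneq t 0.
  by rewrite expr0n /= invr0 mulr0 mul0r addr_ge0 // mulr_ge0 // sqr_ge0.
have t2 : 0 < t ^+ 2 by rewrite exprn_even_gt0.
have -> : (1 - cos (a * t)) / t ^+ 2 * (1 + t ^+ 2) =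
  (1 - cos (a * t)) / t ^+ 2 + (1 - cos (a * t)) by field.
apply: lerD.
  rewrite ler_pdivrMr //; have := one_sub_cos_le (a * t).
  by have -> : (a * t) ^+ 2 / 2 = a ^+ 2 / 2 * t ^+ 2 by field.
by have := cos_geN1 (a * t); lra.
Qed.

Lemma oneDsqrV_ge0 (t : R) : 0 <= (oneDsqr t)^-1.
Proof. by rewrite invr_ge0 (le_trans ler01) ?oneDsqr_ge1. Qed.

Lemma measurable_oneDsqrV : measurable_fun setT (fun t : R => (oneDsqr t)^-1).
Proof. by apply: continuous_measurable_fun; exact: continuous_oneDsqrV. Qed.

Lemma integrable_oneDsqrV :
  mu.-integrable `[0, +oo[ (EFin \o (fun t => (oneDsqr t)^-1)).
Proof.
apply/integrableP; split.
  by apply/measurable_EFinP; apply: measurable_funTS; exact: measurable_oneDsqrV.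
have := integral0y_oneDsqr R.
under [X in (X < _)%E]eq_integral => t _.
  rewrite /= ger0_norm; last exact: oneDsqrV_ge0.
  over.
by move=> ->; exact: ltry.
Qed.

Lemma integrable_le_oneDsqrV (f : R -> R) C : measurable_fun setT f ->
  (forall t, `|f t| <= C * (oneDsqr t)^-1) ->
  mu.-integrable `[0, +oo[ (EFin \o f).
Proof.
move=> mf fC.
have iC : mu.-integrable `[0, +oo[ (EFin \o (fun t => C * (oneDsqr t)^-1)).
  by apply: integrable_bounded_measM => //;
    [exact: integrable_oneDsqrV | exact: bounded_meas_cst].
apply: (@le_integrable _ _ _ mu `[0, +oo[%classic _ _ (EFin \o (fun t => C * (oneDsqr t)^-1))) iC => //.
  by apply/measurable_EFinP; exact: measurable_funTS.
by move=> t _ /=; rewrite lee_fin (le_trans (fC t)) // ler_norm.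
Qed.

Lemma integrable_osc a : mu.-integrable `[0, +oo[ (EFin \o osc a).
Proof.
apply: (@integrable_le_oneDsqrV _ (a ^+ 2 / 2 + 2)); first exact: measurable_osc.
by move=> t; rewrite ger0_norm ?osc_ge0 // osc_le.
Qed.

(** The value at 1 is pi / 2; it stays a symbol, as only its positivity and the homogeneity in [a]
    enter. *)
Definition osc_int a := \int[mu]_(t in `[0, +oo[) osc a t.

(** Substitution of [t / a] for [t]. This is how absolute values, hence piecewise linear
    multipliers, arise from integrals of cosines. *)
Lemma osc_int_scale a : osc_int a = `|a| * osc_int 1.
Proof.
wlog a0 : a / 0 < a => [H|].
  have [a0|a0|->] := ltgtP a 0; last 2 first.
  - exact: H.
  - rewrite normr0 mul0r /osc_int; under eq_Rintegral do rewrite /osc mul0r cos0 subrr mul0r.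
    by rewrite /Rintegral integral0.
  rewrite -normrN -H ?oppr_gt0 // /osc_int; apply: eq_Rintegral => t _.
  by rewrite /osc mulNr cosN.
rewrite gtr0_norm //.
have := @ge0_integral_affine R a 0 `[0, +oo[%classic (EFin \o osc 1) a0 _ _ _.
have -> : [set t | `[0, +oo[%classic (0 + a * t)] = `[0, +oo[%classic.
  by apply/seteqP; split => t /=; rewrite !in_itv /= !andbT add0r pmulr_rge0.
move=> /(_ (measurable_itv _)) H.
have E (t : R) : (a ^+ 2)^-1 * osc a t = osc 1 (0 + a * t).
  by rewrite /osc add0r mul1r exprMn (invfM (a ^+ 2)) mulrCA.
have {}H : (\int[mu]_(t in `[0%R, +oo[) (((a ^+ 2)^-1)%:E * (osc a t)%:E) =
    (a^-1)%:E * \int[mu]_(t in `[0%R, +oo[) (osc 1 t)%:E)%E.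
  rewrite -H.
  - apply: eq_integral => t _ /=; rewrite -EFinM; congr (_%:E); exact: E.
  - by apply/measurable_EFinP; exact: measurable_osc.
  - by move=> t /=; rewrite lee_fin osc_ge0.
rewrite ge0_integralZl_EFin // in H; last 3 first.
- by move=> t _; rewrite lee_fin osc_ge0.
- by apply/measurable_EFinP; apply: measurable_funTS; exact: measurable_osc.
- by rewrite invr_ge0 sqr_ge0.
rewrite -!Rintegral_EFin // in H; [|exact: integrable_osc..].
move: H; rewrite -!EFinM => -[]; rewrite -/(osc_int a) -/(osc_int 1) => H.
have a2 : a ^+ 2 != 0 by rewrite expf_neq0 // gt_eqF.
apply: (mulfI (invr_neq0 a2)); rewrite H expr2; field; exact: lt0r_neq0.
Qed.

Lemma osc_int1_gt0 : 0 < osc_int 1.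
Proof.
have p0 := pi_gt0 R.
(* On [[pi / 2, pi]] the cosine is nonpositive, so the integrand is at least [(pi ^+ 2)^-1]
   there. *)
apply: (@lt_le_trans _ _ ((pi ^+ 2)^-1 * (pi - pi / 2))).
  by rewrite mulr_gt0 ?invr_gt0 ?exprn_gt0 //; lra.
rewrite -Rint_cst; last lra.
rewrite -lee_fin !Rintegral_EFin //; last 2 first.
- exact: integrable_osc.
- by apply: integrable_itv; exact: bounded_meas_cst.
apply: (@le_trans _ _ (\int[mu]_(t in `[(pi / 2)%R, pi]) (osc 1 t)%:E)%E).
  apply: ge0_le_integral => //.
  - by move=> t _; rewrite lee_fin invr_ge0 sqr_ge0.
  - by apply/measurable_EFinP; apply: measurable_funTS; exact: measurable_osc.
  move=> t /=; rewrite in_itv /= => /andP[t1 t2].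
  have t0 : 0 < t by lra.
  rewrite lee_fin /osc mul1r -[leLHS]mul1r ler_pM ?invr_ge0 ?sqr_ge0 //.
    rewrite lerBrDl -lerBrDr subrr.
    have := cosDpi (t - pi); rewrite subrK => ->.
    rewrite oppr_le0; apply: cos_ge0_pihalf; apply/andP; split; lra.
  rewrite lef_pV2 ?posrE ?exprn_gt0 // ler_sqr ?nnegrE; lra.
apply: ge0_subset_integral => //.
- by apply/measurable_EFinP; apply: measurable_funTS; exact: measurable_osc.
- by move=> t _; rewrite lee_fin osc_ge0.
- move=> t /=; rewrite !in_itv /= andbT => /andP[t1 _]; lra.
Qed.

(** The de la Vallee Poussin kernel, a difference of two Fejer kernels, normalised so that its
    multiplier is 1 at frequency 0. *)
Definition trap_kernel (l e t : R) := (osc e t - osc l t) / (2 * osc_int 1 * (e - l)).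

(** For [0 <= l < e] this is the even function of [m] equal to 1 up to [l], to 0 from [e] on, and
    linear in between, in the form in which [osc_int_scale] delivers it. *)
Definition trapezoid (l e m : R) :=
  (`|e + m| + `|e - m| - `|l + m| - `|l - m|) / (2 * (e - l)).

Lemma measurable_trap_kernel l e : measurable_fun setT (trap_kernel l e).
Proof.
rewrite /trap_kernel; under eq_fun do rewrite mulrC.
by apply: measurable_funM => //; apply: measurable_funB; exact: measurable_osc.
Qed.

Lemma trap_kernel_le l e : exists2 C, 0 < C &
  forall t, `|trap_kernel l e t| <= C * (oneDsqr t)^-1.
Proof.
pose c := `|(2 * osc_int 1 * (e - l))^-1|.
exists (c * ((e ^+ 2 / 2 + 2) + (l ^+ 2 / 2 + 2)) + 1).
  rewrite ltr_wpDl // mulr_ge0 ?normr_ge0 //.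
  have := sqr_ge0 e; have := sqr_ge0 l; lra.
move=> t; rewrite /trap_kernel normrM -/c mulrC.
rewrite mulrDl mul1r ler_wpDr ?oneDsqrV_ge0 // -mulrA ler_wpM2l ?normr_ge0 //.
rewrite mulrDl (le_trans (ler_normB _ _)) //.
by rewrite !ger0_norm ?osc_ge0 // lerD ?osc_le.
Qed.

Lemma integrable_trap_kernel l e : mu.-integrable `[0, +oo[ (EFin \o trap_kernel l e).
Proof.
have [C _ hC] := trap_kernel_le l e.
exact: (integrable_le_oneDsqrV (@measurable_trap_kernel l e) hC).
Qed.

(** By [oscD], the product of [2 * cos (m * t)] with a difference of two [osc] is a combination of
    four [osc] of shifted parameters, and each integrates to an absolute value times [osc_int 1]. *)
Lemma Rintegral_cos_trap_kernel l e m : l < e ->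
  \int[mu]_(t in `[0, +oo[) (2 * cos (m * t) * trap_kernel l e t) = trapezoid l e m.
Proof.
move=> le.
set c := (2 * osc_int 1 * (e - l))^-1.
have Jp := osc_int1_gt0.
have oscD (a b t : R) :
    osc (a + b) t + osc (a - b) t = 2 * (1 - cos (a * t) * cos (b * t)) * (t ^+ 2)^-1.
  by rewrite /osc (mulrDl a b t) (mulrBl t a b) cosD cosB; ring.
have -> : \int[mu]_(t in `[0, +oo[) (2 * cos (m * t) * trap_kernel l e t) =
  \int[mu]_(t in `[0, +oo[) (c * ((osc (e + m) t + osc (e - m) t) - (osc (l + m) t + osc (l - m) t))).
  apply: eq_Rintegral => t _.
  by rewrite !oscD /trap_kernel -/c /osc; ring.
have iD a b : mu.-integrable `[0, +oo[ (EFin \o (fun t => osc a t + osc b t)).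
  by apply: intD => //; exact: integrable_osc.
have iB := intB (measurable_itv _) (iD (e + m) (e - m)) (iD (l + m) (l - m)).
rewrite RintZ // RintB // !RintD //; try exact: integrable_osc.
rewrite -!/(osc_int _) !(osc_int_scale (_ + _)).
rewrite /c /trapezoid; field.
by rewrite subr_eq0 !gt_eqF.
Qed.

Lemma trapezoid_in l e m : l < e -> `|m| <= l -> trapezoid l e m = 1.
Proof.
rewrite ler_norml => le /andP[m1 m2]; rewrite /trapezoid !ger0_norm; try lra.
by field; rewrite subr_eq0 gt_eqF.
Qed.

Lemma trapezoid_out l e m : l < e -> 0 <= l -> e <= `|m| -> trapezoid l e m = 0.
Proof.
move=> le l0 em; rewrite /trapezoid; have [m0|m0] := lerP 0 m.
  rewrite (ger0_norm m0) in em.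
  rewrite (ger0_norm (_ : 0 <= e + m)); last lra.
  rewrite (ger0_norm (_ : 0 <= l + m)); last lra.
  rewrite (ler0_norm (_ : e - m <= 0)); last lra.
  rewrite (ler0_norm (_ : l - m <= 0)); last lra.
  by rewrite (_ : _ + _ - _ - _ = 0) ?mul0r //; ring.
rewrite (ltr0_norm m0) in em.
rewrite (ler0_norm (_ : e + m <= 0)); last lra.
rewrite (ler0_norm (_ : l + m <= 0)); last lra.
rewrite (ger0_norm (_ : 0 <= e - m)); last lra.
rewrite (ger0_norm (_ : 0 <= l - m)); last lra.
by rewrite (_ : _ + _ - _ - _ = 0) ?mul0r //; ring.
Qed.

Lemma trapezoidN l e m : trapezoid l e (- m) = trapezoid l e m.
Proof. rewrite /trapezoid !opprK; congr (_ / _); ring. Qed.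

End Kernel.

(** * The trapezoid operator on Stepanov almost periodic functions *)

Section TrapezoidOperator.
Variable R : realType.
Local Notation mu := (@lebesgue_measure R).

Lemma bounded_meas_opp f : bounded_meas f -> bounded_meas (fun t : R => f (- t)).
Proof. by move=> hf; apply: bounded_meas_comp => //; exact: oppr_measurable. Qed.

Lemma measurable_EFin_norm (D : set R) (f : R -> R) : bounded_meas f ->
  measurable_fun D (fun t => (`|f t|)%:E).
Proof.
move=> bf; apply/measurable_EFinP; apply: measurable_funTS.
by have [] := bounded_meas_norm bf.
Qed.

(** The Stepanov seminorm of exponent 1, without the factor 1 / pi. The spectral arguments need this
    one alone; [Sp_norm_window_le] reduces the exponent [p] to it. *)
Definition window_le (h : R -> R) (eps : R) :=
  forall u, (\int[mu]_(t in `[u, (u + pi)%R]) (`|h t|)%:E <= eps%:E)%E.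

Lemma window_le_opp h eps : bounded_meas h -> window_le h eps ->
  window_le (fun t => h (- t)) eps.
Proof.
move=> bh H u.
have := @ge0_integral_oppr R `[- u - pi, - u]%classic (fun t => (`|h t|)%:E) (measurable_itv _)
  (measurable_EFin_norm bh).
have -> : [set t | `[- u - pi, - u]%classic (- t)] = `[u, u + pi]%classic.
  by apply/seteqP; split => t /=; rewrite !in_itv /= => /andP[? ?]; apply/andP; split; lra.
move=> ->; last by move=> t; rewrite lee_fin.
by have := H (- u - pi); rewrite subrK.
Qed.

Lemma window_leD f g e1 e2 : bounded_meas f -> bounded_meas g ->
  window_le f e1 -> window_le g e2 -> window_le (fun t => f t + g t) (e1 + e2).
Proof.
move=> bf bg hf hg u; rewrite EFinD; apply: le_trans (leeD (hf u) (hg u)).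
rewrite -ge0_integralD //; try exact: measurable_EFin_norm;
  try by move=> t _; rewrite lee_fin.
apply: ge0_le_integral => //; try by move=> t _; rewrite lee_fin.
- by apply: measurable_EFin_norm; exact: bounded_measD.
- by apply: emeasurable_funD; exact: measurable_EFin_norm.
- by move=> t _; rewrite -EFinD lee_fin ler_normD.
Qed.

Lemma window_leN h eps : window_le h eps -> window_le (fun t => - h t) eps.
Proof. by move=> hh u; under eq_integral do rewrite normrN; exact: hh. Qed.

Lemma window_leMr h g eps : bounded_meas h -> bounded_meas g ->
  (forall t, `|g t| <= 1) -> window_le h eps -> window_le (fun t => h t * g t) eps.
Proof.
move=> bh bg g1 hh u; apply: le_trans (hh u).
apply: ge0_le_integral => //; try by move=> t _; rewrite lee_fin.
- by apply: measurable_EFin_norm; exact: bounded_measM.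
- exact: measurable_EFin_norm.
- by move=> t _; rewrite lee_fin normrM ler_piMr.
Qed.

Lemma window_le_cover h eps b a n : bounded_meas h -> window_le h eps ->
  (\int[mu]_(t in `[a, (a + n%:R * pi)%R[) (`|h (b + t)%R|)%:E <= (n%:R * eps)%:E)%E.
Proof.
move=> bh H.
have bhb : bounded_meas (fun t => h (b + t)) by exact: bounded_meas_shift.
elim: n => [|n IH].
  by rewrite !mul0r addr0 set_itv_ge ?integral_set0 // bnd_simp ltxx.
have p0 := pi_ge0 R.
have pn : 0 <= n%:R * pi :> R by rewrite mulr_ge0.
have -> : n.+1%:R * pi = n%:R * pi + pi :> R by rewrite -natr1; ring.
rewrite (@ge0_integral_itv_split _ a (a + n%:R * pi)) //; last 3 first.
- by rewrite lerDl.
- by rewrite bnd_simp addrA lerDl.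
- by have [] := bounded_meas_norm bhb.
rewrite -natr1 mulrDl mul1r EFinD; apply: leeD => //.
have := @ge0_integral_shift R b `[b + (a + n%:R * pi), b + (a + n%:R * pi) + pi]%classic
  (fun t => (`|h t|)%:E) (measurable_itv _) (measurable_EFin_norm bh).
have -> : [set t | `[b + (a + n%:R * pi), b + (a + n%:R * pi) + pi]%classic (b + t)] =
   `[a + n%:R * pi, a + n%:R * pi + pi]%classic.
  by apply/seteqP; split => t /=; rewrite !in_itv /= => /andP[? ?]; apply/andP; split; lra.
move=> E; have := H (b + (a + n%:R * pi)); rewrite -E; last by move=> t; rewrite lee_fin.
apply: le_trans; rewrite addrA.
apply: ge0_subset_integral => //.
- exact: measurable_EFin_norm.
- by move=> t /=; rewrite !in_itv /= => /andP[-> /ltW].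
Qed.

Lemma window_le_itv h eps b a c : 0 <= eps -> bounded_meas h -> window_le h eps -> a <= c ->
  (\int[mu]_(t in `[a, c]) (`|h (b + t)%R|)%:E <= (((c - a) / pi + 1) * eps)%:E)%E.
Proof.
move=> e0 bh H ac.
have p0 := pi_gt0 R.
set n := (Num.truncn ((c - a) / pi)).+1.
have n1 : (c - a) / pi < n%:R by exact: truncnS_gt.
have n2 : n%:R <= (c - a) / pi + 1.
  by rewrite -natr1 lerD2r truncn_le // divr_ge0 ?subr_ge0 // ltW.
have bhb : bounded_meas (fun t => h (b + t)) by exact: bounded_meas_shift.
apply: (@le_trans _ _ (\int[mu]_(t in `[a, (a + n%:R * pi)%R[) (`|h (b + t)%R|)%:E)%E).
  apply: ge0_subset_integral => //.
  - exact: measurable_EFin_norm.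
  - move=> t /=; rewrite !in_itv /= => /andP[-> tc] /=.
    rewrite ltr_pdivrMr // in n1; lra.
by apply: (le_trans (window_le_cover _ _ n bh H)); rewrite lee_fin ler_wpM2r.
Qed.

Definition trap_op (l e : R) (h : R -> R) (y : R) :=
  \int[mu]_(t in `[0, +oo[) ((h (y + t) + h (y - t)) * trap_kernel l e t).

Lemma bounded_meas_sym h y : bounded_meas h -> bounded_meas (fun t : R => h (y + t) + h (y - t)).
Proof.
by move=> bh; apply: bounded_measD; [exact: bounded_meas_shift | exact: bounded_meas_reflect].
Qed.

Lemma integrable_trap_op l e h y : bounded_meas h ->
  mu.-integrable `[0, +oo[ (EFin \o (fun t => (h (y + t) + h (y - t)) * trap_kernel l e t)).
Proof.
move=> bh; apply: integrable_bounded_measM => //; first exact: integrable_trap_kernel.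
exact: bounded_meas_sym.
Qed.

Lemma trap_opB l e h g y : bounded_meas h -> bounded_meas g ->
  trap_op l e (fun t => h t - g t) y = trap_op l e h y - trap_op l e g y.
Proof.
move=> bh bg; rewrite /trap_op -RintB //; try exact: integrable_trap_op.
by apply: eq_Rintegral => t _; ring.
Qed.

(** The kernel is [O(1 / (1 + t ^+ 2))], so its mass can be summed over windows, uniformly in [y].
    The operator thus turns approximation in mean into uniform approximation, which makes the value
    at a single point accessible. *)
Lemma trap_op_bound l e : exists2 C, 0 < C & forall h eps y, 0 <= eps ->
  bounded_meas h -> window_le h eps -> `|trap_op l e h y| <= C * eps.
Proof.
have [Ck Ck0 hk] := trap_kernel_le l e.
have p0 := pi_gt0 R.
exists (Ck * (4 + 4 * 2 / pi * 2)).
  by rewrite mulr_gt0 // ltr_wpDr // mulr_ge0 // divr_ge0 // ltW.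
move=> h eps y e0 bh H.
have bh' := bounded_meas_opp bh.
have H' := window_le_opp bh H.
apply: normr_Rintegral_le => //; first exact: integrable_trap_op.
pose h1 t := `|h (y + t)|; pose h2 t := `|h (- (- y + t))|.
pose V t := h1 t + h2 t.
have b1 : bounded_meas h1 by apply: bounded_meas_norm; exact: bounded_meas_shift.
have b2 : bounded_meas h2.
  by apply: bounded_meas_norm; exact: (bounded_meas_shift (- y) bh').
have bV : bounded_meas V by exact: bounded_measD.
have V0 t : 0 <= V t by rewrite /V /h1 /h2 addr_ge0.
have mv := @measurable_oneDsqrV R.
have mVv : measurable_fun setT (fun t => V t * (oneDsqr t)^-1).
  by apply: measurable_funM => //; have [] := bV.
have Vv0 t : 0 <= V t * (oneDsqr t)^-1 by rewrite mulr_ge0 // oneDsqrV_ge0.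
have Vitv a c : a <= c ->
    (\int[mu]_(t in `[a, c]) (V t)%:E <= (((c - a) / pi + 1) * eps * 2)%:E)%E.
  move=> ac; under eq_integral do rewrite EFinD.
  have m1 : measurable_fun `[a, c] (fun t => (h1 t)%:E).
    by apply/measurable_EFinP; apply: measurable_funTS; have [] := b1.
  have m2 : measurable_fun `[a, c] (fun t => (h2 t)%:E).
    by apply/measurable_EFinP; apply: measurable_funTS; have [] := b2.
  rewrite ge0_integralD //; try by move=> t _; rewrite lee_fin normr_ge0.
  have -> : ((c - a) / pi + 1) * eps * 2 = ((c - a) / pi + 1) * eps + ((c - a) / pi + 1) * eps by ring.
  rewrite EFinD; apply: leeD; first exact: window_le_itv.
  exact: (window_le_itv (- y) e0 bh' H').
apply: (@le_trans _ _ (\int[mu]_(t in `[0%R, +oo[) (Ck%:E * (V t * (oneDsqr t)^-1)%:E))%E).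
  apply: ge0_le_integral => //.
  - apply/measurable_EFinP; apply: measurable_funTS.
    apply: (measurableT_comp (f := @Num.norm _ R)) => //.
    apply: measurable_funM; last exact: measurable_trap_kernel.
    by have [] := bounded_meas_sym y bh.
  - by apply/measurable_EFinP; apply: measurable_funTS; exact: measurable_funM.
  - move=> t _; rewrite -EFinM lee_fin normrM mulrCA ler_pM //.
    by rewrite /V /h1 /h2 opprD opprK; exact: ler_normD.
rewrite ge0_integralZl_EFin //; [| by move=> t _; rewrite lee_fin
  | by apply/measurable_EFinP; exact: measurable_funTS | exact: ltW].
rewrite -mulrA EFinM; apply: lee_wpmul2l; first by rewrite lee_fin ltW.
rewrite (@ge0_integral_itv_split _ 0 pi) ?(ltW p0) //.
rewrite mulrDl EFinD; apply: leeD.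
  apply: (@le_trans _ _ (\int[mu]_(t in `[0%R, pi]) (V t)%:E)%E).
    apply: (@le_trans _ _ (\int[mu]_(t in `[0%R, pi[) (V t)%:E)%E).
      apply: le_integral_EFin => //; first by have [] := bV.
      by move=> t _; rewrite ler_piMr // invf_le1 ?oneDsqr_ge1 //.
    apply: subset_integral_EFin => //; last by have [] := bV.
    by move=> t /=; rewrite !in_itv /= => /andP[-> /ltW].
  apply: (le_trans (Vitv 0 pi (ltW p0))).
  by rewrite subr0 mulfV ?gt_eqF // lee_fin; lra.
(* An interval [[tau, 2 * tau]] with [tau >= pi] costs at most [2 * tau / pi] windows, and [V] adds
   two translates: hence [4 * eps / pi]. *)
have := @dyadic_integral_le R pi (4 * eps / pi) 1 2^-1 V (fun t => (oneDsqr t)^-1) p0.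
have e12 : 1 / (1 - 2^-1) = 2 :> R.
  by rewrite (_ : 1 - 2^-1 = 2^-1) ?div1r ?invrK //; lra.
rewrite e12 => H0.
have -> : 4 * 2 / pi * 2 * eps = 4 * eps / pi * 2 * 2 by ring.
apply: le_trans (H0 _ _ _ _ _ _ _ _ _ _) _ => //; last first.
- rewrite lee_fin; have A0 : 0 <= 4 * eps / pi * 2 by rewrite !mulr_ge0 // invr_ge0 ltW.
  lra.
- move=> j.
  have T0 : 0 < pi * 2 ^+ j :> R by rewrite mulr_gt0 // exprn_gt0.
  rewrite mul1r ler_pdivrMr; last by rewrite (lt_le_trans ltr01) ?oneDsqr_ge1.
  rewrite /oneDsqr exprVn -ler_pdivrMl ?invr_gt0 ?exprn_gt0 // invrK.
  rewrite exprMn; have := pi_ge2 R.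
  have : 1 <= 2 ^+ j :> R by rewrite exprn_ege1 // ler1n.
  move: (2 ^+ j) (@pi R) => a b; nra.
- move=> tau ptau.
  have t0 : 0 < tau by exact: lt_le_trans ptau.
  apply: (@le_trans _ _ (\int[mu]_(t in `[tau, (2 * tau)%R]) (V t)%:E)%E).
    apply: subset_integral_EFin => //; last by have [] := bV.
    by move=> t /=; rewrite !in_itv /= => /andP[-> /ltW].
  have : tau <= 2 * tau by lra.
  move=> /Vitv /le_trans; apply; rewrite lee_fin.
  have -> : 2 * tau - tau = tau by ring.
  have : 1 <= tau / pi by rewrite ler_pdivlMr // mul1r.
  have -> : 4 * eps / pi * tau = 4 * eps * (tau / pi) by ring.
  move: (tau / pi) => z; nra.
- move=> s t ps st; rewrite lef_pV2 ?posrE ?(lt_le_trans ltr01) ?oneDsqr_ge1 //.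
  by rewrite lerD2l ler_sqr ?nnegrE //; lra.
- by have [] := bV.
- by rewrite invr_ge0 ler0n /= invf_lt1 // ltr1n.
- by rewrite divr_ge0 ?mulr_ge0 // ltW.
Qed.

Definition trap_poly (l e : R) (s : seq (R * R * R)) :=
  [seq ((trapezoid l e p.2 * p.1.1, trapezoid l e p.2 * p.1.2), p.2) | p <- s].

Definition neg_poly (s : seq (R * R * R)) := [seq ((- p.1.1, - p.1.2), p.2) | p <- s].

Lemma rpoly_cat s s' (t : R) : rpoly (s ++ s') t = rpoly s t + rpoly s' t.
Proof. by rewrite /rpoly big_cat. Qed.

Lemma rpoly_neg s (t : R) : rpoly (neg_poly s) t = - rpoly s t.
Proof. by rewrite /rpoly big_map -sumrN; apply: eq_bigr => p _ /=; ring. Qed.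

Lemma trap_op_rpoly l e s y : l < e -> trap_op l e (rpoly s) y = rpoly (trap_poly l e s) y.
Proof.
move=> le; rewrite /trap_op.
have E (t : R) : rpoly s (y + t) + rpoly s (y - t) =
    \sum_(p <- s) (p.1.1 * cos (p.2 * y) + p.1.2 * sin (p.2 * y)) * (2 * cos (p.2 * t)).
  rewrite /rpoly -big_split; apply: eq_bigr => p _ /=.
  by rewrite mulrDr mulrBr !cosD !sinD !cosN !sinN; ring.
under eq_Rintegral do rewrite E.
have bterm (p : R * R * R) : bounded_meas
    (fun t => (p.1.1 * cos (p.2 * y) + p.1.2 * sin (p.2 * y)) * (2 * cos (p.2 * t))).
  apply: bounded_measM; first exact: bounded_meas_cst.
  by apply: bounded_measM; [exact: bounded_meas_cst | exact: bounded_meas_cos].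
elim: s {E} => [|p s IH].
  rewrite /rpoly /= big_nil; under eq_Rintegral do rewrite big_nil mul0r.
  by rewrite /Rintegral integral0.
under eq_Rintegral do rewrite big_cons mulrDl.
rewrite RintD //; last 2 first.
- by apply: integrable_bounded_measM => //; exact: integrable_trap_kernel.
- apply: integrable_bounded_measM => //; first exact: integrable_trap_kernel.
  by apply: bounded_meas_sum.
rewrite IH /rpoly /= big_cons /=; congr (_ + _).
under eq_Rintegral do rewrite -mulrA.
rewrite RintZ //.
  by rewrite Rintegral_cos_trap_kernel //; ring.
apply: integrable_bounded_measM => //; first exact: integrable_trap_kernel.
by apply: bounded_measM; [exact: bounded_meas_cst | exact: bounded_meas_cos].
Qed.

Definition stepanov_approx (h : R -> R) := forall eps, 0 < eps ->
  exists s, window_le (fun t => h t - rpoly s t) eps.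

(** The interval [[0, L]] costs at most [L / pi + 1] windows; this is at most [L] as soon as
    [L >= 2], because [pi >= 2], so no constant is lost. *)
Lemma window_le_mean g eps : 0 <= eps -> bounded_meas g -> window_le g eps ->
  \forall L \near +oo%R, `|L^-1 * \int[mu]_(t in `[0, L]) g t| <= eps.
Proof.
move=> e0 bg wg; near=> L.
have L2 : 2 <= L by near: L; apply: nbhs_pinfty_ge; exact: num_real.
have L0 : 0 < L by lra.
rewrite normrM normfV (gtr0_norm L0) mulrC ler_pdivrMr //.
apply: normr_Rintegral_le => //; first exact: integrable_itv.
have := window_le_itv 0 e0 bg wg (ltW L0).
under eq_integral do rewrite add0r.
move=> /le_trans; apply; rewrite lee_fin subr0 mulrC ler_wpM2l //.
have : L / pi <= L / 2 by rewrite ler_wpM2l ?(ltW L0) // lef_pV2 ?posrE ?pi_gt0 // pi_ge2.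
lra.
Unshelve. all: by end_near. Qed.

Lemma has_mean_close g g' eps m m' : 0 <= eps -> bounded_meas g -> bounded_meas g' ->
  window_le (fun t => g t - g' t) eps -> has_mean g m -> has_mean g' m' ->
  `|m - m'| <= eps.
Proof.
move=> e0 bg bg' w hm hm'.
have bd : bounded_meas (fun t => g t - g' t) by exact: bounded_measB.
have hd : has_mean (fun t => g t + (-1) * g' t) (m + (-1) * m').
  apply: has_meanD => //; last exact: has_meanZ.
  by apply: bounded_measM => //; exact: bounded_meas_cst.
have {}hd : has_mean (fun t => g t - g' t) (m - m').
  by move: hd; under eq_fun do rewrite mulN1r; rewrite mulN1r.
have near_e := window_le_mean e0 bd w.
rewrite ler_norml; apply/andP; split.
  by apply: (cvgr_to_ge hd); apply: filterS near_e => L; rewrite ler_norml => /andP[//].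
by apply: (cvgr_to_le hd); apply: filterS near_e => L; rewrite ler_norml => /andP[].
Qed.

(** Cauchy's criterion: the averages of [g] are eventually within [eps] of the convergent averages
    of [g']. *)
Lemma has_mean_exists g : bounded_meas g ->
  (forall eps, 0 < eps -> exists g' m', [/\ bounded_meas g', has_mean g' m' &
     window_le (fun t => g t - g' t) eps]) -> exists m, has_mean g m.
Proof.
move=> bg H; apply/cvg_ex; apply/cauchy_cvgP; apply/cauchy_exP => e e0.
have e2 : 0 < e / 2 by rewrite divr_gt0.
have [g' [m' [bg' hm' w]]] := H _ e2.
exists m'.
change (\forall L \near +oo%R, ball m' e (L^-1 * \int[mu]_(t in `[0, L]) g t)).
near=> L.
have L0 : 0 < L by near: L; exact: nbhs_pinfty_gt.
rewrite /ball /=.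
have h1 : `|m' - L^-1 * \int[mu]_(t in `[0, L]) g' t| < e / 2.
  by near: L; move/cvgrPdist_lt : hm' => /(_ _ e2).
have h2 : `|L^-1 * \int[mu]_(t in `[0, L]) (g t - g' t)| <= e / 2.
  by near: L; apply: window_le_mean => //; [exact: ltW | exact: bounded_measB].
rewrite RintB // in h2; try exact: integrable_itv.
rewrite mulrBr in h2.
set A := L^-1 * _ in h1 *; set B := L^-1 * _ in h2 *.
have -> : m' - B = (m' - A) - (B - A) by ring.
by rewrite (le_lt_trans (ler_normB _ _)) // [ltRHS]splitr ltr_leD.
Unshelve. all: by end_near. Qed.

Lemma eq_mean_val (g : R -> R) m m' : m = m' -> has_mean g m -> has_mean g m'.
Proof. by move=> ->. Qed.

(** The Bohr cosine coefficient of [rpoly s] at [m]. The frequencies of a list have arbitrary sign,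
    so [m] and [- m] both contribute a half, with a sign change in the case of the sine. *)
Definition half_cos (s : seq (R * R * R)) m := \sum_(p <- s)
  p.1.1 * (2^-1 * (p.2 - m == 0)%:R + 2^-1 * (p.2 + m == 0)%:R).
Definition half_sin (s : seq (R * R * R)) m := \sum_(p <- s)
  p.1.2 * (2^-1 * (p.2 - m == 0)%:R - 2^-1 * (p.2 + m == 0)%:R).

Lemma has_mean_rpoly_cos s m : has_mean (fun t => rpoly s t * cos (m * t)) (half_cos s m).
Proof.
rewrite /rpoly; under eq_fun do rewrite mulr_suml.
have E (p : R * R * R) : (fun t => (p.1.1 * cos (p.2 * t) + p.1.2 * sin (p.2 * t)) * cos (m * t)) =
  (fun t => p.1.1 * (2^-1 * cos ((p.2 - m) * t) + 2^-1 * cos ((p.2 + m) * t)) +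
    p.1.2 * (2^-1 * sin ((p.2 + m) * t) + 2^-1 * sin ((p.2 - m) * t))).
  by apply/funext => t; rewrite mulrDl -!mulrA mul_cos_cos mul_sin_cos -!mulrDl -!mulrBl.
have bc a c : bounded_meas (fun t => a * cos (c * t)).
  by apply: bounded_measM; [exact: bounded_meas_cst | exact: bounded_meas_cos].
have bs a c : bounded_meas (fun t => a * sin (c * t)).
  by apply: bounded_measM; [exact: bounded_meas_cst | exact: bounded_meas_sin].
apply: has_mean_sum => [p|p _]; rewrite E.
  by apply: bounded_measD; apply: bounded_measM => //; try exact: bounded_meas_cst;
    exact: bounded_measD.
apply: (@eq_mean_val _ (p.1.1 * (2^-1 * (p.2 - m == 0)%:R + 2^-1 * (p.2 + m == 0)%:R) + p.1.2 * (2^-1 * 0 + 2^-1 * 0))); first by rewrite !mulr0 addr0 mulr0 addr0.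
apply: has_meanD; try by apply: bounded_measM => //; try exact: bounded_meas_cst;
    exact: bounded_measD.
  apply: has_meanZ; first exact: bounded_measD.
  by apply: has_meanD => //; apply: has_meanZ; [exact: bounded_meas_cos | exact: has_mean_cos
    | exact: bounded_meas_cos | exact: has_mean_cos].
apply: has_meanZ; first exact: bounded_measD.
by apply: has_meanD => //; apply: has_meanZ; [exact: bounded_meas_sin | exact: has_mean_sin
    | exact: bounded_meas_sin | exact: has_mean_sin].
Qed.

Lemma has_mean_rpoly_sin s m : has_mean (fun t => rpoly s t * sin (m * t)) (half_sin s m).
Proof.
rewrite /rpoly; under eq_fun do rewrite mulr_suml.
have E (p : R * R * R) : (fun t => (p.1.1 * cos (p.2 * t) + p.1.2 * sin (p.2 * t)) * sin (m * t)) =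
  (fun t => p.1.2 * (2^-1 * cos ((p.2 - m) * t) + (- 2^-1) * cos ((p.2 + m) * t)) +
    p.1.1 * (2^-1 * sin ((p.2 + m) * t) + (- 2^-1) * sin ((p.2 - m) * t))).
  apply/funext => t; rewrite mulrDl -!mulrA mul_sin_sin [cos _ * sin _]mulrC mul_sin_cos.
  rewrite -!mulrDl -!mulrBl [m + _]addrC -(opprB p.2 m) [- _ * t]mulNr sinN; ring.
have bc a c : bounded_meas (fun t => a * cos (c * t)).
  by apply: bounded_measM; [exact: bounded_meas_cst | exact: bounded_meas_cos].
have bs a c : bounded_meas (fun t => a * sin (c * t)).
  by apply: bounded_measM; [exact: bounded_meas_cst | exact: bounded_meas_sin].
apply: has_mean_sum => [p|p _]; rewrite E.
  by apply: bounded_measD; apply: bounded_measM => //; try exact: bounded_meas_cst;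
    exact: bounded_measD.
apply: (@eq_mean_val _ (p.1.2 * (2^-1 * (p.2 - m == 0)%:R + - 2^-1 * (p.2 + m == 0)%:R) + p.1.1 * (2^-1 * 0 + - 2^-1 * 0))); first by rewrite !mulr0 addr0 mulr0 addr0 mulNr.
apply: has_meanD; try by apply: bounded_measM => //; try exact: bounded_meas_cst;
    exact: bounded_measD.
  apply: has_meanZ; first exact: bounded_measD.
  by apply: has_meanD => //; apply: has_meanZ; [exact: bounded_meas_cos | exact: has_mean_cos
    | exact: bounded_meas_cos | exact: has_mean_cos].
apply: has_meanZ; first exact: bounded_measD.
by apply: has_meanD => //; apply: has_meanZ; [exact: bounded_meas_sin | exact: has_mean_sin
    | exact: bounded_meas_sin | exact: has_mean_sin].
Qed.

Lemma half_cos_trap l e s m : half_cos (trap_poly l e s) m = trapezoid l e m * half_cos s m.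
Proof.
rewrite /half_cos big_map mulr_sumr; apply: eq_bigr => p _ /=.
rewrite -mulrA mulrCA [in RHS]mulrCA; congr (_ * _).
rewrite !mulrDr; congr (_ + _).
  by have [/eqP|] := eqVneq (p.2 - m) 0; rewrite ?mulr0 // subr_eq0 => /eqP ->.
have [/eqP|] := eqVneq (p.2 + m) 0; rewrite ?mulr0 //.
by rewrite addr_eq0 => /eqP ->; rewrite trapezoidN.
Qed.

Lemma half_sin_trap l e s m : half_sin (trap_poly l e s) m = trapezoid l e m * half_sin s m.
Proof.
rewrite /half_sin big_map mulr_sumr; apply: eq_bigr => p _ /=.
rewrite -mulrA mulrCA [in RHS]mulrCA; congr (_ * _).
rewrite !mulrBr; congr (_ - _).
  by have [/eqP|] := eqVneq (p.2 - m) 0; rewrite ?mulr0 // subr_eq0 => /eqP ->.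
have [/eqP|] := eqVneq (p.2 + m) 0; rewrite ?mulr0 //.
by rewrite addr_eq0 => /eqP ->; rewrite trapezoidN.
Qed.

Lemma half_cos_cat s s' m : half_cos (s ++ s') m = half_cos s m + half_cos s' m.
Proof. by rewrite /half_cos big_cat. Qed.
Lemma half_sin_cat s s' m : half_sin (s ++ s') m = half_sin s m + half_sin s' m.
Proof. by rewrite /half_sin big_cat. Qed.
Lemma half_cos_neg s m : half_cos (neg_poly s) m = - half_cos s m.
Proof. by rewrite /half_cos big_map -sumrN; apply: eq_bigr => p _ /=; rewrite mulNr. Qed.
Lemma half_sin_neg s m : half_sin (neg_poly s) m = - half_sin s m.
Proof. by rewrite /half_sin big_map -sumrN; apply: eq_bigr => p _ /=; rewrite mulNr. Qed.

Lemma sum_seq_eq (S : seq R) (F : R -> R) m : uniq S ->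
  \sum_(p <- S) F p * (p - m == 0)%:R = F m * (m \in S)%:R.
Proof.
move=> uS; have [mS|mS] := boolP (m \in S).
  rewrite (bigD1_seq m) //= subrr eqxx mulr1 big1 ?addr0 // => p pm.
  by rewrite subr_eq0 (negbTE pm) mulr0.
rewrite mulr0 big_seq big1 // => p pS; rewrite subr_eq0.
by have [pm|_] := eqVneq p m; [rewrite -pm pS in mS | rewrite mulr0].
Qed.

Lemma trapezoid_le1 (l e m : R) : l < e -> `|trapezoid l e m| <= 1.
Proof.
move=> le; rewrite /trapezoid normrM normfV (gtr0_norm (_ : 0 < 2 * (e - l))); last lra.
rewrite ler_pdivrMr ?mul1r; last lra.
have h (x y : R) : `| `|x| - `|y| | <= `|x - y| by exact: ler_dist_dist.
have h1 := h (e + m) (l + m); have h2 := h (e - m) (l - m).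
have E1 : e + m - (l + m) = e - l by ring.
have E2 : e - m - (l - m) = e - l by ring.
rewrite E1 in h1; rewrite E2 in h2; rewrite (gtr0_norm (_ : 0 < e - l)) in h1 h2; try lra.
have -> : `|e + m| + `|e - m| - `|l + m| - `|l - m| =
  (`|e + m| - `|l + m|) + (`|e - m| - `|l - m|) by ring.
rewrite (le_trans (ler_normD _ _)) //; lra.
Qed.

Lemma window_le_rpoly_sub h s s' e1 e2 : bounded_meas h ->
  window_le (fun t => h t - rpoly s t) e1 -> window_le (fun t => h t - rpoly s' t) e2 ->
  window_le (rpoly (s ++ neg_poly s')) (e1 + e2).
Proof.
move=> bh h1 h2.
have b1 : bounded_meas (fun t => h t - rpoly s t) by apply: bounded_measB => //; exact: bounded_meas_rpoly.
have b2 : bounded_meas (fun t => h t - rpoly s' t) by apply: bounded_measB => //; exact: bounded_meas_rpoly.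
have := window_leD (bounded_measN b1) b2 (window_leN h1) h2.
congr window_le; apply/funext => t; rewrite rpoly_cat rpoly_neg; ring.
Qed.

Lemma trap_poly_cat l e s s' : trap_poly l e (s ++ s') = trap_poly l e s ++ trap_poly l e s'.
Proof. by rewrite /trap_poly map_cat. Qed.

Lemma trap_poly_neg l e s : trap_poly l e (neg_poly s) = neg_poly (trap_poly l e s).
Proof. by rewrite /trap_poly /neg_poly -!map_comp; apply: eq_map => p /=; rewrite !mulrN. Qed.

Lemma stepanov_approx_means h : bounded_meas h -> stepanov_approx h ->
  exists C S : R -> R, forall m, has_mean (fun t => h t * cos (m * t)) (C m) /\
    has_mean (fun t => h t * sin (m * t)) (S m).
Proof.
move=> bh ah.
have hc m : exists c, has_mean (fun t => h t * cos (m * t)) c.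
  apply: has_mean_exists => [|eps e0].
    by apply: bounded_measM => //; exact: bounded_meas_cos.
  have [s w] := ah _ e0.
  have bs := bounded_meas_rpoly s.
  exists (fun t => rpoly s t * cos (m * t)), (half_cos s m); split.
  - by apply: bounded_measM => //; exact: bounded_meas_cos.
  - exact: has_mean_rpoly_cos.
  - have := @window_leMr _ (fun t => cos (m * t)) _ (bounded_measB bh bs) (bounded_meas_cos m)
      (fun t => cos_max _) w.
    by congr window_le; apply/funext => t; rewrite mulrBl.
have hs m : exists c, has_mean (fun t => h t * sin (m * t)) c.
  apply: has_mean_exists => [|eps e0].
    by apply: bounded_measM => //; exact: bounded_meas_sin.
  have [s w] := ah _ e0.
  have bs := bounded_meas_rpoly s.
  exists (fun t => rpoly s t * sin (m * t)), (half_sin s m); split.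
  - by apply: bounded_measM => //; exact: bounded_meas_sin.
  - exact: has_mean_rpoly_sin.
  - have := @window_leMr _ (fun t => sin (m * t)) _ (bounded_measB bh bs) (bounded_meas_sin m)
      (fun t => sin_max _) w.
    by congr window_le; apply/funext => t; rewrite mulrBl.
have [C HC] := choice hc; have [S HS] := choice hs.
by exists C, S.
Qed.

(* The trapezoid operator multiplies the Bohr coefficients by the trapezoid, so
   if no frequency lies in the gap, both sides have the same coefficients. *)
Lemma trap_op_spectral h l e y (Sp : seq R) (C S : R -> R) :
  0 <= l -> l < e -> bounded_meas h -> stepanov_approx h ->
  (forall m, has_mean (fun t => h t * cos (m * t)) (C m)) ->
  (forall m, has_mean (fun t => h t * sin (m * t)) (S m)) ->
  uniq Sp -> (forall m, m \in Sp -> - m \in Sp) ->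
  (forall m, m \in Sp -> `|m| <= l) ->
  (forall m, m \notin Sp -> `|m| < e -> C m = 0 /\ S m = 0) ->
  trap_op l e h y = \sum_(m <- Sp) (C m * cos (m * y) + S m * sin (m * y)).
Proof.
move=> l0 le bh ah hC hS uS symS Sl gap.
have [K K0 hK] := trap_op_bound l e.
pose ls := [seq ((C m, S m), m) | m <- Sp].
have rls t : rpoly ls t = \sum_(m <- Sp) (C m * cos (m * t) + S m * sin (m * t)).
  by rewrite /rpoly big_map.
rewrite -rls.
have CN m : C (- m) = C m.
  apply: (has_mean_unique (hC (- m))).
  by under eq_fun do rewrite mulNr cosN; exact: hC.
have SN m : S (- m) = - S m.
  apply: (has_mean_unique (hS (- m))).
  have -> : (fun t => h t * sin (- m * t)) = (fun t => -1 * (h t * sin (m * t))).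
    by apply/funext => t; rewrite (mulNr m t) sinN; ring.
  apply: (eq_mean_val (mulN1r _)); apply: has_meanZ => //.
  by apply: bounded_measM => //; exact: bounded_meas_sin.
have symE m : (- m \in Sp) = (m \in Sp).
  by apply/idP/idP => /symS //; rewrite opprK.
(* Off [Sp] either the frequency is below [e] and the coefficient vanishes, or it is at least [e]
   and the trapezoid vanishes. *)
have tC m : trapezoid l e m * C m = C m * (m \in Sp)%:R.
  have [mS|mS] := boolP (m \in Sp); first by rewrite trapezoid_in ?Sl // mul1r mulr1.
  have [me|em] := ltP `|m| e; first by have [-> _] := gap m mS me; rewrite !mulr0.
  by rewrite trapezoid_out // mul0r mulr0.
have tS m : trapezoid l e m * S m = S m * (m \in Sp)%:R.
  have [mS|mS] := boolP (m \in Sp); first by rewrite trapezoid_in ?Sl // mul1r mulr1.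
  have [me|em] := ltP `|m| e; first by have [_ ->] := gap m mS me; rewrite !mulr0.
  by rewrite trapezoid_out // mul0r mulr0.
(* The members of [Sp] come in pairs of opposite sign, and each of the two contributes half of the
   coefficient. *)
have lsC m : half_cos ls m = C m * (m \in Sp)%:R.
  rewrite /half_cos big_map /=.
  have -> : \sum_(i <- Sp) C i * (2^-1 * (i - m == 0)%:R + 2^-1 * (i + m == 0)%:R) =
    \sum_(i <- Sp) (2^-1 * (C i * (i - m == 0)%:R) + 2^-1 * (C i * (i - (- m) == 0)%:R)).
    by apply: eq_bigr => i _; rewrite opprK; ring.
  by rewrite big_split -!mulr_sumr /= !sum_seq_eq // symE CN; field.
have lsS m : half_sin ls m = S m * (m \in Sp)%:R.
  rewrite /half_sin big_map /=.
  have -> : \sum_(i <- Sp) S i * (2^-1 * (i - m == 0)%:R - 2^-1 * (i + m == 0)%:R) =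
    \sum_(i <- Sp) (2^-1 * (S i * (i - m == 0)%:R) - 2^-1 * (S i * (i - (- m) == 0)%:R)).
    by apply: eq_bigr => i _; rewrite opprK; ring.
  by rewrite sumrB -!mulr_sumr /= !sum_seq_eq // symE SN; field.
have d0 d : 0 < d -> `|trap_op l e h y - rpoly ls y| <= K * (d + d) + K * d.
  move=> d0; have [s ws] := ah _ d0.
  pose F s' := trap_poly l e s' ++ neg_poly ls.
  have FE s' t : rpoly (F s') t = rpoly (trap_poly l e s') t - rpoly ls t.
    by rewrite /F rpoly_cat rpoly_neg.
  have Fy : `|rpoly (F s) y| <= K * (d + d).
    apply: rpoly_le_of_small_means => r r0.
    (* Accuracy [r] makes the Bohr coefficients of [F s'] at most [r], while accuracy [d] keeps
       [F s'] uniformly within [K * (d + d)] of [F s], whatever [r] is. *)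
    pose r' := Num.min r d.
    have r'0 : 0 < r' by rewrite lt_min r0.
    have [s' ws'] := ah _ r'0.
    exists (rpoly (F s')), (half_cos (F s')), (half_sin (F s')); split.
    - exact: bounded_meas_rpoly.
    - move=> t; rewrite !FE opprB addrA subrK -rpoly_neg -rpoly_cat.
      rewrite -trap_poly_neg -trap_poly_cat -trap_op_rpoly //.
      have w := window_le_rpoly_sub bh ws ws'.
      apply: (le_trans (hK _ _ t _ (bounded_meas_rpoly _) w)).
        by rewrite addr_ge0 // ltW.
      by rewrite ler_wpM2l ?(ltW K0) // lerD2l /r' ge_min lexx orbT.
    - by move=> a; split; [exact: has_mean_rpoly_cos | exact: has_mean_rpoly_sin].
    move=> a; rewrite half_cos_cat half_sin_cat half_cos_neg half_sin_neg lsC lsS.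
    rewrite half_cos_trap half_sin_trap -tC -tS -!mulrBr !(normrM (trapezoid l e a)).
    have bs' := bounded_meas_rpoly s'.
    have cl : `|half_cos s' a - C a| <= r'.
      have b1 : bounded_meas (fun t => h t * cos (a * t)).
        by apply: bounded_measM => //; exact: bounded_meas_cos.
      have b2 : bounded_meas (fun t => rpoly s' t * cos (a * t)).
        by apply: bounded_measM => //; exact: bounded_meas_cos.
      have w := @window_leMr _ (fun t => cos (a * t)) _ (bounded_measB bh bs') (bounded_meas_cos a)
          (fun t => cos_max _) ws'.
      have {}w : window_le (fun t => h t * cos (a * t) - rpoly s' t * cos (a * t)) r'.
        by move: w; congr window_le; apply/funext => t; rewrite mulrBl.
      by rewrite distrC; exact: (has_mean_close (ltW r'0) b1 b2 w (hC a) (@has_mean_rpoly_cos s' a)).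
    have sl : `|half_sin s' a - S a| <= r'.
      have b1 : bounded_meas (fun t => h t * sin (a * t)).
        by apply: bounded_measM => //; exact: bounded_meas_sin.
      have b2 : bounded_meas (fun t => rpoly s' t * sin (a * t)).
        by apply: bounded_measM => //; exact: bounded_meas_sin.
      have w := @window_leMr _ (fun t => sin (a * t)) _ (bounded_measB bh bs') (bounded_meas_sin a)
          (fun t => sin_max _) ws'.
      have {}w : window_le (fun t => h t * sin (a * t) - rpoly s' t * sin (a * t)) r'.
        by move: w; congr window_le; apply/funext => t; rewrite mulrBl.
      by rewrite distrC; exact: (has_mean_close (ltW r'0) b1 b2 w (hS a) (@has_mean_rpoly_sin s' a)).
    have r'r : r' <= r by rewrite /r' ge_min lexx.
    have t1 := trapezoid_le1 a le.
    split; rewrite -[leRHS]mul1r; apply: ler_pM => //; exact: le_trans r'r.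
  have -> : trap_op l e h y - rpoly ls y =
     rpoly (F s) y + (trap_op l e h y - rpoly (trap_poly l e s) y) by rewrite FE; ring.
  apply: (le_trans (ler_normD _ _)); apply: lerD => //.
  rewrite -trap_op_rpoly // -trap_opB //; last exact: bounded_meas_rpoly.
  apply: hK => //; first exact: ltW.
  by apply: bounded_measB => //; exact: bounded_meas_rpoly.
apply/eqP; rewrite -subr_eq0 -normr_eq0 eq_le normr_ge0 andbT.
apply/ler_addgt0Pr => z z0; rewrite add0r.
have zK : 0 < z / (3 * K) by rewrite divr_gt0 // mulr_gt0.
apply: (le_trans (d0 _ zK)).
have -> : K * (z / (3 * K) + z / (3 * K)) + K * (z / (3 * K)) = z by field; rewrite gt_eqF.
by [].
Qed.

End TrapezoidOperator.

(** * Sine coefficients over a dyadic block *)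

Section SineCoefficients.
Variable R : realType.
Local Notation mu := (@lebesgue_measure R).

(** Sums and differences of two such numbers are integer multiples of [beta], whence the
    orthogonality of the sines over the full period [2 * pi / beta]. *)
Definition half_freq (beta : R) (k : nat) : R := beta * (k%:R + 2^-1).

Lemma sin_2pi_nat (n : nat) : sin (pi *+ 2 *+ n) = 0 :> R.
Proof. by have := periodicn (@sinD2pi R) n 0; rewrite add0r sin0. Qed.

Lemma Rintegral_cos_period (beta : R) (n : nat) : 0 < beta -> (0 < n)%N ->
  \int[mu]_(t in `[0, 2 * pi / beta]) cos (beta * n%:R * t) = 0.
Proof.
move=> b0 n0; have p0 := pi_gt0 R.
rewrite Rintegral_cosM; last 2 first.
- by rewrite mulf_neq0 ?gt_eqF // ltr0n.
- by rewrite divr_gt0 // mulr_gt0.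
rewrite mulr0 sin0 subr0.
have -> : beta * n%:R * (2 * pi / beta) = pi *+ 2 *+ n.
  by rewrite -mulr_natr -(mulr_natr pi 2); field; rewrite gt_eqF.
by rewrite sin_2pi_nat mul0r.
Qed.

Lemma Rintegral_sin_half_freq (beta : R) (i j : nat) : 0 < beta ->
  \int[mu]_(t in `[0, 2 * pi / beta]) (sin (half_freq beta i * t) * sin (half_freq beta j * t)) =
  (pi / beta) * (i == j)%:R.
Proof.
move=> b0; have p0 := pi_gt0 R.
have P0 : 0 <= 2 * pi / beta by rewrite divr_ge0 ?mulr_ge0 // ltW.
wlog ij : i j / (i <= j)%N => [H|].
  case/orP: (leq_total i j) => /H // h.
  by rewrite eq_sym -h; apply: eq_Rintegral => t _; rewrite mulrC.
have E (t : R) : sin (half_freq beta i * t) * sin (half_freq beta j * t) =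
  2^-1 * cos (beta * (j - i)%:R * t) - 2^-1 * cos (beta * (i + j).+1%:R * t).
  rewrite mul_sin_sin; congr (_ * _ - _ * _).
    by rewrite -cosN; congr cos; rewrite natrB // /half_freq; ring.
  by congr cos; rewrite /half_freq -(natr1 (i + j)%N) natrD; field.
under eq_Rintegral do rewrite E.
have ic a : mu.-integrable `[0, 2 * pi / beta] (EFin \o (fun t => 2^-1 * cos (a * t))).
  by apply: integrable_itv; apply: bounded_measM; [exact: bounded_meas_cst | exact: bounded_meas_cos].
have ic1 a : mu.-integrable `[0, 2 * pi / beta] (EFin \o (fun t => cos (a * t))).
  by apply: integrable_itv; exact: bounded_meas_cos.
rewrite RintB // !RintZ // (Rintegral_cos_period b0 (ltn0Sn _)) mulr0 subr0.
have [<-|neij] := eqVneq i j.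
  rewrite subnn; under eq_Rintegral do rewrite mulr0 mul0r cos0.
  by rewrite Rint_cst // mulr1 mul1r subr0; field; rewrite gt_eqF.
by rewrite Rintegral_cos_period // ?mulr0 // subn_gt0 ltn_neqAle neij.
Qed.

Lemma bessel (beta : R) (r : seq nat) (h : R -> R) : 0 < beta -> uniq r ->
  bounded_meas h ->
  \sum_(k <- r) (\int[mu]_(t in `[0, 2 * pi / beta]) (h t * sin (half_freq beta k * t))) ^+ 2
   <= pi / beta * \int[mu]_(t in `[0, 2 * pi / beta]) (h t ^+ 2).
Proof.
move=> b0 ur bh; have p0 := pi_gt0 R.
set P := [set` `[0, 2 * pi / beta]].
have mP : measurable P by exact: measurable_itv.
pose c k := \int[mu]_(t in P) (h t * sin (half_freq beta k * t)).
pose g t := \sum_(k <- r) c k * sin (half_freq beta k * t).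
(* The inverse of the squared norm of each sine, so that [d * g] is the orthogonal projection of
   [h]. *)
pose d := beta / pi.
have d0 : 0 < d by rewrite divr_gt0.
have bs k : bounded_meas (fun t => sin (half_freq beta k * t)) := bounded_meas_sin _.
have bcs k : bounded_meas (fun t => c k * sin (half_freq beta k * t)).
  by apply: bounded_measM => //; exact: bounded_meas_cst.
have bg : bounded_meas g by exact: bounded_meas_sum.
have Rsum (F : nat -> R -> R) : (forall k, bounded_meas (F k)) ->
  \int[mu]_(t in P) (\sum_(k <- r) F k t) = \sum_(k <- r) \int[mu]_(t in P) F k t.
  move=> bF; elim: (r) => [|k s IH].
    by under eq_Rintegral do rewrite big_nil; rewrite big_nil /Rintegral integral0.
  under eq_Rintegral do rewrite big_cons.
  rewrite RintD //; last 2 first.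
  - exact: integrable_itv.
  - by apply: integrable_itv; exact: bounded_meas_sum.
  by rewrite IH big_cons.
have hg : \int[mu]_(t in P) (h t * g t) = \sum_(k <- r) c k ^+ 2.
  have -> : \int[mu]_(t in P) (h t * g t) =
     \int[mu]_(t in P) (\sum_(k <- r) c k * (h t * sin (half_freq beta k * t))).
    by apply: eq_Rintegral => t _; rewrite mulr_sumr; apply: eq_bigr => k _; rewrite mulrCA.
  rewrite Rsum => [|k]; last first.
    by apply: bounded_measM; [exact: bounded_meas_cst | exact: bounded_measM].
  apply: eq_bigr => k _; rewrite RintZ //.
  by apply: integrable_itv; exact: bounded_measM.
have sg i : i \in r -> \int[mu]_(t in P) (sin (half_freq beta i * t) * g t) = d^-1 * c i.
  move=> ir.
  have -> : \int[mu]_(t in P) (sin (half_freq beta i * t) * g t) =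
     \int[mu]_(t in P) (\sum_(k <- r) c k * (sin (half_freq beta i * t) * sin (half_freq beta k * t))).
    by apply: eq_Rintegral => t _; rewrite mulr_sumr; apply: eq_bigr => k _; rewrite mulrCA.
  rewrite Rsum => [|k]; last first.
    by apply: bounded_measM; [exact: bounded_meas_cst | exact: bounded_measM].
  rewrite (bigD1_seq i) //= big1 ?addr0.
    rewrite RintZ //; last by apply: integrable_itv; exact: bounded_measM.
    by rewrite Rintegral_sin_half_freq // eqxx mulr1 /d invf_div mulrC.
  move=> k ki; rewrite RintZ //; last by apply: integrable_itv; exact: bounded_measM.
  by rewrite Rintegral_sin_half_freq // eq_sym (negbTE ki) !mulr0.
have gg : \int[mu]_(t in P) (g t * g t) = d^-1 * \sum_(k <- r) c k ^+ 2.
  have -> : \int[mu]_(t in P) (g t * g t) =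
     \int[mu]_(t in P) (\sum_(k <- r) c k * (sin (half_freq beta k * t) * g t)).
    apply: eq_Rintegral => t _; rewrite {1}/g mulr_suml; apply: eq_bigr => k _.
    by rewrite mulrA.
  rewrite Rsum => [|k]; last first.
    by apply: bounded_measM; [exact: bounded_meas_cst | exact: bounded_measM].
  rewrite mulr_sumr big_seq [RHS]big_seq; apply: eq_bigr => k kr; rewrite RintZ //.
    by rewrite sg //; ring.
  by apply: integrable_itv; exact: bounded_measM.
have : 0 <= \int[mu]_(t in P) ((h t - d * g t) ^+ 2).
  by apply: Rintegral_ge0 => t _; exact: sqr_ge0.
have -> : \int[mu]_(t in P) ((h t - d * g t) ^+ 2) =
  \int[mu]_(t in P) (h t ^+ 2 - (2 * d * (h t * g t) - d ^+ 2 * (g t * g t))).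
  by apply: eq_Rintegral => t _; ring.
have bhg : bounded_meas (fun t => h t * g t) by exact: bounded_measM.
have bgg : bounded_meas (fun t => g t * g t) by exact: bounded_measM.
have bhh : bounded_meas (fun t => h t ^+ 2) by under eq_fun do rewrite expr2; exact: bounded_measM.
have b1 : bounded_meas (fun t => 2 * d * (h t * g t)) by apply: bounded_measM => //; exact: bounded_meas_cst.
have b2 : bounded_meas (fun t => d ^+ 2 * (g t * g t)) by apply: bounded_measM => //; exact: bounded_meas_cst.
rewrite RintB //; [|exact: integrable_itv|by apply: integrable_itv; exact: bounded_measB].
rewrite RintB //; [|exact: integrable_itv|exact: integrable_itv].
rewrite !RintZ //; [|exact: integrable_itv|exact: integrable_itv].
rewrite hg gg; set X := \sum_(k <- r) _; set Y := \int[mu]_(t in P) _.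
have -> : d ^+ 2 * (d^-1 * X) = d * X by field; rewrite gt_eqF.
have -> : pi / beta = d^-1 by rewrite /d invf_div.
rewrite -ler_pdivrMl ?invr_gt0 // invrK; lra.
Qed.

(* Layer-cake: an exponentially decaying distribution has all moments; powers are
   compared with exponentials through [y <= s^-1 * expR (s * y)]. *)
Lemma sum_powR_of_counts (q C1 xi : R) : 0 < q -> 0 <= C1 -> 0 < xi < 1 ->
  exists2 K, 0 < K & forall (r : seq nat) (y : nat -> R) (N : R), 0 <= N ->
    (forall k, 0 <= y k) -> (size r)%:R <= N ->
    (forall J : nat, \sum_(k <- r) (C1 + 2 * J%:R <= y k)%R%:R <= N * xi ^+ J) ->
    \sum_(k <- r) y k `^ q <= K * N.
Proof.
move=> q0 C10 /andP[xi0 xi1].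
pose a := - ln xi.
have a0 : 0 < a by rewrite /a oppr_gt0; apply: ln_lt0; rewrite xi0.
have xiE : xi = expR (- a) by rewrite /a opprK lnK.
pose s := a / (4 * q).
have s0 : 0 < s by rewrite divr_gt0 // mulr_gt0.
pose z := expR (a / 2).
have z0 : 0 < z by exact: expR_gt0.
have zxi : z * xi = expR (- (a / 2)) by rewrite xiE -expRD; congr expR; lra.
have zxi1 : z * xi < 1 by rewrite zxi expR_lt1 oppr_lt0 divr_gt0.
have zxi0 : 0 <= z * xi by rewrite zxi expR_ge0.
pose E := expR (a / 4 * C1).
have E0 : 0 < E by exact: expR_gt0.
pose K := s `^ (- q) * (E * (1 + z / (1 - z * xi))).
have sq0 : 0 < s `^ (- q) by rewrite powR_gt0.
exists K.
  by rewrite !mulr_gt0 // ltr_wpDr // divr_ge0 ?subr_ge0 // ltW.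
move=> r y N N0 y0 szN cnt.
(* Any bound above all [y k]: it makes the sum over [J] finite. *)
pose M := (\sum_(k <- r) (Num.truncn (y k)).+1)%N.
have yM k : k \in r -> y k < M%:R.
  move=> kr; apply: (lt_le_trans (truncnS_gt _)); rewrite ler_nat.
  by rewrite /M (big_rem k) //= leq_addr.
have pt k : k \in r -> y k `^ q <= s `^ (- q) *
   (E * (1 + \sum_(J < M) (C1 + 2 * J%:R <= y k)%R%:R * z ^+ J.+1)).
  move=> kr.
  have le1 : y k `^ q <= s `^ (- q) * expR (a / 4 * y k).
    have -> : a / 4 * y k = q * (s * y k) by rewrite /s; field; rewrite gt_eqF.
    rewrite [q * _]mulrC expRM.
    have le2 : y k <= s^-1 * expR (s * y k).
      rewrite -ler_pdivrMl ?invr_gt0 // invrK.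
      by have := expR_ge1Dx (s * y k); lra.
    have := @ge0_ler_powR _ q (ltW q0) (y k) (s^-1 * expR (s * y k)) _ _ le2.
    rewrite !nnegrE y0 mulr_ge0 ?invr_ge0 ?(ltW s0) ?expR_ge0 // => /(_ erefl erefl).
    rewrite powRM ?invr_ge0 ?(ltW s0) ?expR_ge0 //.
    by rewrite -powR_inv1 ?(ltW s0) // -powRrM mulN1r.
  apply: (le_trans le1); rewrite ler_pM2l //.
  have sum0 (P : pred 'I_M) : 0 <= \sum_(J < M | P J) (C1 + 2 * J%:R <= y k)%R%:R * z ^+ J.+1.
    by apply: sumr_ge0 => J _; rewrite mulr_ge0 ?ler0n // exprn_ge0 // ltW.
  have [yC|Cy] := ltP (y k) C1.
    apply: (@le_trans _ _ (E * 1)).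
      by rewrite mulr1 /E ler_expR ler_pM2l ?divr_gt0 // ltW.
    by rewrite ler_pM2l // lerDl.
  pose J0 := Num.truncn ((y k - C1) / 2).
  have yC0 : 0 <= (y k - C1) / 2 by rewrite divr_ge0 // subr_ge0.
  have J01 : J0%:R <= (y k - C1) / 2 by rewrite truncn_le.
  have J02 : (y k - C1) / 2 < J0.+1%:R by exact: truncnS_gt.
  have J0M : (J0 < M)%N.
    by rewrite -(ltr_nat R); apply: le_lt_trans (yM _ kr); lra.
  have ineq : C1 + 2 * J0%:R <= y k by lra.
  rewrite (bigD1 (Ordinal J0M)) //= ineq mul1r.
  apply: (@le_trans _ _ (E * z ^+ J0.+1)).
    rewrite /E /z -expRM_natl -expRD ler_expR.
    have -> : a / 4 * C1 + J0.+1%:R * (a / 2) = a / 4 * (C1 + 2 * J0.+1%:R) by field.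
    rewrite ler_pM2l ?divr_gt0 //; lra.
  rewrite ler_pM2l //.
  have := sum0 (fun J => J != Ordinal J0M); lra.
apply: (@le_trans _ _ (\sum_(k <- r) s `^ (- q) *
   (E * (1 + \sum_(J < M) (C1 + 2 * J%:R <= y k)%R%:R * z ^+ J.+1)))).
  by rewrite big_seq [leRHS]big_seq; apply: ler_sum.
rewrite -!mulr_sumr /K -!mulrA !ler_pM2l // big_split /= exchange_big /=.
rewrite mulrDl mul1r; apply: lerD.
  by rewrite big_const_seq count_predT iter_addr_0.
apply: (@le_trans _ _ (\sum_(J < M) N * z * (z * xi) ^+ J)).
  apply: ler_sum => J _; rewrite -mulr_suml exprMn exprS.
  have -> : N * z * (z ^+ J * xi ^+ J) = N * xi ^+ J * (z * z ^+ J) by ring.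
  by rewrite ler_wpM2r // mulr_ge0 ?exprn_ge0 // ltW.
rewrite -mulr_sumr.
have -> : z / (1 - z * xi) * N = N * z * (1 - z * xi)^-1 by ring.
rewrite ler_wpM2l ?mulr_ge0 ?(ltW z0) //.
rewrite -[leRHS]mul1r ler_pdivlMr ?subr_gt0 //.
have -> : (\sum_(i < M) (z * xi) ^+ i) * (1 - z * xi) = 1 - (z * xi) ^+ M.
  have /= := subrX1 (z * xi) M; lra.
by rewrite gerBl exprn_ge0.
Qed.

Lemma le_powR_trunc (p th v : R) : 1 < p -> 0 < th -> th <= v ->
  v <= v `^ p * th `^ (1 - p).
Proof.
move=> p1 th0 thv; have v0 : 0 < v by exact: lt_le_trans thv.
have -> : v `^ p = v * v `^ (p - 1) by rewrite mulr_powRB1 ?ltW //; lra.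
rewrite -mulrA ler_peMr ?(ltW v0) //.
have -> : th `^ (1 - p) = (th `^ (p - 1))^-1 by rewrite -powRN; congr (_ `^ _); lra.
rewrite ler_pdivlMr ?powR_gt0 // mul1r.
have p10 : 0 <= p - 1 by lra.
by apply: (ge0_ler_powR p10); rewrite ?nnegrE // ltW.
Qed.

Lemma powR_expn (a r : R) (n : nat) : 0 <= a -> (a ^+ n) `^ r = (a `^ r) ^+ n.
Proof. move=> a0; rewrite -(powR_mulrn n a0) -(powR_mulrn n (powR_ge0 a r)).
exact: powRAC. Qed.

Lemma integral_le_support (A D : set R) (h f : R -> R) : measurable A -> measurable D ->
  measurable_fun setT h -> measurable_fun setT f -> (forall t, 0 <= h t) ->
  (forall t, D t -> h t <= f t) -> (forall t, ~ D t -> h t = 0) ->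
  (\int[mu]_(t in A) (h t)%:E <= \int[mu]_(t in D) (f t)%:E)%E.
Proof.
move=> mA mD mh mf h0 hf hD.
apply: (@le_trans _ _ (\int[mu]_(t in D) (h t)%:E)%E); last exact: le_integral_EFin.
apply: (@le_trans _ _ (\int[mu]_(t in setT) (h t)%:E)%E).
  exact: subset_integral_EFin.
rewrite [leRHS]integral_mkcond.
apply: (@le_trans _ _ (\int[mu]_t (((fun t => (h t)%:E) \_ D) t))%E) => //.
rewrite le_eqVlt; apply/orP; left; apply/eqP; apply: eq_integral => t _.
rewrite patchE; case: ifPn => // /negP; rewrite inE => /hD ->.
by [].
Qed.

Lemma integral_cst_itv (a b c : R) : a <= b ->
  (\int[mu]_(t in `[a, b[) c%:E = (c * (b - a))%:E)%E.
Proof.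
move=> ab; rewrite integral_cst //.
have := lebesgue_measure_itv `[a, b[ => /= ->.
rewrite lte_fin; case: ltP => [_ //|ba] /=.
by have -> : b = a by [apply/eqP; rewrite eq_le ab ba]; rewrite subrr mulr0 mule0.
Qed.

(** * Near, high and low parts of a function dominated by V(t) / t *)

Section Decomposition.
Variables (p gam B : R) (V : R -> R).
Hypotheses (p1 : 1 < p) (gam0 : 0 < gam) (B0 : 0 < B).
Hypotheses (mV : measurable_fun setT V) (V0 : forall t, 0 <= V t).
Hypothesis Vp : forall tau, gam <= tau ->
  (\int[mu]_(t in `[tau, (2 * tau)%R[) (V t `^ p)%:E <= (B `^ p * tau)%:E)%E.

Let mVp : measurable_fun setT (fun t => V t `^ p).
Proof. exact: (measurableT_comp (measurable_powR p) mV). Qed.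

Let mVt : measurable_fun setT (fun t => V t * t^-1).
Proof. by apply: measurable_funM => //; exact: measurable_inv. Qed.

(** Each dyadic block costs at most [2 * B], half from the values of [V] up to [B] and half from
    those above, by [le_powR_trunc]. The blocks do not decay, which is the origin of the linear
    growth in [J]. *)
Lemma near_part_le (J : nat) :
  (\int[mu]_(t in `[gam, (gam * 2 ^+ J)%R[) (`|V t * t^-1|)%:E <= (2 * J%:R * B)%:E)%E.
Proof.
elim: J => [|J IH].
  by rewrite expr0 mulr1 mulr0 mul0r set_itv_ge ?integral_set0 // bnd_simp ltxx.
have g2 : 0 < gam * 2 ^+ J by rewrite mulr_gt0 // exprn_gt0.
have gg : gam <= gam * 2 ^+ J by rewrite -[leLHS]mulr1 ler_pM2l // exprn_ege1 // ler1n.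
rewrite (@ge0_integral_itv_split _ gam (gam * 2 ^+ J)) //; last 2 first.
- by rewrite bnd_simp ler_pM2l // ler_eXn2l // ltr1n.
- exact: measurableT_comp.
rewrite -(natr1 J) mulrDr mulrDl mulr1 EFinD; apply: leeD => //.
set tau := gam * 2 ^+ J in g2 gg *.
have -> : gam * 2 ^+ J.+1 = 2 * tau by rewrite exprS mulrCA.
apply: (@le_trans _ _ (\int[mu]_(t in `[tau, (2 * tau)%R[)
    (tau^-1 * (B `^ (1 - p) * V t `^ p + B))%:E)%E).
  apply: le_integral_EFin => //.
  - exact: measurableT_comp.
  - apply: measurable_funM => //; apply: measurable_funD => //; exact: measurable_funM.
  move=> t /=; rewrite in_itv /= => /andP[t1 t2].
  have t0 : 0 < t by exact: lt_le_trans t1.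
  rewrite ger0_norm ?mulr_ge0 ?invr_ge0 ?(ltW t0) // mulrC.
  apply: ler_pM; rewrite ?invr_ge0 ?(ltW t0) //; first by rewrite lef_pV2 ?posrE.
  have [VB|BV] := leP (V t) B.
    by apply: (le_trans VB); rewrite lerDr mulr_ge0 ?powR_ge0.
  by apply: (le_trans (le_powR_trunc p1 B0 (ltW BV))); rewrite mulrC lerDl ltW.
have m1 : measurable_fun setT (fun t => B `^ (1 - p) * V t `^ p) by exact: measurable_funM.
rewrite integralZ_EFin_ge0 //; last 3 first.
- by apply: measurable_funD.
- by move=> t; rewrite addr_ge0 ?(ltW B0) // mulr_ge0 ?powR_ge0.
- by rewrite invr_ge0 ltW.
rewrite integralD_EFin_ge0 //; last 2 first.
- by move=> t; rewrite mulr_ge0 ?powR_ge0.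
- by move=> t; exact: ltW.
rewrite integralZ_EFin_ge0 ?powR_ge0 //; last by move=> t; exact: powR_ge0.
rewrite integral_cst_itv; last lra.
apply: (@le_trans _ _ ((tau^-1)%:E * ((B `^ (1 - p))%:E * (B `^ p * tau)%:E + (B * (2 * tau - tau))%:E))%E).
  apply: lee_wpmul2l; first by rewrite lee_fin invr_ge0 ltW.
  apply: leeD => //; apply: lee_wpmul2l; first by rewrite lee_fin powR_ge0.
  exact: Vp.
change ((tau^-1 * (B `^ (1 - p) * (B `^ p * tau) + B * (2 * tau - tau)))%:E <= (2 * B)%:E)%E.
rewrite lee_fin.
have -> : B `^ (1 - p) * (B `^ p * tau) = B * tau.
  rewrite mulrA -powRD ?(gt_eqF B0) ?implybT // subrK powRr1 //; exact: ltW.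
by rewrite le_eqVlt; apply/orP; left; apply/eqP; field; rewrite gt_eqF.
Qed.

Let kap := (p - 1) / 4.
Let kap0 : 0 < kap. Proof. by rewrite /kap divr_gt0 // subr_gt0. Qed.

(** The exponent must be positive, so that the integral of [V t / t] over the set above the
    threshold converges at infinity, and below 1/2, so that [threshold t ^+ 2 / t ^+ 2] is
    integrable there; 1/4 serves both ends. *)
Definition threshold (t : R) := B * (t / gam) `^ (4^-1).

Lemma measurable_threshold : measurable_fun setT threshold.
Proof.
apply: measurable_funM => //.
apply: (measurableT_comp (measurable_powR _)).
exact: measurable_funM.
Qed.

Lemma threshold_gt0 t : 0 < t -> 0 < threshold t.
Proof. by move=> t0; rewrite mulr_gt0 // powR_gt0 // divr_gt0. Qed.

Lemma two_powRN_lt1 (a : R) : 0 < a -> 0 <= 2 `^ (- a) < 1.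
Proof.
move=> a0; rewrite powR_ge0 powRN invf_lt1 ?powR_gt0 //=.
have := @gt0_ltr_powR _ a a0 1 2; rewrite !nnegrE ler01 ler0n ltr1n powR1.
by move=> /(_ isT isT isT).
Qed.

(** The factor [threshold t]^ (1 - p)[supplied by]le_powR_trunc[decays like t^(-(p - 1)/4), so that
    every dyadic block gains]2 [^ (- kap)]. *)
Lemma big_part_le :
  (\int[mu]_(t in `[gam, +oo[) (V t `^ p * (threshold t `^ (1 - p) * `|t^-1|))%:E
     <= (B / (1 - 2 `^ (- kap)))%:E)%E.
Proof.
have thE t : 0 < t -> threshold t `^ (1 - p) = B `^ (1 - p) * (t / gam) `^ (- kap).
  move=> t0; rewrite /threshold powRM ?powR_ge0 ?(ltW B0) //.
  by rewrite -powRrM; congr (_ * _ `^ _); rewrite /kap; field.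
have := @dyadic_integral_le R gam (B `^ p) (B `^ (1 - p)) (2 `^ (- kap))
  (fun t => V t `^ p) (fun t => threshold t `^ (1 - p) * `|t^-1|) gam0.
have -> : B `^ p * (B `^ (1 - p) / (1 - 2 `^ (- kap))) = B / (1 - 2 `^ (- kap)).
  rewrite mulrA -powRD ?(gt_eqF B0) ?implybT // addrCA subrr addr0 powRr1 //; exact: ltW.
have mth := measurable_threshold.
apply; rewrite ?powR_ge0 //.
- by have /andP[_ ->] := two_powRN_lt1 kap0.
- apply: measurable_funM; first exact: (measurableT_comp (measurable_powR _) mth).
  by apply: measurableT_comp => //; exact: measurable_inv.
- by move=> t; exact: powR_ge0.
- by move=> t; rewrite mulr_ge0 ?powR_ge0.
- move=> s t gs st.
  have s0 : 0 < s by exact: lt_le_trans gs.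
  have t0 : 0 < t by exact: lt_le_trans st.
  have tsV : `|t^-1| <= `|s^-1| by rewrite !normfV (gtr0_norm s0) (gtr0_norm t0) lef_pV2 ?posrE.
  apply: (ler_pM (powR_ge0 _ _) (normr_ge0 _) _ tsV).
  rewrite (thE s s0) (thE t t0) ler_wpM2l ?powR_ge0 // (powRN (s / gam)) (powRN (t / gam)).
  rewrite lef_pV2 ?posrE; [|by rewrite powR_gt0 // divr_gt0..].
  have sg : s / gam \is Num.nneg by rewrite nnegrE ltW // divr_gt0.
  have tg : t / gam \is Num.nneg by rewrite nnegrE ltW // divr_gt0.
  have stg : s / gam <= t / gam by rewrite ler_wpM2r // invr_ge0 ltW.
  exact: (ge0_ler_powR (ltW kap0) sg tg stg).
- move=> j; have T0 : 0 < gam * 2 ^+ j by rewrite mulr_gt0 // exprn_gt0.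
  rewrite (thE _ T0) normfV (gtr0_norm T0) mulrCA mulfV ?gt_eqF // mulr1.
  have -> : gam * 2 ^+ j / gam = 2 ^+ j by rewrite mulrAC mulfV ?gt_eqF // mul1r.
  by rewrite powR_expn.
Qed.

(** The integrand is of order t^(-3/2), so starting at [gam * 2 ^+ J] yields the decay 2^(-J/2), the
    source of the exponential count. *)
Lemma small_part_le (J : nat) :
  (\int[mu]_(t in `[(gam * 2 ^+ J)%R, +oo[) (threshold t ^+ 2 * (t ^+ 2)^-1)%:E
    <= (B ^+ 2 / gam * (2 `^ (- 2^-1)) ^+ J / (1 - 2 `^ (- 2^-1)))%:E)%E.
Proof.
set T := gam * 2 ^+ J; set xi := 2 `^ (- 2^-1).
have T0 : 0 < T by rewrite mulr_gt0 // exprn_gt0.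
have th2 t : 0 <= t -> threshold t ^+ 2 = B ^+ 2 * (t / gam) `^ 2^-1.
  move=> t0; rewrite /threshold exprMn -powR_expn ?divr_ge0 ?(ltW gam0) //.
  rewrite -powR_mulrn ?divr_ge0 ?(ltW gam0) // -powRrM; congr (_ * _ `^ _); by field.
have := @dyadic_integral_le R T 1 (B ^+ 2 / gam * xi ^+ J) xi
  (fun=> 1) (fun t => threshold t ^+ 2 * (t ^+ 2)^-1) T0.
rewrite mul1r; under eq_integral do rewrite mul1r.
have xi1 : 0 <= xi < 1 by apply: two_powRN_lt1; rewrite invr_gt0.
have mth := measurable_threshold.
apply => //.
- by rewrite mulr_ge0 ?exprn_ge0 ?powR_ge0 // divr_ge0 ?sqr_ge0 // ltW.
- by apply: measurable_funM; [exact: measurable_funX | exact: measurable_inv_sqr].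
- by move=> t; rewrite mulr_ge0 ?invr_ge0 ?sqr_ge0.
- move=> s t Ts st.
  have s0 : 0 < s by exact: lt_le_trans Ts.
  have t0 : 0 < t by exact: lt_le_trans st.
  rewrite (th2 s (ltW s0)) (th2 t (ltW t0)) -!(mulrA (B ^+ 2)) ler_wpM2l ?sqr_ge0 //.
  have -> : t / gam = (s / gam) * (t / s) by field; rewrite !gt_eqF.
  have sg0 : 0 <= s / gam by rewrite ltW // divr_gt0.
  have ts0 : 0 <= t / s by rewrite ltW // divr_gt0.
  rewrite (powRM _ sg0 ts0) -(mulrA ((s / gam) `^ 2^-1)) ler_wpM2l ?powR_ge0 //.
  have ts1 : 1 <= t / s by rewrite ler_pdivlMr // mul1r.
  have h1 : (t / s) `^ 2^-1 <= t / s by apply: ler1_powR => //; rewrite invf_le1 // ler1n.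
  have h2 : t / s <= (t / s) ^+ 2 by rewrite expr2 ler_peMr // (le_trans ler01).
  apply: (@le_trans _ _ ((t / s) ^+ 2 * (t ^+ 2)^-1)).
    by rewrite ler_wpM2r ?invr_ge0 ?sqr_ge0 // (le_trans h1).
  by rewrite le_eqVlt; apply/orP; left; apply/eqP; field; rewrite !gt_eqF.
- move=> tau Ttau; have t0 : 0 < tau by exact: lt_le_trans Ttau.
  rewrite integral_cst_itv; [rewrite lee_fin; lra | lra].
- move=> j; have Tj : 0 < T * 2 ^+ j by rewrite mulr_gt0 // exprn_gt0.
  rewrite th2; last exact: ltW.
  have E : T * 2 ^+ j / gam = 2 ^+ (J + j).
    by rewrite /T exprD; field; rewrite gt_eqF.
  rewrite E powR_expn //.
  have -> : T * 2 ^+ j = gam * 2 ^+ (J + j) by rewrite -E; field; rewrite gt_eqF.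
  have -> : gam * 2 ^+ (J + j) * (B ^+ 2 * 2 `^ 2^-1 ^+ (J + j) / (gam * 2 ^+ (J + j)) ^+ 2) =
     B ^+ 2 / gam * (2 `^ 2^-1 ^+ (J + j) / 2 ^+ (J + j)).
    by field; rewrite !gt_eqF // exprn_gt0.
  rewrite -expr_div_n.
  have -> : 2 `^ 2^-1 / 2 = xi.
    transitivity (2 `^ 2^-1 * (2 `^ 1)^-1 : R); first by rewrite powRr1.
    rewrite -powRN -powRD ?pnatr_eq0 ?implybT // /xi.
    by congr (_ `^ _); field.
  by rewrite exprD mulrA.
Qed.

End Decomposition.

Lemma mul_sin_bounded_meas (u : R -> R) (a : R) : bounded_meas u ->
  bounded_meas (fun t => u t * sin (a * t)).
Proof. by move=> bu; apply: bounded_measM => //; exact: bounded_meas_sin. Qed.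

(* Up to time [gam * 2 ^ J] the integrand is bounded in [L^1] by [2 J B]; beyond
   it, the part above [threshold] is bounded in [L^1] and the part below it is
   small in [L^2], so Bessel's inequality counts the exceptional frequencies. *)
Lemma count_large_coefs (beta p gam B : R) (u V : R -> R) (r : seq nat) (J : nat) :
  0 < beta -> 1 < p -> 0 < gam -> 0 < B -> uniq r ->
  bounded_meas u -> measurable_fun setT V -> (forall t, 0 <= V t) ->
  (forall t, t < gam -> u t = 0) -> (forall t, gam <= t -> `|u t| <= V t * t^-1) ->
  (forall tau, gam <= tau ->
    (\int[mu]_(t in `[tau, (2 * tau)%R[) (V t `^ p)%:E <= (B `^ p * tau)%:E)%E) ->
  \sum_(k <- r) ((1 - 2 `^ (- ((p - 1) / 4)))^-1 + 1 + 2 * J%:R <=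
     `|\int[mu]_(t in `[0, 2 * pi / beta]) (u t * sin (half_freq beta k * t))| / B)%R%:R
  <= pi / beta / (1 - 2 `^ (- 2^-1)) / gam * (2 `^ (- 2^-1)) ^+ J.
Proof.
move=> beta0 p1 gam0 B0 ur bu mV V0 u0 uV Vp.
set C := (1 - _)^-1; set P := [set` `[0, 2 * pi / beta]].
have mP : measurable P by exact: measurable_itv.
have iP f : bounded_meas f -> mu.-integrable P (EFin \o f) by exact: integrable_itv.
pose T := gam * 2 ^+ J.
have gT : gam <= T by rewrite /T -[leLHS]mulr1 ler_pM2l // exprn_ege1 // ler1n.
have T0 : 0 < T by exact: lt_le_trans gT.
pose th := threshold gam B.
have mth : measurable_fun setT th by exact: measurable_threshold.
pose u1 t := if t < T then u t else 0.
pose u2 t := if t < T then 0 else if th t < V t then u t else 0.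
pose u3 t := if t < T then 0 else if th t < V t then 0 else u t.
have u123 t : u t = u1 t + (u2 t + u3 t).
  by rewrite /u1 /u2 /u3; case: ifP => _; [|case: ifP => _]; rewrite ?addr0 ?add0r.
have mu_ : measurable_fun setT u by have [] := bu.
have [M uM] : exists M, forall t, `|u t| <= M by have [] := bu.
have M0 : 0 <= M by apply: le_trans (uM 0).
have mltT : measurable_fun setT (fun t : R => t < T) by apply: measurable_fun_ltr.
have mthV : measurable_fun setT (fun t : R => th t < V t) by apply: measurable_fun_ltr.
have bu1 : bounded_meas u1.
  apply: (@bounded_measW _ _ M) => [|t]; first by apply: measurable_fun_ifT.
  by rewrite /u1; case: ifP => _ //; rewrite normr0.
have bu2 : bounded_meas u2.
  apply: (@bounded_measW _ _ M) => [|t].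
    by apply: measurable_fun_ifT => //; apply: measurable_fun_ifT.
  by rewrite /u2; case: ifP => _; [|case: ifP => _]; rewrite ?normr0.
have bu3 : bounded_meas u3.
  apply: (@bounded_measW _ _ M) => [|t].
    by apply: measurable_fun_ifT => //; apply: measurable_fun_ifT.
  by rewrite /u3; case: ifP => _; [|case: ifP => _]; rewrite ?normr0.
pose c (v : R -> R) k := \int[mu]_(t in P) (v t * sin (half_freq beta k * t)).
have cE k : c u k = c u1 k + (c u2 k + c u3 k).
  rewrite /c -!RintD //; try by apply: iP; do ?apply: bounded_measD; exact: mul_sin_bounded_meas.
  by apply: eq_Rintegral => t _; rewrite u123 !mulrDl.
have mVt : measurable_fun setT (fun t => V t * t^-1).
  by apply: measurable_funM => //; exact: measurable_inv.
have mnVt : measurable_fun setT (fun t => `|V t * t^-1|) by exact: measurableT_comp.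
have L1 (v f : R -> R) D b k : bounded_meas v -> measurable D -> measurable_fun setT f ->
    (forall t, D t -> `|v t| <= f t) -> (forall t, ~ D t -> v t = 0) ->
    (\int[mu]_(t in D) (f t)%:E <= b%:E)%E -> `|c v k| <= b.
  move=> bv mD mf vf v0 fb.
  have bvs := mul_sin_bounded_meas (half_freq beta k) bv.
  apply: normr_Rintegral_le => //; first exact: iP.
  apply: le_trans fb; apply: integral_le_support => //.
  - by have [] := bounded_meas_norm bvs.
  - move=> t Dt; apply: le_trans (vf t Dt); rewrite normrM ler_piMr //; exact: sin_max.
  - by move=> t Dt; rewrite v0 // mul0r normr0.
have c1 k : `|c u1 k| <= 2 * J%:R * B.
  apply: (L1 u1 (fun t => `|V t * t^-1|) [set` `[gam, T[] _ k) => //.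
  - move=> t /=; rewrite in_itv /= => /andP[gt tT]; rewrite /u1 tT.
    by apply: (le_trans (uV t gt)); exact: ler_norm.
  - move=> t /=; rewrite in_itv /= => /negP; rewrite negb_and -ltNge -leNgt /u1 => /orP[tg|Tt].
      by case: ifP => // _; exact: u0.
    by rewrite ltNge Tt.
  - exact: (near_part_le p1 gam0 B0 mV V0 Vp).
have c2 k : `|c u2 k| <= B * C.
  apply: (L1 u2 (fun t => V t `^ p * (th t `^ (1 - p) * `|t^-1|)) [set` `[gam, +oo[] _ k) => //.
  - apply: measurable_funM; first exact: (measurableT_comp (measurable_powR p) mV).
    apply: measurable_funM; first exact: (measurableT_comp (measurable_powR _) mth).
    by apply: measurableT_comp => //; exact: measurable_inv.
  - move=> t /=; rewrite in_itv /= andbT => gt.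
    have t0 : 0 < t by exact: lt_le_trans gt.
    have fp : 0 <= V t `^ p * (th t `^ (1 - p) * `|t^-1|) by rewrite !mulr_ge0 ?powR_ge0.
    rewrite /u2; case: ifP => _; first by rewrite normr0.
    case: ifP => [thV|_]; last by rewrite normr0.
    apply: (le_trans (uV t gt)).
    have tV : 0 <= t^-1 by rewrite invr_ge0 ltW.
    rewrite (ger0_norm tV) mulrA; apply: (ler_wpM2r tV).
    by apply: le_powR_trunc => //; [exact: threshold_gt0 | exact: ltW].
  - move=> t /=; rewrite in_itv /= andbT => /negP; rewrite -ltNge => tg.
    by rewrite /u2 (lt_le_trans tg gT).
  - exact: (big_part_le p1 gam0 B0 mV Vp).
pose D3 := B ^+ 2 / gam * (2 `^ (- 2^-1)) ^+ J / (1 - 2 `^ (- 2^-1)).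
have bu33 : bounded_meas (fun t => u3 t ^+ 2) by under eq_fun do rewrite expr2; exact: bounded_measM.
have c3 : \int[mu]_(t in P) (u3 t ^+ 2) <= D3.
  rewrite -lee_fin Rintegral_EFin //; last exact: iP.
  apply: le_trans (small_part_le B gam0 J).
  apply: integral_le_support => //.
  - by have [] := bu33.
  - by apply: measurable_funM; [exact: measurable_funX | exact: measurable_inv_sqr].
  - by move=> t; exact: sqr_ge0.
  - move=> t /=; rewrite in_itv /= andbT => Tt.
    have t0 : 0 < t by exact: lt_le_trans Tt.
    rewrite /u3 ltNge Tt /=; case: ifP => [_|/negbT].
      by rewrite expr0n /= mulr_ge0 ?sqr_ge0 // invr_ge0 sqr_ge0.
    rewrite -leNgt => Vth.
    rewrite -exprVn -exprMn -[leLHS]real_normK ?num_real // ler_sqr ?nnegrE //.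
      apply: (le_trans (uV t (le_trans gT Tt))); rewrite ler_wpM2r // invr_ge0; exact: ltW.
    by rewrite mulr_ge0 ?invr_ge0 ?ltW // threshold_gt0.
  - move=> t /=; rewrite in_itv /= andbT => /negP; rewrite -ltNge => tT.
    by rewrite /u3 tT expr0n.
have bes := bessel beta0 ur bu3.
(* The near part uses up [2 * J * B] and the high part [C * B]; a coefficient above
   [(C + 1 + 2 * J) * B] therefore leaves at least [B] to the low part, and Chebyshev's inequality
   applies to its squares. *)
have pt k : (C + 1 + 2 * J%:R <= `|c u k| / B)%R%:R <= B ^- 2 * (c u3 k) ^+ 2 :> R.
  have rhs0 : 0 <= B ^- 2 * (c u3 k) ^+ 2 by rewrite mulr_ge0 ?invr_ge0 ?sqr_ge0.
  case: (boolP (C + 1 + 2 * J%:R <= `|c u k| / B)) => // h.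
  rewrite ler_pdivlMr // in h.
  have h3 : B <= `|c u3 k|.
    have : `|c u k| <= `|c u1 k| + (`|c u2 k| + `|c u3 k|).
      by rewrite cE (le_trans (ler_normD _ _)) // lerD2l ler_normD.
    have := c1 k; have := c2 k; move: h; nra.
  rewrite mulrC ler_pdivlMr ?exprn_gt0 // mul1r.
  by rewrite -[leRHS]real_normK ?num_real // ler_sqr ?nnegrE ?(ltW B0).
apply: (@le_trans _ _ (\sum_(k <- r) B ^- 2 * (c u3 k) ^+ 2)); first by apply: ler_sum => k _; exact: pt.
rewrite -mulr_sumr; apply: (@le_trans _ _ (B ^- 2 * (pi / beta * D3))).
  rewrite ler_wpM2l ?invr_ge0 ?sqr_ge0 //; apply: (le_trans bes).
  by rewrite ler_wpM2l // divr_ge0 ?pi_ge0 // ltW.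
rewrite le_eqVlt; apply/orP; left; apply/eqP; rewrite /D3.
have h0 : (0 : R) < 2^-1 by rewrite invr_gt0.
have /andP[_ x1] := two_powRN_lt1 h0.
move: x1; move: (2 `^ (- 2^-1)) (@pi R) => xi ppi x1.
field; rewrite !gt_eqF ?subr_gt0 //.
Qed.

(** The length of the block and the count of [count_large_coefs] are both [O(1 / gam)], so after
    division by [B] they share one factor [N0 / gam] in [sum_powR_of_counts]. *)
Lemma sum_coefs_powR (beta p q : R) : 0 < beta -> 1 < p -> 0 < q ->
  exists2 K, 0 < K & forall (gam B : R) (u V : R -> R) (r : seq nat),
  0 < gam -> 0 < B -> uniq r -> (size r)%:R * gam <= 2 / beta ->
  bounded_meas u -> measurable_fun setT V -> (forall t, 0 <= V t) ->
  (forall t, t < gam -> u t = 0) -> (forall t, gam <= t -> `|u t| <= V t * t^-1) ->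
  (forall tau, gam <= tau ->
    (\int[mu]_(t in `[tau, (2 * tau)%R[) (V t `^ p)%:E <= (B `^ p * tau)%:E)%E) ->
  \sum_(k <- r) `|\int[mu]_(t in `[0, 2 * pi / beta]) (u t * sin (half_freq beta k * t))| `^ q
    <= K * B `^ q / gam.
Proof.
move=> b0 p1 q0.
have kap0 : 0 < (p - 1) / 4 by rewrite divr_gt0 // subr_gt0.
have /andP[k0 k1] := two_powRN_lt1 kap0.
have h0 : (0 : R) < 2^-1 by rewrite invr_gt0.
have /andP[x0 x1] := two_powRN_lt1 h0.
pose C := (1 - 2 `^ (- ((p - 1) / 4)))^-1 + 1 : R.
have C0 : 0 <= C by rewrite addr_ge0 // invr_ge0 subr_ge0 ltW.
have xi01 : 0 < (2 : R) `^ (- 2^-1) < 1 by rewrite powR_gt0.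
have [K K0 HK] := sum_powR_of_counts q0 C0 xi01.
pose N0 := 2 / beta + pi / beta / (1 - 2 `^ (- 2^-1)).
have n1 : 0 < 2 / beta by rewrite divr_gt0.
have n2 : 0 < pi / beta / (1 - 2 `^ (- 2^-1)).
  by rewrite !divr_gt0 ?pi_gt0 // subr_gt0.
exists (K * N0); first by rewrite mulr_gt0 // addr_gt0.
move=> gam B u V r g0 B0 ur szr bu mV V0 u0 uV Vp.
pose c k := \int[mu]_(t in `[0, 2 * pi / beta]) (u t * sin (half_freq beta k * t)).
have := HK r (fun k => `|c k| / B) (N0 / gam) _ _ _ _.
have E k : `|c k| `^ q = B `^ q * (`|c k| / B) `^ q.
  by rewrite -powRM ?divr_ge0 ?(ltW B0) // mulrC divfK ?gt_eqF.
under [X in _ -> X <= _]eq_bigr do rewrite E.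
rewrite -mulr_sumr => H.
have -> : K * N0 * B `^ q / gam = B `^ q * (K * (N0 / gam)) by ring.
rewrite ler_wpM2l ?powR_ge0 //; apply: H.
- by rewrite divr_ge0 ?(ltW g0) // addr_ge0 // ltW.
- by move=> k; rewrite divr_ge0 // ltW.
- rewrite ler_pdivlMr // (le_trans szr) // lerDl ltW //.
- move=> J; apply: (le_trans (count_large_coefs J b0 p1 g0 B0 ur bu mV V0 u0 uV Vp)).
  rewrite ler_wpM2r ?exprn_ge0 // ler_wpM2r ?invr_ge0 ?(ltW g0) // lerDr ltW //.
Qed.

End SineCoefficients.

(** * Second differences *)

Section ShiftedKernel.
Variable R : realType.
Local Notation mu := (@lebesgue_measure R).

Lemma powRD3_le (a b c p : R) : 1 < p -> 0 <= a -> 0 <= b -> 0 <= c ->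
  (a + b + c) `^ p <= 3 `^ p * (a `^ p + b `^ p + c `^ p).
Proof.
move=> p1 a0 b0 c0.
have p0 : 0 <= p by lra.
pose M := Num.max a (Num.max b c).
have aM : a <= M by rewrite le_max lexx.
have bM : b <= M by rewrite !le_max lexx orbT.
have cM : c <= M by rewrite !le_max lexx !orbT.
have M0 : 0 <= M by exact: le_trans aM.
apply: (@le_trans _ _ ((3 * M) `^ p)).
  by apply: ge0_ler_powR; rewrite ?nnegrE ?addr_ge0 ?mulr_ge0 //; lra.
rewrite powRM // ler_pM2l ?powR_gt0 //.
have h x : 0 <= x `^ p by exact: powR_ge0.
have := h a; have := h b; have := h c.
by rewrite /M /Num.max; case: ifP => _; [case: ifP => _|]; lra.
Qed.

Lemma powRD2_le (a b p : R) : 0 < p -> 0 <= a -> 0 <= b ->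
  (a + b) `^ p <= 2 `^ p * (a `^ p + b `^ p).
Proof.
move=> p0 a0 b0.
have p00 := ltW p0.
pose M := Num.max a b.
have aM : a <= M by rewrite le_max lexx.
have bM : b <= M by rewrite le_max lexx orbT.
have M0 : 0 <= M by exact: le_trans aM.
apply: (@le_trans _ _ ((2 * M) `^ p)).
  by apply: (ge0_ler_powR p00); rewrite ?nnegrE ?addr_ge0 ?mulr_ge0 //; lra.
rewrite powRM // ler_pM2l ?powR_gt0 //.
have h x : 0 <= x `^ p by exact: powR_ge0.
have := h a; have := h b.
by rewrite /M /Num.max; case: ifP => _; lra.
Qed.

Lemma integral_cst_measure (D : set R) (b d : R) : measurable D -> mu D = d%:E ->
  (\int[mu]_(t in D) b%:E = (b * d)%:E)%E.
Proof. by move=> mD Dd; rewrite integral_cst // EFinM; congr (_ * _)%E; exact: Dd. Qed.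

(** A substitute for Hoelder's inequality at the cost of a factor 2: pointwise, [h] is at most
    [b + b]^ (1 - p) * h [^ p]. *)
Lemma ge0_integral_Lp_L1_on (D : set R) (h : R -> R) (p b d : R) : 1 < p -> 0 < b ->
  measurable D -> mu D = d%:E -> measurable_fun setT h -> (forall t, 0 <= h t) ->
  (\int[mu]_(t in D) (h t `^ p)%:E <= (b `^ p * d)%:E)%E ->
  (\int[mu]_(t in D) (h t)%:E <= (2 * b * d)%:E)%E.
Proof.
move=> p1 b0 mD Dd mh h0 H.
have mhp : measurable_fun setT (fun t => h t `^ p) by exact: (measurableT_comp (measurable_powR p) mh).
apply: (@le_trans _ _ (\int[mu]_(t in D) (b `^ (1 - p) * h t `^ p + b)%:E)%E).
  apply: le_integral_EFin => //.
    by apply: measurable_funD => //; exact: measurable_funM.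
  move=> t _; have [hb|bh] := leP (h t) b.
    by apply: (le_trans hb); rewrite lerDr mulr_ge0 ?powR_ge0.
  by apply: (le_trans (le_powR_trunc p1 b0 (ltW bh))); rewrite mulrC lerDl ltW.
rewrite integralD_EFin_ge0 //; last 3 first.
- exact: measurable_funM.
- by move=> t; rewrite mulr_ge0 ?powR_ge0.
- by move=> t; exact: ltW.
rewrite integralZ_EFin_ge0 ?powR_ge0 //; last by move=> t; exact: powR_ge0.
rewrite (integral_cst_measure _ mD Dd).
apply: (@le_trans _ _ ((b `^ (1 - p))%:E * (b `^ p * d)%:E + (b * d)%:E)%E).
  by apply: leeD => //; apply: lee_wpmul2l => //; rewrite lee_fin powR_ge0.
rewrite -EFinM -EFinD lee_fin mulrA -powRD ?(gt_eqF b0) ?implybT // subrK powRr1 ?(ltW b0) //.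
lra.
Qed.

Lemma ge0_integral_Lp_L1 (h : R -> R) (p b d : R) : 1 < p -> 0 < b -> 0 < d ->
  measurable_fun setT h -> (forall t, 0 <= h t) ->
  (\int[mu]_(t in `]0%R, d[) (h t `^ p)%:E <= (b `^ p * d)%:E)%E ->
  (\int[mu]_(t in `]0%R, d[) (h t)%:E <= (2 * b * d)%:E)%E.
Proof.
move=> p1 b0 d0; apply: ge0_integral_Lp_L1_on => //.
by have := lebesgue_measure_itv `]0%R, d[ => /= ->; rewrite lte_fin d0 sube0.
Qed.

Definition rho (beta t : R) := sin (beta / 2 * t) * (t ^+ 2)^-1.

Lemma measurable_rho beta : measurable_fun setT (rho beta).
Proof.
apply: measurable_funM; last exact: measurable_inv_sqr.
by have [] := bounded_meas_sin (beta / 2).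
Qed.

(** The difference of the cosines of frequencies beta k and beta (k + 1) is twice a product of
    sines. The index [k] survives in one sine only, so letting it vary runs through the sine
    coefficients of one fixed function. *)
Lemma trap_kernelE (beta : R) (k : nat) (t : R) : 0 < beta ->
  trap_kernel (beta * k%:R) (beta * k.+1%:R) t =
  (osc_int (1 : R) * beta)^-1 * (rho beta t * sin (half_freq beta k * t)).
Proof.
move=> b0; rewrite /trap_kernel /osc /rho.
have -> : beta * k.+1%:R - beta * k%:R = beta by rewrite -natr1; ring.
have -> : beta * k.+1%:R * t = half_freq beta k * t + beta / 2 * t.
  by rewrite /half_freq -natr1; field.
have -> : beta * k%:R * t = half_freq beta k * t - beta / 2 * t.
  by rewrite /half_freq; field.
rewrite cosD cosB; have J0 := osc_int1_gt0 R.
have [->|t0] := eqVneq t 0; first by rewrite expr0n /= invr0 !(mulr0, mul0r, subrr).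
by field; rewrite t0 !gt_eqF.
Qed.

Lemma normr_rho_le1 beta t : 0 < beta -> 0 < t -> `|rho beta t| <= beta / 2 * t^-1.
Proof.
move=> b0 t0; rewrite /rho normrM (ger0_norm (_ : 0 <= (t ^+ 2)^-1)) ?invr_ge0 ?sqr_ge0 //.
rewrite ler_pdivrMr ?exprn_gt0 // (le_trans (normr_sin_le_id _)) //.
rewrite (ger0_norm (mulr_ge0 (divr_ge0 (ltW b0) _) (ltW t0))) //.
have -> // : beta / 2 * t^-1 * t ^+ 2 = beta / 2 * t by field; rewrite gt_eqF.
Qed.

Lemma normr_rho_le2 beta t : `|rho beta t| <= (t ^+ 2)^-1.
Proof.
rewrite /rho normrM (ger0_norm (_ : 0 <= (t ^+ 2)^-1)) ?invr_ge0 ?sqr_ge0 //.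
by rewrite ler_piMl ?invr_ge0 ?sqr_ge0 // sin_max.
Qed.

(** The sine and the power of [t] are varied separately. The condition [3 * gam <= t] keeps [s]
    comparable with [t], so the singularity of [rho] at 0 stays away. *)
Lemma rho_sub_le beta gam s t : 0 < beta -> 0 < gam -> 3 * gam <= t -> `|t - s| = gam ->
  `|rho beta t - rho beta s| <= 2 * beta * gam * (t ^+ 2)^-1.
Proof.
move=> b0 g0 gt ts.
have t0 : 0 < t by lra.
have s2 : 2 * t <= 3 * s by have := ler_norm (t - s); rewrite ts; lra.
have s0 : 0 < s by lra.
have -> : rho beta t - rho beta s = (sin (beta / 2 * t) - sin (beta / 2 * s)) * (t ^+ 2)^-1 +
   sin (beta / 2 * s) * ((s - t) * ((t + s) / s ^+ 2)) * (t ^+ 2)^-1.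
  by rewrite /rho; field; rewrite !gt_eqF.
rewrite -mulrDl normrM (ger0_norm (_ : 0 <= (t ^+ 2)^-1)) ?invr_ge0 ?sqr_ge0 //.
rewrite ler_wpM2r ?invr_ge0 ?sqr_ge0 // (le_trans (ler_normD _ _)) //.
have h1 : `|sin (beta / 2 * t) - sin (beta / 2 * s)| <= beta / 2 * gam.
  by rewrite (le_trans (sin_lipschitz _ _)) // -mulrBr normrM ts (ger0_norm (divr_ge0 (ltW b0) _)).
have h2 : `|sin (beta / 2 * s) * ((s - t) * ((t + s) / s ^+ 2))| <= beta / 2 * s * (gam * ((t + s) / s ^+ 2)).
  rewrite normrM [X in _ * X <= _]normrM distrC ts; apply: ler_pM; rewrite ?mulr_ge0 ?normr_ge0 ?(ltW g0) //.
    by rewrite (le_trans (normr_sin_le_id _)) // (ger0_norm (mulr_ge0 (divr_ge0 (ltW b0) _) (ltW s0))).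
  by rewrite (ger0_norm (divr_ge0 (addr_ge0 (ltW t0) (ltW s0)) (sqr_ge0 _))).
have h3 : s * ((t + s) / s ^+ 2) <= 5 / 2.
  have -> : s * ((t + s) / s ^+ 2) = (t + s) / s by field; rewrite gt_eqF.
  rewrite ler_pdivrMr //; lra.
have -> : 2 * beta * gam = beta / 2 * gam + beta / 2 * gam * 3 by field.
apply: lerD => //; apply: (le_trans h2).
have -> : beta / 2 * s * (gam * ((t + s) / s ^+ 2)) = beta / 2 * gam * (s * ((t + s) / s ^+ 2)) by ring.
rewrite ler_wpM2l ?mulr_ge0 ?divr_ge0 ?ltW //; lra.
Qed.

End ShiftedKernel.

Section SupportOfIntegral.
Variable R : realType.
Local Notation mu := (@lebesgue_measure R).

Lemma restrict_support (A D : set R) (f : R -> R) :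
  (forall t, f t != 0 -> (A t <-> D t)) -> f \_ A = f \_ D.
Proof.
move=> AD; apply/funext => t; rewrite !patchE.
have [->|/AD h] := eqVneq (f t) 0; first by rewrite !if_same.
by have -> : (t \in A) = (t \in D) by apply/idP/idP; rewrite !inE => /h.
Qed.

Lemma eq_Rintegral_support (A D : set R) (f : R -> R) :
  (forall t, f t != 0 -> (A t <-> D t)) ->
  \int[mu]_(t in A) f t = \int[mu]_(t in D) f t.
Proof. by move=> /restrict_support h; rewrite Rintegral_mkcond h -Rintegral_mkcond. Qed.

Lemma integrable_support (A D : set R) (f : R -> R) : measurable A -> measurable D ->
  (forall t, f t != 0 -> (A t <-> D t)) ->
  mu.-integrable A (EFin \o f) -> mu.-integrable D (EFin \o f).
Proof.
move=> mA mD /restrict_support h /integrable_mkcond => /(_ mA) ih.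
apply/integrable_mkcond => //; apply: eq_integrable ih => // t _.
by have := congr1 (fun g => (g t)%:E) h; rewrite !patchE /=; case: ifP; case: ifP.
Qed.

End SupportOfIntegral.

Section SecondDifference.
Variable R : realType.
Local Notation mu := (@lebesgue_measure R).
Variables (beta p gam B0 : R) (h : R -> R).
Hypotheses (b0 : 0 < beta) (p1 : 1 < p) (g0 : 0 < gam) (B00 : 0 < B0).
Hypothesis hb : bounded_meas h.
Let dp t := `|h t - h (t + gam)|.
Let dm t := `|h t - h (t - gam)|.
Hypothesis dpP : forall d, 0 < d ->
  (\int[mu]_(t in `]0%R, d[) (dp t `^ p)%:E <= (B0 `^ p * d)%:E)%E.
Hypothesis dmP : forall d, 0 < d ->
  (\int[mu]_(t in `]0%R, d[) (dm t `^ p)%:E <= (B0 `^ p * d)%:E)%E.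
Hypothesis hP : forall d, gam <= d ->
  (\int[mu]_(t in `]0%R, d[) (`|h t| `^ p)%:E <= ((2 * d / gam * B0) `^ p * d)%:E)%E.

(** The cut at [2 * gam], rather than [gam], makes the shifted copies vanish below [gam], hence
    [second_diff] as well. *)
Definition far_part t := h t * rho beta t * \1_(`[2 * gam, +oo[) t.

Definition second_diff t := far_part t - far_part (t - gam) / 2 - far_part (t + gam) / 2.

(** The function V of the overview. In mean [h] grows at most like [t / gam] times [B0], so the
    damping [gam / t] brings the last term to the order of the increments. *)
Definition majorant t := dm t + dp t + gam * `|t|^-1 * `|h t|.

Lemma far_part_ge t : 2 * gam <= t -> far_part t = h t * rho beta t.
Proof. by move=> tg; rewrite /far_part indicE mem_set ?mulr1 //= in_itv /= tg. Qed.

Lemma far_part_lt t : t < 2 * gam -> far_part t = 0.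
Proof.
move=> tg; rewrite /far_part indicE memNset ?mulr0 //= in_itv /=.
by rewrite andbT leNgt tg.
Qed.

Lemma far_part_le t : `|far_part t| <= beta / (4 * gam) * `|h t|.
Proof.
have [tg|tg] := ltP t (2 * gam).
  by rewrite far_part_lt // normr0 mulr_ge0 // divr_ge0 ?ltW // mulr_gt0.
have t0 : 0 < t by have := g0; lra.
rewrite far_part_ge // normrM mulrC ler_wpM2r //.
apply: (le_trans (normr_rho_le1 b0 t0)).
have -> : beta / (4 * gam) = beta / 2 * (2 * gam)^-1 by field; rewrite gt_eqF.
by rewrite ler_pM2l ?divr_gt0 // lef_pV2 ?posrE // mulr_gt0.
Qed.

Lemma bounded_meas_far_part : bounded_meas far_part.
Proof.
have [mh [M hM]] := hb.
apply: (@bounded_measW _ _ (beta / (4 * gam) * M)).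
  apply: measurable_funM; last exact: measurable_indic.
  by apply: measurable_funM => //; exact: measurable_rho.
move=> t; apply: (le_trans (far_part_le t)).
by rewrite ler_wpM2l // divr_ge0 ?ltW // mulr_gt0.
Qed.

Lemma integrable_far_part : mu.-integrable setT (EFin \o far_part).
Proof.
have [mf _] := bounded_meas_far_part.
have [mh [M hM]] := hb.
have M0 : 0 <= M by exact: le_trans (hM 0).
apply: (@integrable_support _ `[0, +oo[) => //.
  move=> t; have [tg|tg _] := ltP t (2 * gam); first by rewrite far_part_lt ?eqxx.
  by split => // _; rewrite /= in_itv /= andbT (le_trans _ tg) // mulr_ge0 // ltW.
apply: (@integrable_le_oneDsqrV _ _ (M * ((4 * gam ^+ 2)^-1 + 1))) => // t.
have C0 : 0 <= (4 * gam ^+ 2)^-1 by rewrite invr_ge0 mulr_ge0 // sqr_ge0.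
have [tg|tg] := ltP t (2 * gam).
  by rewrite far_part_lt // normr0 mulr_ge0 ?oneDsqrV_ge0 // mulr_ge0 // addr_ge0.
have t0 : 0 < t by have := g0; lra.
rewrite far_part_ge // normrM -mulrA; apply: ler_pM => //.
apply: (le_trans (normr_rho_le2 _ _)).
rewrite ler_pdivlMr ?(lt_le_trans ltr01) ?oneDsqr_ge1 // /oneDsqr mulrDr mulr1.
rewrite mulVf ?gt_eqF ?exprn_gt0 // lerD2r lef_pV2 ?posrE ?exprn_gt0 ?mulr_gt0 ?exprn_gt0 //.
have -> : 4 * gam ^+ 2 = (2 * gam) ^+ 2 by rewrite exprMn; congr (_ * _); rewrite -natrX.
by rewrite ler_sqr ?nnegrE ?mulr_ge0 // ltW.
Qed.

Lemma bounded_meas_second_diff : bounded_meas second_diff.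
Proof.
have bf := bounded_meas_far_part.
apply: bounded_measB; [apply: bounded_measB => //|]; apply: bounded_measM => //.
- by apply: (bounded_meas_comp bf); exact: measurable_funB.
- exact: bounded_meas_cst.
- by apply: (bounded_meas_comp bf); exact: measurable_funD.
- exact: bounded_meas_cst.
Qed.

Lemma second_diff_lt t : t < gam -> second_diff t = 0.
Proof. by move=> tg; rewrite /second_diff !far_part_lt ?mul0r ?subr0 //; have := g0; lra. Qed.

(* Averaging the shifts by [gam] and [- gam] multiplies sine coefficients by
   [cos (a * gam)], which stays away from 1 for the frequencies of the block. *)
Lemma second_diff_sin a :
  mu.-integrable setT (EFin \o (fun t => second_diff t * sin (a * t))) /\
  \int[mu]_t (second_diff t * sin (a * t)) =
  (1 - cos (a * gam)) * \int[mu]_t (far_part t * sin (a * t)).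
Proof.
have iF := integrable_far_part.
have iM k : bounded_meas k -> mu.-integrable setT (EFin \o (fun t => far_part t * k t)).
  move=> bk; have := integrable_bounded_measM measurableT iF bk.
  by apply: eq_integrable => // t _; rewrite /= mulrC.
have bs c : bounded_meas (fun t => sin (a * (t + c))).
  apply: (bounded_meas_comp (f := fun t => sin (a * t))); first exact: bounded_meas_sin.
  exact: measurable_funD.
have [i1 e1] := integral_shiftT (- gam) (iM _ (bs gam)).
have [i2 e2] := integral_shiftT gam (iM _ (bs (- gam))).
have i0 := iM _ (bounded_meas_sin a).
have E t : second_diff t * sin (a * t) = far_part t * sin (a * t) -
   (2^-1 * (far_part (- gam + t) * sin (a * (- gam + t + gam))) +
    2^-1 * (far_part (gam + t) * sin (a * (gam + t - gam)))).
  by rewrite /second_diff [- gam + t]addrC [gam + t]addrC subrK addrK; field.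
have iZ k : mu.-integrable setT (EFin \o k) -> mu.-integrable setT (EFin \o (fun t => 2^-1 * k t)).
  move=> ik; have := integrableZl measurableT 2^-1 ik.
  by apply: eq_integrable => // t _; rewrite /= EFinM.
have iD := intD measurableT (iZ _ i1) (iZ _ i2).
split.
  apply: eq_integrable (intB measurableT i0 iD) => // t _.
  by rewrite /= E.
under eq_Rintegral do rewrite E.
rewrite RintB // RintD // ?RintZ // ; last 2 first.
- exact: iZ.
- exact: iZ.
rewrite e1 e2 -RintZ ?measurableT //; last exact: iM.
rewrite -[2^-1 * \int[mu]_t (far_part t * sin (a * (t - gam)))]RintZ ?measurableT //; last exact: iM.
rewrite -RintD ?measurableT //; last 2 first.
- exact: iZ (iM _ _).
- exact: iZ (iM _ _).
have -> : \int[mu]_t (2^-1 * (far_part t * sin (a * (t + gam))) +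
   2^-1 * (far_part t * sin (a * (t - gam)))) =
   \int[mu]_t (cos (a * gam) * (far_part t * sin (a * t))).
  apply: eq_Rintegral => t _; by rewrite mulrDr mulrBr sinD sinB; field.
by rewrite RintZ ?measurableT // mulrBl mul1r.
Qed.

Let dm0 t : 0 <= dm t. Proof. exact: normr_ge0. Qed.
Let dp0 t : 0 <= dp t. Proof. exact: normr_ge0. Qed.

(** A product rule for differences: each shift falls either on [h] or on [rho], and [3 * gam <= t]
    puts all three points beyond the cut. *)
Lemma second_diff_ge t : 3 * gam <= t -> `|second_diff t| <=
  2^-1 * (`|rho beta (t - gam)| * dm t + `|rho beta t - rho beta (t - gam)| * `|h t| +
  (`|rho beta (t + gam)| * dp t + `|rho beta t - rho beta (t + gam)| * `|h t|)).
Proof.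
move=> tg; have g0' := g0.
rewrite /second_diff !far_part_ge; try lra.
have -> : h t * rho beta t - h (t - gam) * rho beta (t - gam) / 2 - h (t + gam) * rho beta (t + gam) / 2
  = 2^-1 * (rho beta (t - gam) * (h t - h (t - gam)) + (rho beta t - rho beta (t - gam)) * h t +
      (rho beta (t + gam) * (h t - h (t + gam)) + (rho beta t - rho beta (t + gam)) * h t)).
  by field.
rewrite normrM (ger0_norm (_ : 0 <= 2^-1)) ?invr_ge0 // ler_wpM2l ?invr_ge0 //.
by apply: (le_trans (ler_normD _ _)); apply: lerD;
  apply: (le_trans (ler_normD _ _)); rewrite !normrM.
Qed.

Let rho_sub_le_pm t : 3 * gam <= t ->
  `|rho beta t - rho beta (t - gam)| <= 2 * beta * gam * (t ^+ 2)^-1 /\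
  `|rho beta t - rho beta (t + gam)| <= 2 * beta * gam * (t ^+ 2)^-1.
Proof.
move=> tg; split; apply: rho_sub_le => //.
  by rewrite opprB addrC subrK gtr0_norm.
by rewrite opprD addrA subrr sub0r normrN gtr0_norm.
Qed.

Lemma second_diff_le_sqr t : 3 * gam <= t ->
  `|second_diff t| <= (2 * (dm t + dp t) + 2 * beta * (gam * `|h t|)) * (t ^+ 2)^-1.
Proof.
move=> tg; apply: (le_trans (second_diff_ge tg)).
have [h1 h2] := rho_sub_le_pm tg.
have t0 : 0 < t by have := g0; lra.
have r s : 2 * t <= 3 * s -> `|rho beta s| <= 4 * (t ^+ 2)^-1.
  move=> ts; apply: (le_trans (normr_rho_le2 _ _)).
  have -> : 4 * (t ^+ 2)^-1 = (t ^+ 2 / 4)^-1 by field; rewrite gt_eqF.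
  rewrite lef_pV2 ?posrE ?divr_gt0 ?exprn_gt0 //; last lra.
  by have := g0; nra.
have r1 : `|rho beta (t - gam)| <= 4 * (t ^+ 2)^-1 by apply: r; lra.
have r2 : `|rho beta (t + gam)| <= 4 * (t ^+ 2)^-1 by apply: r; have := g0; lra.
have q0 : 0 <= (t ^+ 2)^-1 by rewrite invr_ge0 sqr_ge0.
move: (dm0 t) (dp0 t) (normr_ge0 (h t)) => a1 a2 a3.
have e1 := ler_wpM2r a1 r1; have e2 := ler_wpM2r a2 r2.
have e3 := ler_wpM2r a3 h1; have e4 := ler_wpM2r a3 h2.
lra.
Qed.

Lemma second_diff_le_inv t : gam <= t ->
  `|second_diff t| <= 5 * beta * majorant t * t^-1.
Proof.
move=> tg; have g0' := g0; have b0' := b0.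
have t0 : 0 < t by lra.
have ti0 : 0 < t^-1 by rewrite invr_gt0.
rewrite /majorant (gtr0_norm t0) -/(dm t) -/(dp t).
move: (dm0 t) (dp0 t) (normr_ge0 (h t)) => a1 a2 a3.
have bt : 0 < beta * t^-1 by rewrite mulr_gt0.
have [tg3|tg3] := leP (3 * gam) t.
  apply: (le_trans (second_diff_ge tg3)).
  have [h1 h2] := rho_sub_le_pm tg3.
  have r s : 2 * t <= 3 * s -> `|rho beta s| <= beta * t^-1.
    move=> ts; have s0 : 0 < s by lra.
    apply: (le_trans (normr_rho_le1 b0 s0)).
    rewrite -mulrA ler_pM2l // -invfM lef_pV2 ?posrE ?mulr_gt0 //; lra.
  have r1 : `|rho beta (t - gam)| <= beta * t^-1 by apply: r; lra.
  have r2 : `|rho beta (t + gam)| <= beta * t^-1 by apply: r; lra.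
  have e1 := ler_wpM2r a1 r1; have e2 := ler_wpM2r a2 r2.
  have e3 := ler_wpM2r a3 h1; have e4 := ler_wpM2r a3 h2.
  have E : 2 * beta * gam * t ^- 2 = 2 * (beta * t^-1) * (gam * t^-1) by field; rewrite gt_eqF.
  rewrite E in e3 e4.
  have z1 := mulr_ge0 (ltW bt) a1; have z2 := mulr_ge0 (ltW bt) a2.
  have z3 : 0 <= beta * t^-1 * (gam * t^-1) * `|h t| by rewrite !mulr_ge0 // ltW.
  lra.
have c1 := far_part_le t; have c2 := far_part_le (t - gam); have c3 := far_part_le (t + gam).
have n2 : `|h (t - gam)| <= `|h t| + dm t.
  by rewrite -[h (t - gam)](subKr (h t)) (le_trans (ler_normB _ _)).
have n3 : `|h (t + gam)| <= `|h t| + dp t.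
  by rewrite -[h (t + gam)](subKr (h t)) (le_trans (ler_normB _ _)).
set k := beta / (4 * gam) in c1 c2 c3.
have k0 : 0 < k by rewrite divr_gt0 // mulr_gt0.
have c2' := le_trans c2 (ler_wpM2l (ltW k0) n2).
have c3' := le_trans c3 (ler_wpM2l (ltW k0) n3).
have le1 : `|second_diff t| <= k * (2 * `|h t| + dm t / 2 + dp t / 2).
  rewrite /second_diff; apply: (le_trans (ler_normB _ _)).
  apply: (le_trans (lerD (ler_normB _ _) (lexx _))).
  have half (y : R) : `|y / 2| = `|y| / 2 by rewrite normrM (@ger0_norm _ (2^-1)) // invr_ge0.
  rewrite !half; lra.
apply: (le_trans le1).
(* Near the cut no cancellation is used: [t < 3 * gam] trades [1 / gam] for [3 / t], and a further
   factor [3 * gam / t > 1] is inserted for the term in [h]. *)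
have kt : k <= 3 / 4 * (beta * t^-1).
  rewrite /k mulrA ler_pdivlMr // mulrAC ler_pdivrMr ?mulr_gt0 //.
  have := ltW tg3; rewrite -(ler_pM2l b0); lra.
have kt2 : k <= 9 / 4 * (beta * t^-1 * (gam * t^-1)).
  have := ltW tg3; rewrite -(ler_pM2l ti0) mulVf ?gt_eqF // => y.
  have : k * 1 <= 3 / 4 * (beta * t^-1) * (t^-1 * (3 * gam)).
    by apply: ler_pM => //; rewrite ?ler01 ?ltW.
  lra.
have e1 := ler_wpM2r a1 kt; have e2 := ler_wpM2r a2 kt; have e3 := ler_wpM2r a3 kt2.
have z1 := mulr_ge0 (ltW bt) a1; have z2 := mulr_ge0 (ltW bt) a2.
have z3 : 0 <= beta * t^-1 * (gam * t^-1) * `|h t| by rewrite !mulr_ge0 // ltW.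
lra.
Qed.

Let mh : measurable_fun setT h. Proof. by have [] := hb. Qed.

Let mdm : measurable_fun setT (fun t => `|h t - h (t - gam)|).
Proof.
have bs : bounded_meas (fun t => h (t - gam)) by apply: (bounded_meas_comp hb); exact: measurable_funB.
by have [] := bounded_meas_norm (bounded_measB hb bs).
Qed.

Let mdp : measurable_fun setT (fun t => `|h t - h (t + gam)|).
Proof.
have bs : bounded_meas (fun t => h (t + gam)) by apply: (bounded_meas_comp hb); exact: measurable_funD.
by have [] := bounded_meas_norm (bounded_measB hb bs).
Qed.

Lemma measurable_majorant : measurable_fun setT majorant.
Proof.
apply: measurable_funD; first exact: measurable_funD.
apply: measurable_funM; last exact: measurableT_comp.
apply: measurable_funM => //.
exact: (measurableT_comp (@measurable_inv R) (@normr_measurable R setT)).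
Qed.

Lemma majorant_ge0 t : 0 <= majorant t.
Proof. by rewrite !addr_ge0 ?dm0 ?dp0 // !mulr_ge0 ?invr_ge0 // ltW. Qed.

Lemma integral_powR_majorant tau : gam <= tau ->
  (\int[mu]_(t in `[tau, (2 * tau)%R[) ((5 * beta * majorant t) `^ p)%:E
     <= ((360 * beta * B0) `^ p * tau)%:E)%E.
Proof.
move=> gt; have t0 : 0 < tau by have := g0; lra.
have p0 : 0 <= p by have := p1; lra.
have k0 : 0 <= gam / tau by rewrite divr_ge0 // ltW.
pose K := (15 * beta) `^ p.
pose F t := K * (dm t `^ p + dp t `^ p + (gam / tau) `^ p * (`|h t| `^ p)).
have mp (f : R -> R) : measurable_fun setT f -> measurable_fun setT (fun t => f t `^ p).
  by move=> mf; exact: (measurableT_comp (measurable_powR p) mf).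
have mhn : measurable_fun setT (fun t => `|h t|) by exact: measurableT_comp.
have mh3 : measurable_fun setT (fun t => (gam / tau) `^ p * (`|h t| `^ p)).
  by apply: measurable_funM => //; exact: mp.
have mF : measurable_fun setT F.
  apply: measurable_funM => //; apply: measurable_funD => //.
  by apply: measurable_funD; exact: mp.
apply: (@le_trans _ _ (\int[mu]_(t in `[tau, (2 * tau)%R[) (F t)%:E)%E).
  apply: le_integral_EFin => //.
  - by apply: mp; apply: measurable_funM => //; exact: measurable_majorant.
  - by move=> t; exact: powR_ge0.
  move=> t /=; rewrite in_itv /= => /andP[tt _].
  have bb : 0 <= 5 * beta by rewrite mulr_ge0 // ltW.
  have -> : F t = (5 * beta) `^ p * (3 `^ p * (dm t `^ p + dp t `^ p + (gam / tau * `|h t|) `^ p)).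
    have e15 : 15 * beta = 5 * beta * 3 by ring.
    by rewrite /F /K e15 (powRM p bb (ler0n _ 3)) (powRM p k0 (normr_ge0 _)) mulrA.
  rewrite powRM ?majorant_ge0 // ler_wpM2l ?powR_ge0 //.
  have hh : 0 <= gam / tau * `|h t| by rewrite mulr_ge0.
  apply: le_trans (powRD3_le p1 (dm0 t) (dp0 t) hh).
  apply: ge0_ler_powR => //; rewrite ?nnegrE ?majorant_ge0 ?addr_ge0 ?dm0 ?dp0 //.
  have tp : 0 < t by exact: lt_le_trans tt.
  rewrite /majorant lerD2l ler_wpM2r // ler_pM2l // lef_pV2 ?posrE ?normr_gt0 ?gt_eqF //.
  by rewrite gtr0_norm.
have F0 t : 0 <= F t by rewrite mulr_ge0 ?addr_ge0 ?mulr_ge0 ?powR_ge0.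
apply: (@le_trans _ _ (\int[mu]_(t in `]0%R, (2 * tau)%R[) (F t)%:E)%E).
  apply: subset_integral_EFin => // t /=; rewrite !in_itv /= => /andP[tt ->].
  by rewrite (lt_le_trans t0).
rewrite integralZ_EFin_ge0 ?powR_ge0 //; last 2 first.
- by apply: measurable_funD => //; apply: measurable_funD; exact: mp.
- by move=> t; rewrite !addr_ge0 ?mulr_ge0 ?powR_ge0.
rewrite integralD_EFin_ge0 //; last 3 first.
- by apply: measurable_funD; exact: mp.
- by move=> t; rewrite addr_ge0 ?powR_ge0.
- by move=> t; rewrite mulr_ge0 ?powR_ge0.
rewrite integralD_EFin_ge0 //; last 4 first.
- exact: mp.
- exact: mp.
- by move=> t; rewrite powR_ge0.
- by move=> t; rewrite powR_ge0.
rewrite integralZ_EFin_ge0 ?powR_ge0 //; last exact: mp.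
have t20 : 0 < 2 * tau by rewrite mulr_gt0.
have t2g : gam <= 2 * tau by lra.
have l1 := dmP t20; have l2 := dpP t20; have l3 := hP t2g.
have := leeD (leeD l1 l2) (lee_wpmul2l (_ : 0 <= ((gam / tau) `^ p)%:E)%E l3).
rewrite lee_fin powR_ge0 => /(_ isT) l4.
have := lee_wpmul2l (_ : 0 <= K%:E)%E l4.
rewrite lee_fin powR_ge0 => /(_ isT) l5.
apply: (le_trans l5).
rewrite -[leLHS]/((K * (B0 `^ p * (2 * tau) + B0 `^ p * (2 * tau) +
  (gam / tau) `^ p * ((2 * (2 * tau) / gam * B0) `^ p * (2 * tau))))%:E) lee_fin.
have -> : (gam / tau) `^ p * ((2 * (2 * tau) / gam * B0) `^ p * (2 * tau)) =
    4 `^ p * B0 `^ p * (2 * tau).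
  have z0 : 0 <= 2 * (2 * tau) / gam * B0 by rewrite mulr_ge0 ?divr_ge0 ?ltW // mulr_gt0.
  rewrite mulrA -(powRM p k0 z0) -(powRM p (ler0n _ 4) (ltW B00)).
  by congr (_ `^ _ * _); field; rewrite !gt_eqF.
(* 360 is 15 * 6 * 4: 15 joins the 5 of [second_diff_le_inv] to the 3 of [powRD3_le], 4 comes from
   [hP] at [2 * tau], and 6 counts three terms over an interval of length [2 * tau]. *)
have -> : 360 * beta * B0 = 15 * beta * (6 * (4 * B0)) by ring.
have bb : 0 <= 15 * beta by rewrite mulr_ge0 // ltW.
have B4 : 0 <= 4 * B0 by rewrite mulr_ge0 // ltW.
have B6 : 0 <= 6 * (4 * B0) by rewrite mulr_ge0.
rewrite (powRM p bb B6) (powRM p _ B4) // (powRM p _ (ltW B00)) // -[leRHS]mulrA ler_wpM2l ?powR_ge0 //.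
have n4 : 1 <= 4 `^ p.
  have s4 : 1 <= 4 :> R by rewrite ler1n.
  by have := ler_powR s4 p0; rewrite powRr0.
have n6 : 6 <= 6 `^ p.
  have s6 : 1 <= 6 :> R by rewrite ler1n.
  by have := ler_powR s6 (ltW p1); rewrite powRr1.
have Bp : 0 <= B0 `^ p * tau by rewrite mulr_ge0 ?powR_ge0 // ltW.
have e1 := ler_wpM2r Bp n4.
have e2 : 0 <= 4 `^ p * (B0 `^ p * tau) by rewrite mulr_ge0 // powR_ge0.
have e3 := ler_wpM2r e2 n6.
lra.
Qed.

End SecondDifference.

(** * Reduction of the kernel integral to sine coefficients on one period *)

Section TrapezoidCoefficients.
Variable R : realType.
Local Notation mu := (@lebesgue_measure R).
Variables (beta p gam B0 M1 : R) (h : R -> R).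
Hypotheses (b0 : 0 < beta) (p1 : 1 < p) (g0 : 0 < gam) (g1 : gam <= beta^-1) (B00 : 0 < B0).
Hypothesis hb : bounded_meas h.
Hypothesis dpP : forall d, 0 < d ->
  (\int[mu]_(t in `]0%R, d[) (`|h t - h (t + gam)| `^ p)%:E <= (B0 `^ p * d)%:E)%E.
Hypothesis dmP : forall d, 0 < d ->
  (\int[mu]_(t in `]0%R, d[) (`|h t - h (t - gam)| `^ p)%:E <= (B0 `^ p * d)%:E)%E.
Hypothesis hP : forall d, gam <= d ->
  (\int[mu]_(t in `]0%R, d[) (`|h t| `^ p)%:E <= ((2 * d / gam * B0) `^ p * d)%:E)%E.
Hypothesis hM1 : forall t, gam * `|h t| <= M1 * B0.

Let mh : measurable_fun setT h. Proof. by have [] := hb. Qed.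
Let mnh : measurable_fun setT (fun t => `|h t|). Proof. exact: measurableT_comp. Qed.

Lemma integrable_rho_sin k : mu.-integrable `[0, +oo[
  (EFin \o (fun t => h t * (rho beta t * sin (half_freq beta k * t)))).
Proof.
have J0 := osc_int1_gt0 R.
have bJ := bounded_measM hb (bounded_meas_cst (osc_int (1 : R) * beta)).
have := integrable_bounded_measM (measurable_itv _)
  (integrable_trap_kernel (beta * k%:R) (beta * k.+1%:R)) bJ.
apply: eq_integrable => // t _ /=; rewrite trap_kernelE //; congr EFin.
by field; rewrite !gt_eqF.
Qed.

(** Only []0, 2 * gam[] contributes. There the sine is bounded by its argument, which cancels the
    singularity of [rho] and leaves the constant [beta / gam] in front of [h]. *)
Lemma near_half_freq_le k : half_freq beta k * gam <= 2 ->
  `|\int[mu]_(t in `[0, +oo[) (h t * (rho beta t * sin (half_freq beta k * t))) -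
    \int[mu]_t (far_part beta gam h t * sin (half_freq beta k * t))| <= 16 * beta * B0.
Proof.
have : 0 < half_freq beta k by rewrite mulr_gt0 // ltr_wpDl // invr_gt0.
have := integrable_rho_sin k; move: (half_freq beta k) => a iR a0 ag.
have bf := bounded_meas_far_part b0 g0 hb.
have iF : mu.-integrable setT (EFin \o (fun t => far_part beta gam h t * sin (a * t))).
  have := integrable_bounded_measM measurableT (integrable_far_part b0 g0 hb) (bounded_meas_sin a).
  by apply: eq_integrable => // t _; rewrite /= mulrC.
have sF t : far_part beta gam h t * sin (a * t) != 0 -> (setT t <-> `[0, +oo[%classic t).
  have [tg|tg _] := ltP t (2 * gam); first by rewrite far_part_lt ?mul0r ?eqxx.
  by split => // _; rewrite /= in_itv /= andbT (le_trans _ tg) // mulr_ge0 // ltW.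
rewrite (eq_Rintegral_support sF).
have iF' := integrable_support measurableT (measurable_itv `[0, +oo[) sF iF.
rewrite -RintB //.
apply: normr_Rintegral_le => //; first exact: intB.
have g2 : 0 < 2 * gam by rewrite mulr_gt0.
have gg : gam <= 2 * gam by have := g0; lra.
(* [4 * B0] is the mean level that [hP] gives at [d = 2 * gam]. *)
have H1 := @ge0_integral_Lp_L1 R (fun t => `|h t|) p (4 * B0) (2 * gam) p1 _ g2 mnh _ _.
have {H1} H1 : (\int[mu]_(t in `]0%R, (2 * gam)%R[) (`|h t|)%:E <= (16 * B0 * gam)%:E)%E.
  have -> : 16 * B0 * gam = 2 * (4 * B0) * (2 * gam) by ring.
  apply: H1 => //; first by rewrite mulr_gt0.
  have -> : 4 * B0 = 2 * (2 * gam) / gam * B0 by field; rewrite gt_eqF.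
  exact: hP.
have k0 : 0 <= beta / gam by rewrite divr_ge0 // ltW.
apply: (@le_trans _ _ (\int[mu]_(t in `]0%R, (2 * gam)%R[) (beta / gam * `|h t|)%:E)%E); last first.
  rewrite integralZ_EFin_ge0 //.
  have := lee_wpmul2l (_ : 0 <= (beta / gam)%:E)%E H1; rewrite lee_fin k0 => /(_ isT) H2.
  apply: (le_trans H2); rewrite -EFinM lee_fin.
  by have -> : beta / gam * (16 * B0 * gam) = 16 * beta * B0 by field; rewrite gt_eqF.
have -> : (\int[mu]_(t in `[0%R, +oo[) (`|h t * (rho beta t * sin (a * t)) -
      far_part beta gam h t * sin (a * t)|)%:E =
    \int[mu]_(t in `[0%R, +oo[) (`|h t * (rho beta t * sin (a * t)) -
      far_part beta gam h t * sin (a * t)| * \1_(`[0, +oo[) t)%:E)%E.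
  by apply: eq_integral => t tA; rewrite indicE tA mulr1.
apply: integral_le_support => //.
- apply: measurable_funM; last exact: measurable_indic.
  apply: measurableT_comp => //; apply: measurable_funB; apply: measurable_funM => //.
  + by apply: measurable_funM; [exact: measurable_rho|have [] := bounded_meas_sin a].
  + by have [] := bf.
  + by have [] := bounded_meas_sin a.
- exact: measurable_funM.
- move=> t /=; rewrite in_itv /= => /andP[t0 tg]; rewrite indicE mem_set ?mulr1; last first.
    by rewrite /= in_itv /= ltW.
  rewrite far_part_lt // mul0r subr0.
  rewrite normrM mulrC ler_wpM2r // normrM.
  have r1 := normr_rho_le1 b0 t0.
  have s1 := normr_sin_le_id (a * t).
  have at0 : 0 < a * t by rewrite mulr_gt0.
  rewrite (gtr0_norm at0) in s1.
  apply: (le_trans (ler_pM (normr_ge0 _) (normr_ge0 _) r1 s1)).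
  have -> : beta / 2 / t * (a * t) = beta / 2 * a by field; rewrite gt_eqF.
  rewrite ler_pdivlMr //; have := ler_wpM2l (ltW b0) ag; lra.
- move=> t /= /negP; rewrite in_itv /= negb_and -!leNgt => /orP[t0|t0].
    move: t0; rewrite le_eqVlt => /orP[/eqP->|t0].
      by rewrite /far_part /rho !mulr0 sin0 !mulr0 subrr normr0 mul0r.
    by rewrite indicE memNset ?mulr0 //= in_itv /= andbT leNgt t0.
  by rewrite far_part_ge // mulrA subrr normr0 mul0r.
Qed.

(** Bessel's inequality covers one period only; beyond it the decay in t^(-2) of
    [second_diff_le_sqr] bounds every coefficient absolutely. The global bound [hM1] controls the
    term in [h]. *)
Lemma second_diff_tail_le P a : 3 * gam <= P ->
  `|\int[mu]_(t in `[P, +oo[) (second_diff beta gam h t * sin (a * t))|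
     <= (16 + 2 * beta * M1) * B0 * (P^-1 / (1 - 2^-1)).
Proof.
move=> gP; have P0 : 0 < P by have := g0; lra.
have [iu _] := second_diff_sin b0 g0 hb a.
have iu' : mu.-integrable `[P, +oo[ (EFin \o (fun t => second_diff beta gam h t * sin (a * t))).
  by apply: integrableS iu.
apply: normr_Rintegral_le => //.
have bu := bounded_meas_second_diff b0 g0 hb.
have mB : measurable_fun setT (fun t : R => h (t - gam)).
  by apply: (measurableT_comp mh); exact: measurable_funB.
have mD : measurable_fun setT (fun t : R => h (t + gam)).
  by apply: (measurableT_comp mh); exact: measurable_funD.
have mdm : measurable_fun setT (fun t : R => `|h t - h (t - gam)|).
  by apply: measurableT_comp => //; exact: measurable_funB.
have mdp : measurable_fun setT (fun t : R => `|h t - h (t + gam)|).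
  by apply: measurableT_comp => //; exact: measurable_funB.
have MB : 0 <= M1 * B0 by rewrite (le_trans _ (hM1 0)) // mulr_ge0 // ltW.
have bMB : 0 <= 2 * beta * (M1 * B0) by rewrite mulr_ge0 // mulr_ge0 // ltW.
pose H t := 2 * (`|h t - h (t - gam)| + `|h t - h (t + gam)|) + 2 * beta * (M1 * B0).
have H0 t : 0 <= H t by rewrite addr_ge0 // mulr_ge0 // addr_ge0.
have mH : measurable_fun setT H.
  by apply: measurable_funD => //; apply: measurable_funM => //; exact: measurable_funD.
apply: (@le_trans _ _ (\int[mu]_(t in `[P, +oo[) (H t * (t ^+ 2)^-1)%:E)%E).
  apply: le_integral_EFin => //.
  - apply: measurableT_comp => //; apply: measurable_funM; first by have [] := bu.
    by have [] := bounded_meas_sin a.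
  - by apply: measurable_funM => //; exact: measurable_inv_sqr.
  move=> t /=; rewrite in_itv /= andbT => tP.
  rewrite normrM; apply: (@le_trans _ _ (`|second_diff beta gam h t| * 1)).
    by rewrite ler_wpM2l // sin_max.
  rewrite mulr1 (le_trans (second_diff_le_sqr h b0 g0 (le_trans gP tP))) //.
  rewrite ler_wpM2r ?invr_ge0 ?sqr_ge0 // lerD2l ler_wpM2l // mulr_ge0 // ltW //.
have A0 : 0 <= (16 + 2 * beta * M1) * B0.
  have -> : (16 + 2 * beta * M1) * B0 = 16 * B0 + 2 * beta * (M1 * B0) by ring.
  by rewrite addr_ge0 // mulr_ge0 // ltW.
apply: dyadic_integral_le => //.
- by rewrite invr_ge0 ltW.
- by rewrite invr_ge0 ler0n /= invf_lt1 // ltr1n.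
- exact: measurable_inv_sqr.
- by move=> t; rewrite invr_ge0 sqr_ge0.
- move=> s t Ps st; have s0 : 0 < s by exact: lt_le_trans Ps.
  have t0 : 0 < t by exact: lt_le_trans st.
  by rewrite lef_pV2 ?posrE ?exprn_gt0 // ler_sqr ?nnegrE // ltW.
- move=> tau Pt; have t0 : 0 < tau by exact: lt_le_trans Pt.
  have t20 : 0 < 2 * tau by rewrite mulr_gt0.
  apply: (@le_trans _ _ (\int[mu]_(t in `]0%R, (2 * tau)%R[)
      (2 * (`|h t - h (t - gam)| + `|h t - h (t + gam)|))%:E +
      \int[mu]_(t in `[tau, (2 * tau)%R[) (2 * beta * (M1 * B0))%:E)%E).
    rewrite /H integralD_EFin_ge0 //; last first.
      by apply: measurable_funM => //; exact: measurable_funD.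
    apply: leeD => //; apply: subset_integral_EFin => //.
    + move=> t /=; rewrite !in_itv /= => /andP[tt ->].
      by rewrite (lt_le_trans t0).
    + by apply: measurable_funM => //; exact: measurable_funD.
  rewrite integralZ_EFin_ge0 //; last exact: measurable_funD.
  rewrite integralD_EFin_ge0 // integral_cst_itv; last lra.
  have l1 := ge0_integral_Lp_L1 p1 B00 t20 mdm (fun t => normr_ge0 _) (dmP t20).
  have l2 := ge0_integral_Lp_L1 p1 B00 t20 mdp (fun t => normr_ge0 _) (dpP t20).
  have l3 := lee_wpmul2l (_ : 0 <= (2 : R)%:E)%E (leeD l1 l2).
  apply: (le_trans (leeD (l3 _) (lexx _))); first by rewrite lee_fin.
  rewrite -[leLHS]/((2 * (2 * B0 * (2 * tau) + 2 * B0 * (2 * tau)) +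
     2 * beta * (M1 * B0) * (2 * tau - tau))%:E) lee_fin; lra.
- move=> j; rewrite exprVn.
  have x0 : 0 < P * 2 ^+ j by rewrite mulr_gt0 // exprn_gt0.
  rewrite -invfM; set z := P * 2 ^+ j in x0 *.
  by have -> : z / z ^+ 2 = z^-1 by field; rewrite gt_eqF.
Qed.

(** The angle [half_freq beta k * gam] lies in [[1/2, 2]], inside the range where the cosine
    decreases, so the factor [1 - cos] of [second_diff_sin] is at least [1 - cos (1/2)] and can be
    divided out. *)
Lemma half_freq_coef_le k : half_freq beta k * gam <= 2 -> 2^-1 <= half_freq beta k * gam ->
  `|\int[mu]_(t in `[0, +oo[) (h t * trap_kernel (beta * k%:R) (beta * k.+1%:R) t)| <=
   (osc_int (1 : R) * beta)^-1 * ((1 - cos (2^-1 : R))^-1 *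
    `|\int[mu]_(t in `[0, 2 * pi / beta]) (second_diff beta gam h t * sin (half_freq beta k * t))|
    + (16 * beta + (1 - cos (2^-1 : R))^-1 * ((16 + 2 * beta * M1) * ((2 * pi / beta)^-1 / (1 - 2^-1)))) * B0).
Proof.
move=> a2 a1; set a := half_freq beta k; set P := 2 * pi / beta.
have J0 := osc_int1_gt0 R; have p2 := pi_ge2 R.
have c0 : cos (2^-1 : R) < 1.
  rewrite -[ltRHS]cos0 ltr_cos ?invr_gt0 //; rewrite in_itv /= ?lexx ?pi_ge0 //=.
  by rewrite invr_ge0 ler0n; lra.
have ca : cos (a * gam) <= cos (2^-1 : R).
  move: a1; rewrite le_eqVlt => /orP[/eqP->//|a1].
  by rewrite /a ltW // ltr_cos // in_itv /=; apply/andP; split; lra.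
have gP : 3 * gam <= P.
  rewrite /P -mulrA; have := g1; have := invr_gt0 beta; rewrite b0 => bi; nra.
have P0 : 0 < P by have := g0; lra.
have [iu eu] := second_diff_sin b0 g0 hb a.
have nr := near_half_freq_le a2.
have tl := second_diff_tail_le a gP.
have e1 : \int[mu]_t (second_diff beta gam h t * sin (a * t)) =
  \int[mu]_(t in `[0, P]) (second_diff beta gam h t * sin (a * t)) +
  \int[mu]_(t in `[P, +oo[) (second_diff beta gam h t * sin (a * t)).
  have -> : \int[mu]_t (second_diff beta gam h t * sin (a * t)) =
    \int[mu]_(t in `[0, +oo[) (second_diff beta gam h t * sin (a * t)).
    apply: eq_Rintegral_support => t; have [tg|tg _] := ltP t gam.
      by rewrite second_diff_lt // mul0r eqxx.
    by split => // _; rewrite /= in_itv /= andbT; have := g0; lra.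
  have U : `[0, +oo[%classic = `[0, P[%classic `|` `[P, +oo[%classic.
    by rewrite -itv_bndbnd_setU // bnd_simp ltW.
  rewrite U Rintegral_setU //; last 2 first.
  - by apply: integrableS iu => //; exact: measurableU.
  - apply/disj_set2P; apply/seteqP; split => t //= [].
    by rewrite !in_itv /= => /andP[_ tP]; rewrite leNgt tP.
  by congr (_ + _); apply: Rintegral_itv_bndo_bndc; apply: integrableS iu.
set Y := \int[mu]_(t in `[0, P]) _ in e1 *.
set T := \int[mu]_(t in `[P, +oo[) _ in e1 tl.
set I := \int[mu]_t (far_part beta gam h t * sin (a * t)) in eu nr.
set Q := \int[mu]_(t in `[0, +oo[) _ in nr.
have -> : \int[mu]_(t in `[0, +oo[) (h t * trap_kernel (beta * k%:R) (beta * k.+1%:R) t) =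
    (osc_int (1 : R) * beta)^-1 * Q.
  rewrite /Q -RintZ //; last exact: integrable_rho_sin.
  by apply: eq_Rintegral => t _; rewrite trap_kernelE // mulrCA.
have Jb : 0 < (osc_int (1 : R) * beta)^-1 by rewrite invr_gt0 mulr_gt0.
rewrite normrM (gtr0_norm Jb) ler_pM2l //.
set ka := 1 - cos (2^-1 : R).
have ka0 : 0 < ka by rewrite /ka; lra.
have I1 : `|I| <= ka^-1 * `|Y + T|.
  rewrite -e1 eu normrM ler_pdivlMl // ler_wpM2r //.
  by rewrite (le_trans _ (ler_norm _)) // /ka; lra.
have Q1 : `|Q| <= 16 * beta * B0 + `|I|.
  by rewrite -[Q](subrK I) (le_trans (ler_normD _ _)) // lerD2r.
have kai : 0 < ka^-1 by rewrite invr_gt0.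
have YT : ka^-1 * `|Y + T| <= ka^-1 * (`|Y| + (16 + 2 * beta * M1) * B0 * (P^-1 / (1 - 2^-1))).
  by rewrite ler_pM2l // (le_trans (ler_normD _ _)) // lerD2l.
lra.
Qed.

End TrapezoidCoefficients.

(** Apart from the sine coefficient, [half_freq_coef_le] leaves a term [c * B0] for each of at most
    [2 / (beta * gam)] indices. The constant is independent of [gam], [B0] and [h], hence uniform
    over all blocks. *)
Lemma sum_block_powR (R : realType) (beta p q M1 : R) : 0 < beta -> 1 < p -> 0 < q -> 0 <= M1 ->
  exists2 K, 0 < K & forall (gam B0 : R) (h : R -> R) (r : seq nat),
  0 < gam -> gam <= beta^-1 -> 0 < B0 -> bounded_meas h ->
  (forall d, 0 < d ->
    (\int[lebesgue_measure]_(t in `]0%R, d[) (`|h t - h (t + gam)| `^ p)%:E <= (B0 `^ p * d)%:E)%E) ->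
  (forall d, 0 < d ->
    (\int[lebesgue_measure]_(t in `]0%R, d[) (`|h t - h (t - gam)| `^ p)%:E <= (B0 `^ p * d)%:E)%E) ->
  (forall d, gam <= d ->
    (\int[lebesgue_measure]_(t in `]0%R, d[) (`|h t| `^ p)%:E
       <= ((2 * d / gam * B0) `^ p * d)%:E)%E) ->
  (forall t, gam * `|h t| <= M1 * B0) ->
  uniq r -> (size r)%:R * gam <= 2 / beta ->
  (forall k, k \in r -> 2^-1 <= half_freq beta k * gam /\ half_freq beta k * gam <= 2) ->
  \sum_(k <- r) `|\int[lebesgue_measure]_(t in `[0, +oo[)
     (h t * trap_kernel (beta * k%:R) (beta * k.+1%:R) t)| `^ q <= K * (B0 `^ q / gam).
Proof.
move=> b0 p1 q0 M0; have [K K0 HK] := sum_coefs_powR b0 p1 q0.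
have J0 := osc_int1_gt0 R; have p0 := pi_gt0 R; have p2 := pi_ge2 R.
have c0 : cos (2^-1 : R) < 1.
  rewrite -[ltRHS]cos0 ltr_cos ?invr_gt0 //; rewrite in_itv /= ?lexx ?pi_ge0 //=.
  by rewrite invr_ge0 ler0n; lra.
have [J JE Jp] : exists2 J, J = (osc_int (1 : R) * beta)^-1 & 0 < J.
  by eexists; [reflexivity|rewrite invr_gt0 mulr_gt0].
have [ka kaE ka0] : exists2 ka, ka = (1 - cos (2^-1 : R))^-1 & 0 < ka.
  by eexists; [reflexivity|rewrite invr_gt0 subr_gt0].
have h1 : 0 < (1 - 2^-1 : R) by lra.
have [c cE c00] : exists2 c, c = 16 * beta + ka * ((16 + 2 * beta * M1) * ((2 * pi / beta)^-1 / (1 - 2^-1))) & 0 < c.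
  eexists; first by reflexivity.
  have z1 : 0 <= 16 + 2 * beta * M1 by rewrite addr_ge0 // mulr_ge0 // mulr_ge0 // ltW.
  have z2 : 0 <= (2 * pi / beta)^-1 / (1 - 2^-1).
    by rewrite divr_ge0 ?(ltW h1) // invr_ge0 divr_ge0 ?(ltW b0) // mulr_ge0 // ltW.
  by apply: ltr_pwDl; [rewrite mulr_gt0|exact: (mulr_ge0 (ltW ka0) (mulr_ge0 z1 z2))].
have bb : 0 < 360 * beta by apply: mulr_gt0; rewrite ?ltr0n.
exists (J `^ q * 2 `^ q * (ka `^ q * (K * (360 * beta) `^ q) + c `^ q * (2 / beta))).
  have q3 x : 0 < x -> 0 < x `^ q by exact: powR_gt0.
  apply: mulr_gt0; first by apply: mulr_gt0; exact: q3.
  apply: addr_gt0.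
    by apply: mulr_gt0; [exact: q3|apply: mulr_gt0; [exact: K0|exact: (q3 _ bb)]].
  by apply: mulr_gt0; [exact: q3|rewrite divr_gt0].
move=> gam B0 h r g0 g1 B00 hb dpP dmP hP hM1 ur sr hr.
have bu := bounded_meas_second_diff b0 g0 hb.
have mV : measurable_fun setT (fun t => 5 * beta * majorant gam h t).
  by apply: measurable_funM => //; exact: measurable_majorant.
have BB : 0 < 360 * beta * B0 := mulr_gt0 bb B00.
pose y k := `|\int[lebesgue_measure]_(t in `[0, 2 * pi / beta])
  (second_diff beta gam h t * sin (half_freq beta k * t))| `^ q.
have H : \sum_(k <- r) y k <= K * (360 * beta * B0) `^ q / gam.
  apply: (HK gam _ (second_diff beta gam h) (fun t => 5 * beta * majorant gam h t)) => //.
  - by move=> t; rewrite !mulr_ge0 ?majorant_ge0 // ltW.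
  - by move=> t; exact: second_diff_lt.
  - by move=> t; exact: second_diff_le_inv.
  - by move=> tau; exact: integral_powR_majorant.
rewrite (powRM q (ltW bb) (ltW B00)) in H.
have tm k : k \in r -> `|\int[lebesgue_measure]_(t in `[0, +oo[)
     (h t * trap_kernel (beta * k%:R) (beta * k.+1%:R) t)| `^ q <=
   J `^ q * 2 `^ q * (ka `^ q * y k + c `^ q * B0 `^ q).
  move=> /hr[a1 a2].
  have t1 := half_freq_coef_le b0 p1 g0 g1 B00 hb dpP dmP hP hM1 a2 a1.
  rewrite -kaE -JE -cE in t1.
  set Y := `|\int[lebesgue_measure]_(t in `[0, 2 * pi / beta]) _| in t1.
  have Y0 : 0 <= Y by exact: normr_ge0.
  have cB : 0 <= c * B0 by rewrite mulr_ge0 // ltW.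
  have kY : 0 <= ka * Y by rewrite mulr_ge0 // ltW.
  have rhs0 : 0 <= J * (ka * Y + c * B0) by rewrite mulr_ge0 ?addr_ge0 // ltW.
  apply: (le_trans (ge0_ler_powR (ltW q0) _ _ t1)); rewrite ?nnegrE //.
  rewrite (powRM q (ltW Jp) (addr_ge0 kY cB)) -mulrA ler_wpM2l ?powR_ge0 //.
  apply: (le_trans (powRD2_le q0 kY cB)).
  by rewrite (powRM q (ltW ka0) Y0) (powRM q (ltW c00) (ltW B00)).
rewrite big_seq; apply: (le_trans (ler_sum _ tm)); rewrite -big_seq.
rewrite -mulr_sumr -[leRHS]mulrA ler_wpM2l ?mulr_ge0 ?powR_ge0 //.
rewrite big_split /= -mulr_sumr mulrDl; apply: lerD.
  rewrite -mulrA ler_wpM2l ?powR_ge0 //; apply: (le_trans H).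
  by rewrite le_eqVlt; apply/orP; left; apply/eqP; ring.
rewrite big_const_seq count_predT iter_addr_0 -[_ *+ size r]mulr_natr.
have -> : c `^ q * (2 / beta) * (B0 `^ q / gam) = c `^ q * B0 `^ q * (2 / beta / gam) by ring.
by rewrite ler_wpM2l ?mulr_ge0 ?powR_ge0 // ler_pdivlMr.
Qed.

(** * Passing to Borel representatives *)

Section LowerIntegral.
Variable R : realType.
Local Notation mu := (@lebesgue_measure R).
Import HBNNSimple.

(* The library integral of a nonnegative function is the supremum of the integrals
   of the simple functions below it, so monotonicity needs no measurability. *)
Lemma le_integral_lower (D : set R) (f g : R -> \bar R) :
  (forall t, 0 <= f t)%E -> (forall t, 0 <= g t)%E -> (forall t, D t -> f t <= g t)%E ->
  (\int[mu]_(t in D) f t <= \int[mu]_(t in D) g t)%E.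
Proof.
move=> f0 g0 fg; rewrite !ge0_integralE //.
apply: ub_ereal_sup => _ [s sf <-]; apply: ereal_sup_ubound; exists s => // t.
apply: (le_trans (sf t)); rewrite !patchE; case: ifPn => // tD.
by apply: fg; rewrite inE in tD.
Qed.

(** A simple function below [f] keeps its integral when it is set to 0 on the null set, and then it
    lies below [g]. This moves estimates between [f] and its Borel representatives. *)
Lemma ae_le_integral_lower (D : set R) (f g : R -> \bar R) :
  (forall t, 0 <= f t)%E -> (forall t, 0 <= g t)%E ->
  {ae mu, forall t, D t -> (f t <= g t)%E} ->
  (\int[mu]_(t in D) f t <= \int[mu]_(t in D) g t)%E.
Proof.
move=> f0 g0 [N [mN muN hN]].
rewrite ge0_integralE //; apply: ub_ereal_sup => _ [s sf <-].
rewrite -integralT_nnsfun.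
have -> : (\int[mu]_t (s t)%:E = \int[mu]_(t in ~` N) (s t)%:E)%E.
  rewrite (@ge0_negligible_integral _ _ _ mu setT N) ?setTD //.
  - by apply/measurable_EFinP.
  - by move=> t _; rewrite lee_fin fun_ge0.
rewrite integral_mkcond [leRHS]integral_mkcond.
apply: le_integral_lower => [t|t|t _].
- by rewrite patchE; case: ifP => // _; rewrite lee_fin fun_ge0.
- by rewrite patchE; case: ifP.
rewrite patchE; case: ifPn => [|_]; last by rewrite patchE; case: ifP.
rewrite inE => /(contra_not (hN t)) /contrapT h.
apply: (le_trans (sf t)); rewrite !patchE; case: ifPn => // tD.
by apply: h; rewrite inE in tD.
Qed.

Lemma ae_imply (P Q : R -> Prop) : {ae mu, forall t, P t} -> (forall t, P t -> Q t) ->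
  {ae mu, forall t, Q t}.
Proof.
by move=> [N [mN muN hN]] PQ; exists N; split => // t /= h; apply: hN => /= /PQ.
Qed.

Lemma ae_and (P Q : R -> Prop) : {ae mu, forall t, P t} -> {ae mu, forall t, Q t} ->
  {ae mu, forall t, P t /\ Q t}.
Proof.
move=> hP hQ; have := negligibleU hP hQ; apply: negligibleS => t /= h.
by have [p|] := pselect (P t); [right => q; apply: h|left].
Qed.

Lemma ae_eq_Rintegral_lower (D : set R) (f g : R -> R) :
  {ae mu, forall t, f t = g t} -> \int[mu]_(t in D) f t = \int[mu]_(t in D) g t.
Proof.
move=> fg; rewrite /Rintegral; congr fine; rewrite integralE [RHS]integralE.
by congr (_ - _)%E; apply/eqP; rewrite eq_le; apply/andP; split;
  apply: ae_le_integral_lower => //; apply: (ae_imply fg) => t /= E _;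
  rewrite ?funeposE ?funenegE E.
Qed.

Lemma ae_shift (P : R -> Prop) b : {ae mu, forall t, P t} -> {ae mu, forall t, P (b + t)}.
Proof.
move=> [N [mN muN hN]]; exists [set t | N (b + t)]; split.
- have -> : [set t | N (b + t)] = (fun t => b + t) @^-1` N by [].
  by rewrite -[X in measurable X]setTI; apply: measurable_funD.
- have := @lebesgue_measure_affine R 1 b N ltr01 mN; rewrite muN mul1e => <-.
  by congr (mu _); apply/seteqP; split => t /=; rewrite mul1r.
- by move=> t /= h; apply: hN.
Qed.

Lemma ae_oppr (P : R -> Prop) : {ae mu, forall t, P t} -> {ae mu, forall t, P (- t)}.
Proof.
move=> [N [mN muN hN]]; exists [set t | N (- t)]; split.
- have -> : [set t | N (- t)] = -%R @^-1` N by [].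
  by rewrite -[X in measurable X]setTI; exact: oppr_measurable.
- by rewrite -muN; exact: lebesgue_measureN.
- by move=> t /= h; apply: hN.
Qed.

End LowerIntegral.

Section ComplexModulus.
Variable R : realType.
Implicit Types z : R[i].

Lemma cabsE z : cabs z = Num.sqrt (complex.Re z ^+ 2 + complex.Im z ^+ 2).
Proof. by rewrite /cabs normc_def. Qed.

Lemma cabs_ge0 z : 0 <= cabs z. Proof. by rewrite cabsE sqrtr_ge0. Qed.

Lemma normr_Re_le z : `|complex.Re z| <= cabs z.
Proof. by rewrite cabsE -sqrtr_sqr ler_wsqrtr // lerDl sqr_ge0. Qed.

Lemma normr_Im_le z : `|complex.Im z| <= cabs z.
Proof. by rewrite cabsE -sqrtr_sqr ler_wsqrtr // lerDr sqr_ge0. Qed.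

Lemma cabs_le z : cabs z <= `|complex.Re z| + `|complex.Im z|.
Proof.
have h : 0 <= `|complex.Re z| + `|complex.Im z| by rewrite addr_ge0.
rewrite cabsE -[leRHS]ger0_norm // -sqrtr_sqr ler_wsqrtr // sqrrD !real_normK ?num_real //.
by rewrite -addrA lerD2l lerDr mulrn_wge0 // mulr_ge0.
Qed.

Lemma cabs_eq0 z : (cabs z == 0) = (z == 0).
Proof.
rewrite cabsE sqrtr_eq0 eq_complex /=.
rewrite le_eqVlt ltNge addr_ge0 ?sqr_ge0 // orbF paddr_eq0 ?sqr_ge0 // !sqrf_eq0 //.
Qed.

End ComplexModulus.

Section NormsToIntegrals.
Variable R : realType.
Local Notation mu := (@lebesgue_measure R).

(* For [p = +oo] the estimates are run in [L^2]. *)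
Definition real_exponent (p : \bar R) : R := if p is r%:E then r else 2.

Lemma real_exponent_gt1 p : (1 < p)%E -> 1 < real_exponent p.
Proof. by case: p => [r|_|] //=; rewrite ltr1n. Qed.

Lemma poweR_mean_le (I : \bar R) (d b r : R) : 0 < r -> 0 < d -> 0 <= b -> (0 <= I)%E ->
  (((d^-1)%:E * I) `^ r^-1 <= b%:E)%E -> (I <= (b `^ r * d)%:E)%E.
Proof.
move=> r0 d0 b0; have ri : r^-1 != 0 by rewrite invr_eq0 gt_eqF.
case: I => [i||] //; last first.
  by rewrite gt0_muley ?lte_fin ?invr_gt0 // poweRyr // leye_eq.
rewrite lee_fin => i0; rewrite -EFinM poweR_EFin !lee_fin => H.
rewrite -ler_pdivrMr // mulrC.
have z0 : 0 <= d^-1 * i by rewrite mulr_ge0 // invr_ge0 ltW.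
have := ge0_ler_powR (ltW r0) _ _ H; rewrite !nnegrE powR_ge0 b0 => /(_ isT isT).
by rewrite -powRrM mulVf ?gt_eqF // powRr1.
Qed.

Lemma lp_mean_integral_le (p : \bar R) (d b : R) (h : R -> R[i]) (g : R -> R) :
  (1 < p)%E -> 0 < d -> 0 <= b -> measurable_fun setT g ->
  {ae mu, forall t, `|g t| <= cabs (h t)} -> (lp_mean p d h <= b%:E)%E ->
  (\int[mu]_(t in `]0%R, d[) (`|g t| `^ real_exponent p)%:E
     <= (b `^ real_exponent p * d)%:E)%E.
Proof.
move=> p1 d0 b0 mg hg; have r1 := real_exponent_gt1 p1; move: r1.
have mono r : 0 <= r -> (\int[mu]_(t in `]0%R, d[) (`|g t| `^ r)%:E <=
    \int[mu]_(t in `]0%R, d[) (cabs (h t) `^ r)%:E)%E.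
  move=> r0; apply: ae_le_integral_lower => [t|t|].
  - by rewrite lee_fin powR_ge0.
  - by rewrite lee_fin powR_ge0.
  apply: (ae_imply hg) => t gh _; rewrite lee_fin.
  by apply: ge0_ler_powR => //; rewrite nnegrE ?cabs_ge0.
case: p p1 => [r||] //= p1 r1 H.
  have r0 : 0 < r by lra.
  apply: (le_trans (mono _ (ltW r0))); apply: poweR_mean_le => //.
  by apply: integral_ge0 => t _; rewrite lee_fin powR_ge0.
move: H => /ess_sup_inf.ess_supP H.
apply: (@le_trans _ _ (\int[mu]_(t in `]0%R, d[) (b `^ 2)%:E)%E); last first.
  rewrite integral_cst //; have := lebesgue_measure_itv `]0%R, d[ => /= ->.
  by rewrite lte_fin d0 sube0 -EFinM.
apply: ae_le_integral_lower => [t|t|]; try by rewrite lee_fin powR_ge0.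
have := ae_and hg H; move/ae_imply; apply => t [gh hb] td.
rewrite patchE mem_set // lee_fin in hb.
by rewrite lee_fin; apply: ge0_ler_powR => //; rewrite ?nnegrE //; exact: le_trans hb.
Qed.

(** The factor 2 is the price of [ge0_integral_Lp_L1_on], and [pi] undoes the normalisation of the
    norm. *)
Lemma Sp_norm_window_le (p : \bar R) (eps : R) (F : R -> R[i]) (g : R -> R) :
  (1 < p)%E -> 0 < eps -> measurable_fun setT g ->
  {ae mu, forall t, `|g t| <= cabs (F t)} -> (Sp_norm p F <= eps%:E)%E ->
  window_le g (2 * eps * pi).
Proof.
move=> p1 e0 mg hg H u; have p0 := pi_gt0 R.
have mgn : measurable_fun setT (fun t => `|g t|) by exact: measurableT_comp.
have mupi : mu `[u, (u + pi)%R] = pi%:E.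
  have := lebesgue_measure_itv `[u, (u + pi)%R] => /= ->.
  by rewrite lte_fin ltrDl p0 -EFinD addrAC subrr add0r.
case: p p1 H => [r||] //= p1 H; last first.
  apply: (@le_trans _ _ (\int[mu]_(t in `[u, (u + pi)%R]) (2 * eps)%:E)%E); last first.
    by rewrite (integral_cst_measure _ _ mupi).
  apply: ae_le_integral_lower => [t|t|]; try by rewrite lee_fin // mulr_ge0 // ltW.
  apply: (ae_imply hg) => t gh _; rewrite lee_fin; apply: (le_trans gh).
  have : ((cabs (F t))%:E <= eps%:E)%E.
    by apply: le_trans H; apply: ereal_sup_ubound; exists t.
  by rewrite lee_fin; lra.
have r0 : 0 < r by have : 1 < r by []; lra.
apply: (ge0_integral_Lp_L1_on p1 e0 _ mupi) => //.
apply: (@le_trans _ _ (\int[mu]_(t in `[u, (u + pi)%R]) (cabs (F t) `^ r)%:E)%E).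
  apply: ae_le_integral_lower => [t|t|]; try by rewrite lee_fin powR_ge0.
  apply: (ae_imply hg) => t gh _; rewrite lee_fin.
  by apply: ge0_ler_powR => //; rewrite ?nnegrE ?cabs_ge0 // ltW.
apply: poweR_mean_le => //; first exact: ltW.
  by apply: integral_ge0 => t _; rewrite lee_fin powR_ge0.
by apply: le_trans H; apply: ereal_sup_ubound; exists u.
Qed.

Lemma cvg_complex (u v : R -> R) (a b : R) :
  u L @[L --> +oo] --> a -> v L @[L --> +oo] --> b ->
  lim (((u L +i* v L)%C : (R[i])^o) @[L --> +oo]) = (a +i* b)%C.
Proof.
move=> /cvgrPdist_lt ua /cvgrPdist_lt vb; apply: cvg_lim; first exact: norm_hausdorff.
apply/cvgrPdist_lt => /= e; rewrite ltcE /= => /andP[/eqP ei er].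
have ua' := ua _ (divr_gt0 er (ltr0n _ 2)).
have vb' := vb _ (divr_gt0 er (ltr0n _ 2)).
near=> L.
have hu : `|a - u L| < complex.Re e / 2 by near: L; exact: ua'.
have hv : `|b - v L| < complex.Re e / 2 by near: L; exact: vb'.
rewrite ltcE; apply/andP; split; first by rewrite ei normc_def.
have := cabs_le ((a +i* b)%C - (u L +i* v L)%C); rewrite /cabs /= => hc.
by apply: (le_lt_trans hc); lra.
Unshelve. all: by end_near.
Qed.

Lemma fourier_coefE (f : R -> R[i]) (hr hi : R -> R) (m Cr Sr Ci Si : R) :
  {ae mu, forall t, complex.Re (f t) = hr t} -> {ae mu, forall t, complex.Im (f t) = hi t} ->
  bounded_meas hr -> bounded_meas hi ->
  has_mean (fun t => hr t * cos (m * t)) Cr -> has_mean (fun t => hr t * sin (m * t)) Sr ->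
  has_mean (fun t => hi t * cos (m * t)) Ci -> has_mean (fun t => hi t * sin (m * t)) Si ->
  fourier_coef f m = ((Cr + Si) +i* (Ci - Sr))%C.
Proof.
move=> ar ai br bi hCr hSr hCi hSi.
have bc := bounded_meas_cos m; have bs := bounded_meas_sin m.
have h1 := has_meanD (bounded_measM br bc) (bounded_measM bi bs) hCr hSi.
have h2 : has_mean (fun t => hi t * cos (m * t) + -1 * (hr t * sin (m * t))) (Ci - Sr).
  rewrite -(mulN1r Sr); apply: has_meanD => //; first exact: bounded_measM.
    by apply: bounded_measM; [exact: bounded_meas_cst|exact: bounded_measM].
  by apply: has_meanZ => //; exact: bounded_measM.
have E : (fun L : R => ((L^-1)%:C%C * cintegral `[0, L] (fun t => f t * expi (- (m * t))) : (R[i])^o)) =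
  (fun L => (L^-1 * (\int[mu]_(t in `[0, L]) (hr t * cos (m * t) + hi t * sin (m * t))) +i*
   (L^-1 * (\int[mu]_(t in `[0, L]) (hi t * cos (m * t) + -1 * (hr t * sin (m * t))))))%C).
  apply/funext => L.
  have -> : cintegral `[0, L] (fun t => f t * expi (- (m * t))) =
    ((\int[mu]_(t in `[0, L]) (hr t * cos (m * t) + hi t * sin (m * t))) +i*
     (\int[mu]_(t in `[0, L]) (hi t * cos (m * t) + -1 * (hr t * sin (m * t)))))%C.
    rewrite /cintegral; congr (_ +i* _)%C; apply: ae_eq_Rintegral_lower;
      move: (ae_and ar ai) => /ae_imply; apply => t [<- <-];
      case: (f t) => x y; rewrite /expi cosN sinN /=; ring.
  by apply/eqP; rewrite eq_complex /= !mul0r subr0 addr0 !eqxx.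
by rewrite /fourier_coef E; exact: cvg_complex.
Qed.

End NormsToIntegrals.

Section RealParts.
Variable R : realType.
Local Notation mu := (@lebesgue_measure R).

Lemma Re_sum (I : Type) (r : seq I) (F : I -> R[i]) :
  complex.Re (\sum_(i <- r) F i) = \sum_(i <- r) complex.Re (F i).
Proof. by apply: (big_morph (@complex.Re R)) => // -[? ?] [? ?]. Qed.

Lemma Im_sum (I : Type) (r : seq I) (F : I -> R[i]) :
  complex.Im (\sum_(i <- r) F i) = \sum_(i <- r) complex.Im (F i).
Proof. by apply: (big_morph (@complex.Im R)) => // -[? ?] [? ?]. Qed.

Lemma trig_poly_parts N (c : 'I_N -> R[i]) (lam : 'I_N -> R) :
  exists s s', forall t, complex.Re (trig_poly c lam t) = rpoly s t /\
    complex.Im (trig_poly c lam t) = rpoly s' t.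
Proof.
exists [seq ((complex.Re (c j), - complex.Im (c j)), lam j) | j <- index_enum 'I_N].
exists [seq ((complex.Im (c j), complex.Re (c j)), lam j) | j <- index_enum 'I_N] => t.
rewrite /trig_poly Re_sum Im_sum /rpoly !big_map /=.
by split; apply: eq_bigr => j _; case: (c j) => a b /=; rewrite ?mulNr // addrC.
Qed.

(** A Borel representative may be unbounded on a null set; clipping it at the bound of [u] changes
    it only there. *)
Lemma truncated_part (u : R -> R) (g : R -> R) M : measurable_fun setT g ->
  {ae mu, forall t, u t = g t} -> (forall t, `|u t| <= M) ->
  exists h, bounded_meas h /\ {ae mu, forall t, u t = h t}.
Proof.
move=> mg ug uM; have M0 : 0 <= M by exact: le_trans (uM 0).
exists (fun t => Num.max (- M) (Num.min M (g t))); split.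
  apply: (@bounded_measW _ _ M).
    by apply: measurable_maxr => //; exact: measurable_minr.
  move=> t; rewrite ler_norml le_max lexx ge_max ge_min lexx /= andbT.
  by rewrite (le_trans _ M0) // oppr_le0.
apply: (ae_imply ug) => t <-; have := uM t; rewrite ler_norml => /andP[h1 h2].
by rewrite (min_r h2) (max_r h1).
Qed.

Lemma Omega_parts (alpha : R) (p : \bar R) (f : R -> R[i]) : (1 < p)%E -> Omega alpha p f ->
  exists hr hi : R -> R, [/\ bounded_meas hr, bounded_meas hi,
    {ae mu, forall t, complex.Re (f t) = hr t /\ complex.Im (f t) = hi t},
    stepanov_approx hr & stepanov_approx hi].
Proof.
move=> p1 [[[g [mgr mgi fg]] hS] [M hM] _].
have aer : {ae mu, forall t, complex.Re (f t) = complex.Re (g t)} by apply: (ae_imply fg) => t ->.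
have aei : {ae mu, forall t, complex.Im (f t) = complex.Im (g t)} by apply: (ae_imply fg) => t ->.
have [hr [br ar]] := truncated_part mgr aer (fun t => le_trans (normr_Re_le (f t)) (hM t)).
have [hi [bi ai]] := truncated_part mgi aei (fun t => le_trans (normr_Im_le (f t)) (hM t)).
have ari := ae_and ar ai.
have p0 := pi_gt0 R.
have pn : (pi : R) != 0 by rewrite gt_eqF.
have epsE (e : R) : e = 2 * (e / (2 * pi)) * pi.
  by rewrite mulrAC mulrC divfK // mulf_neq0.
exists hr, hi; split => // eps e0.
  have [N [c [lam H]]] := hS (eps / (2 * pi)) (divr_gt0 e0 (mulr_gt0 (ltr0n _ 2) p0)).
  have [s [s' hs]] := trig_poly_parts c lam; exists s.
  rewrite (epsE eps).
  apply: (Sp_norm_window_le p1 _ _ _ H); first by rewrite divr_gt0 // mulr_gt0.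
    by have [] := bounded_measB br (bounded_meas_rpoly s).
  apply: (ae_imply ar) => t <-; have [<- _] := hs t.
  apply: le_trans (normr_Re_le _).
  by case: (f t) => ? ?; case: (trig_poly _ _ _) => ? ?.
have [N [c [lam H]]] := hS (eps / (2 * pi)) (divr_gt0 e0 (mulr_gt0 (ltr0n _ 2) p0)).
have [s [s' hs]] := trig_poly_parts c lam; exists s'.
rewrite (epsE eps).
apply: (Sp_norm_window_le p1 _ _ _ H); first by rewrite divr_gt0 // mulr_gt0.
  by have [] := bounded_measB bi (bounded_meas_rpoly s').
apply: (ae_imply ai) => t <-; have [_ <-] := hs t.
apply: le_trans (normr_Im_le _).
by case: (f t) => ? ?; case: (trig_poly _ _ _) => ? ?.
Qed.

End RealParts.

(** * Partial sums of the Fourier series *)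

Section Exponents.
Variables (R : realType) (f : R -> R[i]) (lam : int -> R).
Hypothesis hlam : fourier_exponents f lam.

Lemma lam0 : lam 0 = 0. Proof. by have [[]] := hlam. Qed.

Lemma lamN (nu : int) : lam (- nu) = - lam nu. Proof. by have [[_ h] _ _ _ _] := hlam; exact: h. Qed.

Lemma lam_homo (i j : nat) : (i < j)%N -> lam i < lam j.
Proof.
have [_ h _ _ _] := hlam.
apply: (@homo_ltn _ (fun i => lam (Posz i)) (fun x y => x < y)); first by move=> ? ? ?; exact: lt_trans.
by move=> [|n]; [rewrite lam0; have [] := h 1%N isT|have [] := h n.+1 isT].
Qed.

Lemma lam_gt0 (i : nat) : (0 < i)%N -> 0 < lam i.
Proof. by move=> i0; rewrite -lam0; exact: lam_homo. Qed.

Lemma lam_inj : injective lam.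
Proof.
have nat_inj (i j : nat) : lam i = lam j -> i = j.
  by move=> e; have [/lam_homo|/lam_homo|//] := ltngtP i j; rewrite e ltxx.
have posneg (i j : nat) : lam i = lam (Negz j) -> False.
  rewrite NegzE lamN => e; have := lam_gt0 (ltn0Sn j).
  have : 0 <= lam i by case: i e => [|i] _; rewrite ?lam0 // ltW // lam_gt0.
  by rewrite e oppr_ge0 leNgt => /negP.
move=> [i|i] [j|j].
- by move=> /nat_inj ->.
- by move=> /posneg.
- by move=> e; have := posneg _ _ (esym e).
- by rewrite !NegzE !lamN => /oppr_inj /nat_inj [->].
Qed.

Lemma normr_lam nu : `|lam nu| = lam `|nu|%N.
Proof.
have h (i : nat) : `|lam i| = lam i.
  by case: i => [|i]; rewrite ?lam0 ?normr0 // gtr0_norm // lam_gt0.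
by case: nu => i //; rewrite NegzE lamN normrN abszN h.
Qed.

Lemma exponents_finite gam : exists r : seq int,
  [/\ uniq r, forall nu, (nu \in r) = (`|lam nu| <= gam) & forall nu, nu \in r -> - nu \in r].
Proof.
have [_ _ h _ _] := hlam.
move/cvgryPgtr : h => /(_ gam (num_real _)) [N _ hN].
exists [seq nu <- [seq (i%:Z - N%:Z)%R | i <- iota 0 N.*2] | `|lam nu| <= gam].
have E (nu : int) : (nu \in [seq nu <- [seq (i%:Z - N%:Z)%R | i <- iota 0 N.*2] | `|lam nu| <= gam]) = (`|lam nu| <= gam).
  rewrite mem_filter andb_idr // normr_lam => lg.
  have nN : (`|nu| < N)%N by rewrite ltnNge; apply/negP => /hN /=; rewrite ltNge lg.
  apply/mapP; exists (absz (nu + Posz N)%R); first by rewrite mem_iota /=; lia.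
  lia.
split => //.
  by rewrite filter_uniq // map_inj_uniq ?iota_uniq // => i j /addIr [].
by move=> nu; rewrite !E lamN normrN.
Qed.

End Exponents.

Section PartialSums.
Variables (R : realType) (f : R -> R[i]) (lam : int -> R) (hr hi : R -> R).
Local Notation mu := (@lebesgue_measure R).
Hypothesis hlam : fourier_exponents f lam.
Hypotheses (br : bounded_meas hr) (bi : bounded_meas hi)
  (aeri : {ae mu, forall t, complex.Re (f t) = hr t /\ complex.Im (f t) = hi t})
  (ar : stepanov_approx hr) (ai : stepanov_approx hi).

(** The order [gam] and the level [l] only have to select the same exponents, which permits
    [l < gam] when the gap lies below the order. *)
Lemma fourier_sum_parts l e gam x : 0 <= l -> l < e ->
  (forall nu, (`|lam nu| <= gam) = (`|lam nu| <= l)) ->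
  (forall nu, `|lam nu| < e -> `|lam nu| <= l) ->
  complex.Re (fourier_sum f lam gam x) = trap_op l e hr x /\
  complex.Im (fourier_sum f lam gam x) = trap_op l e hi x.
Proof.
move=> l0 le lg gap.
have [Cr [Sr hmr]] := stepanov_approx_means br ar.
have [Ci [Si hmi]] := stepanov_approx_means bi ai.
have aer : {ae mu, forall t, complex.Re (f t) = hr t} by apply: (ae_imply aeri) => t [].
have aei : {ae mu, forall t, complex.Im (f t) = hi t} by apply: (ae_imply aeri) => t [].
have coefE m : fourier_coef f m = ((Cr m + Si m) +i* (Ci m - Sr m))%C.
  exact: (fourier_coefE aer aei br bi (hmr m).1 (hmr m).2 (hmi m).1 (hmi m).2).
have oddS (g S : R -> R) : bounded_meas g -> (forall m, has_mean (fun t => g t * sin (m * t)) (S m)) ->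
    forall m, S (- m) = - S m.
  move=> bg hS m; apply: (has_mean_unique (hS (- m))).
  have := @has_meanZ R (-1) _ _ (bounded_measM bg (bounded_meas_sin m)) (hS m).
  by rewrite mulN1r; apply: eq_has_mean => t; rewrite (mulNr m t) sinN mulN1r mulrN.
have evenC (g C : R -> R) : (forall m, has_mean (fun t => g t * cos (m * t)) (C m)) ->
    forall m, C (- m) = C m.
  move=> hC m; apply: (has_mean_unique (hC (- m))).
  by apply: eq_has_mean (hC m) => t; rewrite mulNr cosN.
have SrN := oddS _ _ br (fun m => (hmr m).2); have SiN := oddS _ _ bi (fun m => (hmi m).2).
have CrN := evenC _ _ (fun m => (hmr m).1); have CiN := evenC _ _ (fun m => (hmi m).1).
have [r [ur mr rN]] := exponents_finite hlam l.
pose Sp := map lam r.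
have uSp : uniq Sp by rewrite map_inj_uniq //; exact: (lam_inj hlam).
have SpN m : m \in Sp -> - m \in Sp.
  by move=> /mapP[nu nr ->]; apply/mapP; exists (- nu); rewrite ?rN // (lamN hlam).
have Spl m : m \in Sp -> `|m| <= l by move=> /mapP[nu nr ->]; rewrite -mr.
have zero m : m \notin Sp -> `|m| < e -> fourier_coef f m = 0.
  move=> mS me; apply/eqP; apply: contraT => /= A0.
  have [_ _ _ _ h] := hlam; have [nu mnu] := h m A0.
  by move: mS; rewrite mnu; case/negP; apply: map_f; rewrite mr gap // -mnu.
(* By the parity of the real coefficients, the two complex equations at [m] and [- m] amount to the
   vanishing of all four. *)
have gapCS m : m \notin Sp -> `|m| < e -> [/\ Cr m = 0, Sr m = 0, Ci m = 0 & Si m = 0].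
  move=> mS me; have z1 := zero m mS me.
  have mS' : - m \notin Sp by apply: contra mS => /SpN; rewrite opprK.
  have := zero (- m) mS'; rewrite normrN => /(_ me) z2.
  move: z1 z2; rewrite !coefE CrN SiN CiN SrN => -[e1 e2] [e3 e4].
  by split; lra.
have Tr := trap_op_spectral x l0 le br ar (fun m => (hmr m).1) (fun m => (hmr m).2) uSp SpN Spl
  (fun m h1 h2 => let: And4 a b _ _ := gapCS m h1 h2 in conj a b).
have Ti := trap_op_spectral x l0 le bi ai (fun m => (hmi m).1) (fun m => (hmi m).2) uSp SpN Spl
  (fun m h1 h2 => let: And4 _ _ a b := gapCS m h1 h2 in conj a b).
(* The real part of a complex term mixes coefficients of [hr] and [hi]; the foreign terms are odd in
   [m] and cancel over the symmetric spectrum. *)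
have odd0 (g : R -> R) : (forall m, g (- m) = - g m) -> \sum_(m <- Sp) g m = 0.
  move=> gN; have pS : perm_eq Sp (map -%R Sp).
    apply: uniq_perm => //; first by rewrite map_inj_uniq //; exact: oppr_inj.
    move=> m; apply/idP/mapP => [mS|[m' mS ->]]; last exact: SpN.
    by exists (- m); rewrite ?opprK ?SpN.
  have : \sum_(m <- Sp) g m = - \sum_(m <- Sp) g m.
    rewrite {1}(perm_big _ pS) big_map -sumrN; by apply: eq_bigr => m _; exact: gN.
  lra.
have -> : fourier_sum f lam gam x = \sum_(m <- Sp) (fourier_coef f m * expi (m * x)).
  rewrite big_map /fourier_sum (fsbig_seq _ _ ur); apply: eq_fsbigl.
  by apply/seteqP; split => nu /=; rewrite lg -mr.
rewrite Re_sum Im_sum Tr Ti; split.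
  transitivity (\sum_(m <- Sp) ((Cr m * cos (m * x) + Sr m * sin (m * x)) +
      (Si m * cos (m * x) - Ci m * sin (m * x)))).
    by apply: eq_bigr => m _; rewrite coefE /=; ring.
  by rewrite big_split /= [X in _ + X]odd0 ?addr0 // => m; rewrite SiN CiN !mulNr sinN cosN; ring.
transitivity (\sum_(m <- Sp) ((Ci m * cos (m * x) + Si m * sin (m * x)) +
    (Cr m * sin (m * x) - Sr m * cos (m * x)))).
  by apply: eq_bigr => m _; rewrite coefE /=; ring.
by rewrite big_split /= [X in _ + X]odd0 ?addr0 // => m; rewrite CrN SrN !mulNr sinN cosN; ring.
Qed.

End PartialSums.

(** * The local modulus *)

Section Modulus.
Variables (R : realType) (w : R -> R).
Hypothesis hw : modulus_type w.

Lemma modulus_homo s t : 0 <= s -> s <= t -> w s <= w t.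
Proof.
have [h _ _ _] := hw; move=> s0 st; apply: h => //; rewrite in_itv /= andbT //.
exact: le_trans st.
Qed.

Lemma modulus_ge0 s : 0 <= s -> 0 <= w s.
Proof. by move=> s0; have [_ _ <- _] := hw; exact: modulus_homo. Qed.

Lemma modulus_natmul n d : 0 <= d -> w (n%:R * d) <= n%:R * w d.
Proof.
have [_ _ h0 h] := hw; move=> d0; elim: n => [|n IH]; first by rewrite !mul0r h0.
rewrite -natr1 !mulrDl !mul1r; apply: le_trans (h _ _ _ _) _ => //; first by rewrite mulr_ge0.
by rewrite lerD2r.
Qed.

Lemma modulus_scale g d : 0 < g -> g <= d -> w d <= 2 * d / g * w g.
Proof.
move=> g0 gd; have z0 : 0 <= d / g by rewrite divr_ge0 // ?ltW // (lt_le_trans g0).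
have /andP[t1 t2] := truncn_itv z0.
have d1 : 1 <= d / g by rewrite ler_pdivlMr // mul1r.
apply: (@le_trans _ _ (w ((Num.truncn (d / g)).+1%:R * g))).
  apply: modulus_homo; first by rewrite (le_trans _ gd) // ltW.
  by rewrite -ler_pdivrMr // ltW.
apply: (le_trans (modulus_natmul _ (ltW g0))).
apply: ler_wpM2r; first exact: (modulus_ge0 (ltW g0)).
rewrite -natr1 -mulrA; lra.
Qed.

(** By [modulus_scale], [w] is either zero on the half-line or positive at every positive point;
    only in the second case can one divide by it. *)
Lemma modulus_gt0 s t : 0 < s -> 0 < w s -> 0 < t -> 0 < w t.
Proof.
move=> s0 ws t0; have [st|ts] := leP s t.
  by apply: (lt_le_trans ws); apply: modulus_homo => //; exact: ltW.
have := modulus_scale t0 (ltW ts); rewrite lt_neqAle modulus_ge0 ?(ltW t0) // andbT => h.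
by apply/eqP => w0; move: h; rewrite -w0 mulr0 leNgt ws.
Qed.

End Modulus.

Section SymmetricDifference.
Variable R : realType.
Local Notation mu := (@lebesgue_measure R).

(** [v] is meant to be the real or imaginary part of [f x], which [h x] need not equal, since [h]
    matches [f] almost everywhere only. *)
Definition sym_diff (h : R -> R) (v x t : R) := h (x + t) + h (x - t) - 2 * v.

Definition dev_coef (h : R -> R) (v x beta : R) (k : nat) : R :=
  \int[mu]_(t in `[0, +oo[) (sym_diff h v x t * trap_kernel (beta * k%:R) (beta * k.+1%:R) t).

Lemma bounded_meas_sym_diff h v x : bounded_meas h -> bounded_meas (sym_diff h v x).
Proof.
move=> bh; apply: bounded_measB; last exact: bounded_meas_cst.
exact: bounded_meas_sym.
Qed.

(** The multiplier is 1 at frequency 0, so the kernel reproduces the constant [v]. *)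
Lemma trap_op_sub h v x l e : 0 <= l -> l < e -> bounded_meas h ->
  trap_op l e h x - v = \int[mu]_(t in `[0, +oo[) (sym_diff h v x t * trap_kernel l e t).
Proof.
move=> l0 le bh.
have ik := integrable_trap_kernel l e.
have i1 := integrable_bounded_measM (measurable_itv _) ik (bounded_meas_sym x bh).
have i2 := integrable_bounded_measM (measurable_itv _) ik (bounded_meas_cst (2 * v)).
rewrite /trap_op -[v in LHS]mulr1 -(trapezoid_in le (_ : `|0| <= l)) ?normr0 //.
rewrite -(Rintegral_cos_trap_kernel 0 le) -RintZ //; last first.
  have i3 := integrable_bounded_measM (measurable_itv _) ik (bounded_meas_cst 2).
  by apply: eq_integrable i3 => // t _ /=; rewrite mul0r cos0 mulr1.
have E : \int[mu]_(t in `[0, +oo[) (v * (2 * cos (0 * t) * trap_kernel l e t)) =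
  \int[mu]_(t in `[0, +oo[) (2 * v * trap_kernel l e t).
  by apply: eq_Rintegral => t _; rewrite mul0r cos0; ring.
rewrite E -RintB //; apply: eq_Rintegral => t _; rewrite /sym_diff; ring.
Qed.

End SymmetricDifference.

Section DeviationOfPartialSums.
Variables (R : realType) (f : R -> R[i]) (lam : int -> R) (hr hi : R -> R) (alpha x : R).
Local Notation mu := (@lebesgue_measure R).
Hypotheses (a0 : 0 < alpha) (hlam : fourier_exponents f lam).
Hypotheses (br : bounded_meas hr) (bi : bounded_meas hi)
  (aeri : {ae mu, forall t, complex.Re (f t) = hr t /\ complex.Im (f t) = hi t})
  (ar : stepanov_approx hr) (ai : stepanov_approx hi).

(* The gap condition of the class is stated for an enumeration [lam'] of its own. *)
Lemma exponent_gap lam' : fourier_exponents f lam' ->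
  (forall nu : nat, (0 < nu)%N -> alpha <= lam' nu.+1 - lam' nu) ->
  forall i j : nat, (0 < i)%N -> lam i < lam j -> lam i + alpha <= lam j.
Proof.
move=> hlam' gap i j i0 ij.
(* At each positive exponent the coefficient of [lam n] or of its opposite is nonzero, so [lam']
   must list it up to sign. *)
have ex (n : nat) : (0 < n)%N -> exists2 a : nat, (0 < a)%N & lam n = lam' a.
  move=> n0; have ln := lam_gt0 hlam n0.
  have [_ _ _ /(_ n n0) An _] := hlam; have [_ _ _ _ full] := hlam'.
  have [nu nuE] : exists nu : int, lam n = `|lam' nu|.
    have [A0|A0] := eqVneq (fourier_coef f (lam n)) 0; last first.
      by have [nu e] := full _ A0; exists nu; rewrite -e gtr0_norm.
    have A1 : fourier_coef f (lam (- n%:Z)) != 0.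
      apply: contraTneq An => A1; rewrite A0 A1; have /eqP -> : cabs (0 : R[i]) == 0 by rewrite cabs_eq0.
      by rewrite addr0 ltxx.
    by have [nu e] := full _ A1; exists nu; rewrite -e (lamN hlam) normrN gtr0_norm.
  move: nuE; rewrite (normr_lam hlam') => e; exists `|nu|%N => //.
  by rewrite lt0n; apply/negP => /eqP z; move: ln; rewrite e z (lam0 hlam') ltxx.
have j0 : (0 < j)%N.
  case: j ij => // ; rewrite (lam0 hlam) => /lt_trans /(_ (lam_gt0 hlam i0)); by rewrite ltxx.
have [a a_gt0 ea] := ex i i0; have [b b_gt0 eb] := ex j j0.
have ab : (a < b)%N.
  rewrite ltnNge leq_eqVlt; apply/negP => /orP[/eqP e|/(lam_homo hlam')].
    by move: ij; rewrite ea eb e ltxx.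
  by rewrite -ea -eb; rewrite ltNge ltW.
have := gap a a_gt0; rewrite ea eb.
have : lam' a.+1 <= lam' b.
  by move: ab; rewrite leq_eqVlt => /orP[/eqP<- //|/(lam_homo hlam')/ltW].
lra.
Qed.

Hypothesis gap : forall i j : nat, (0 < i)%N -> lam i < lam j -> lam i + alpha <= lam j.

(* If some exponent lies in ]beta k, beta (k + 1)[, the gap condition keeps the
   interval ]beta (k - 1), beta k] free of exponents. *)
Lemma fourier_dev_parts (k : nat) : (0 < k)%N -> exists2 j : nat, j = k \/ j = k.-1 &
  complex.Re (fourier_sum f lam (alpha * k%:R / 2) x - f x)
    = dev_coef hr (complex.Re (f x)) x (alpha / 2) j /\
  complex.Im (fourier_sum f lam (alpha * k%:R / 2) x - f x)
    = dev_coef hi (complex.Im (f x)) x (alpha / 2) j.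
Proof.
move=> k0; pose beta := alpha / 2.
have b0 : 0 < beta by rewrite divr_gt0.
have -> : alpha * k%:R / 2 = beta * k%:R by rewrite /beta mulrAC.
have dev j : (forall nu, (`|lam nu| <= beta * k%:R) = (`|lam nu| <= beta * j%:R)) ->
  (forall nu, `|lam nu| < beta * j.+1%:R -> `|lam nu| <= beta * j%:R) ->
  complex.Re (fourier_sum f lam (beta * k%:R) x - f x) = dev_coef hr (complex.Re (f x)) x beta j /\
  complex.Im (fourier_sum f lam (beta * k%:R) x - f x) = dev_coef hi (complex.Im (f x)) x beta j.
  move=> h1 h2; have l0 : 0 <= beta * j%:R by rewrite mulr_ge0 // ltW.
  have le : beta * j%:R < beta * j.+1%:R by rewrite ltr_pM2l // ltr_nat.
  have [e1 e2] := fourier_sum_parts hlam br bi aeri ar ai x l0 le h1 h2.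
  rewrite /dev_coef -!trap_op_sub // -e1 -e2.
  by case: (fourier_sum _ _ _ _) => ? ?; case: (f x).
have [[i [i0 i1 i2]]|none] := pselect (exists i : nat, [/\ (0 < i)%N, beta * k%:R < lam i & lam i < beta * k.+1%:R]).
  exists k.-1; first by right.
  have kE : k.-1.+1 = k by rewrite prednK.
  have kR : k%:R = k.-1%:R + 1 :> R by rewrite natr1 kE.
  have free nu : `|lam nu| <= beta * k%:R -> `|lam nu| <= beta * k.-1%:R.
    rewrite (normr_lam hlam) => h; rewrite leNgt; apply/negP => h'.
    have n0 : (0 < `|nu|)%N.
      rewrite lt0n; apply/negP => /eqP z; move: h'; rewrite z (lam0 hlam) ltNge mulr_ge0 //; exact: ltW.
    have := gap n0 (le_lt_trans h i1); move: i2 h'; rewrite -natr1 kR /beta; lra.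
  apply: dev => nu.
    apply/idP/idP => [/free //|/le_trans]; apply; rewrite ler_pM2l // ler_nat leq_pred //.
  by rewrite kE => /ltW /free.
exists k; first by left.
apply: dev => // nu; rewrite (normr_lam hlam) => h; rewrite leNgt; apply/negP => h'.
apply: none; exists `|nu|%N; split => //.
rewrite lt0n; apply/negP => /eqP z; move: h'; rewrite z (lam0 hlam) ltNge mulr_ge0 //; exact: ltW.
Qed.

(** The gap condition does not bound the distance from 0 to the first exponent, so at order 0 the
    slope of the trapezoid ends at that exponent instead of [alpha / 2]. *)
Lemma fourier_dev_parts0 : exists2 e, 0 < e &
  complex.Re (fourier_sum f lam 0 x - f x)
    = \int[mu]_(t in `[0, +oo[) (sym_diff hr (complex.Re (f x)) x t * trap_kernel 0 e t) /\
  complex.Im (fourier_sum f lam 0 x - f x)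
    = \int[mu]_(t in `[0, +oo[) (sym_diff hi (complex.Im (f x)) x t * trap_kernel 0 e t).
Proof.
have e0 := lam_gt0 hlam (ltn0Sn 0).
exists (lam 1%N) => //.
have h2 nu : `|lam nu| < lam 1%N -> `|lam nu| <= 0.
  rewrite (normr_lam hlam) => h; rewrite leNgt; apply/negP => h'.
  have : (0 < `|nu|)%N by rewrite lt0n; apply/negP => /eqP z; move: h'; rewrite z (lam0 hlam) ltxx.
  rewrite leq_eqVlt => /orP[/eqP z|/(lam_homo hlam)]; first by move: h; rewrite -z ltxx.
  by rewrite ltNge ltW.
have [e1 e2] := fourier_sum_parts hlam br bi aeri ar ai x (lexx 0) e0 (fun=> erefl) h2.
rewrite -!trap_op_sub // -e1 -e2.
by case: (fourier_sum _ _ _ _) => ? ?; case: (f x).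
Qed.

End DeviationOfPartialSums.

(** * Real and imaginary parts of phi_x, treated alike through an abstract [part] *)

Section PartOfLocalModulus.
Variables (R : realType) (f : R -> R[i]) (x : R) (p : \bar R) (w : R -> R) (C : R).
Variables (part : R[i] -> R) (h : R -> R).
Local Notation mu := (@lebesgue_measure R).
Hypotheses (p1 : (1 < p)%E) (hw : modulus_type w) (C0 : 0 < C).
Hypothesis bound : forall gamma delta : R, 0 < gamma -> 0 < delta ->
  [/\ (lp_mean p delta (fun t => (phi f x t - phi f x (t + gamma))%R) <= (C * w gamma)%:E)%E,
      (lp_mean p delta (fun t => (phi f x t - phi f x (t - gamma))%R) <= (C * w gamma)%:E)%E &
      (local_modulus f x p delta <= (C * w delta)%:E)%E].
Hypothesis part_phi : forall a b c, part (a + b - 2 * c) = part a + part b - 2 * part c.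
Hypothesis partB : forall a b, part (a - b) = part a - part b.
Hypothesis part_le : forall z, `|part z| <= cabs z.
Hypothesis bh : bounded_meas h.
Hypothesis aeh : {ae mu, forall t, part (f t) = h t}.

Let s := sym_diff h (part (f x)) x.
Let r := real_exponent p.

Let bs : bounded_meas s. Proof. exact: bounded_meas_sym_diff. Qed.
Let ms : measurable_fun setT s. Proof. by have [] := bs. Qed.
Let w0 t : 0 <= t -> 0 <= w t. Proof. exact: modulus_ge0. Qed.
Let r1 : 1 < r. Proof. exact: real_exponent_gt1. Qed.

Let ae_phi : {ae mu, forall t, part (phi f x t) = s t}.
Proof.
have h1 := ae_shift x aeh; have h2 := ae_oppr h1.
by apply: (ae_imply (ae_and h1 h2)) => t [e1 e2]; rewrite /phi part_phi e1 e2.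
Qed.

Lemma part_shift_integral_le g d : 0 < `|g| -> 0 < d ->
  (\int[mu]_(t in `]0%R, d[) (`|s t - s (t + g)| `^ r)%:E <= ((C * w `|g|) `^ r * d)%:E)%E.
Proof.
move=> g0 d0; have [b1 b2 _] := bound g0 d0.
have Cw : 0 <= C * w `|g| by rewrite mulr_ge0 ?w0 // ltW.
have mg : measurable_fun setT (fun t => s t - s (t + g)).
  apply: measurable_funB => //; apply: (measurableT_comp ms); exact: measurable_funD.
apply: (@lp_mean_integral_le R p d _ (fun t => phi f x t - phi f x (t + g))) => //.
  have h2 := ae_shift g ae_phi.
  apply: (ae_imply (ae_and ae_phi h2)) => t [<-]; rewrite addrC => <-.
  by rewrite -partB.
have [g1|g1] := leP 0 g; first by move: b1; rewrite ger0_norm.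
by move: b2; rewrite ltr0_norm // opprK.
Qed.

Lemma part_integral_le d : 0 < d ->
  (\int[mu]_(t in `]0%R, d[) (`|s t| `^ r)%:E <= ((C * w d) `^ r * d)%:E)%E.
Proof.
move=> d0; have [_ _ b3] := bound d0 d0.
apply: (@lp_mean_integral_le R p d _ (phi f x)) => //.
  by rewrite mulr_ge0 ?w0 // ltW.
by apply: (ae_imply ae_phi) => t <-.
Qed.

(** [sum_block_powR] with [gam = 1 / (beta * m)] and [B0 = C * w gam]; [w 1 > 0] makes [B0]
    positive. The range starts at [m.-1] because the kernel of a partial sum may carry the preceding
    index. *)
Lemma sum_dev_coef_le (beta q : R) : 0 < beta -> 0 < q -> 0 < w 1 ->
  exists2 K, 0 < K & forall m : nat, (0 < m)%N ->
   \sum_(m.-1 <= k < m.*2) `|dev_coef h (part (f x)) x beta k| `^ q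
     <= K * (m%:R * w (beta * m%:R)^-1 `^ q).
Proof.
move=> b0 q0 w1.
have wp t : 0 < t -> 0 < w t by move=> t0; apply: (modulus_gt0 hw ltr01 w1 t0).
have [_ [M hM]] := bs.
have M0 : 0 <= M by exact: le_trans (hM 0).
have bi0 : 0 < beta^-1 by rewrite invr_gt0.
have wb : 0 < beta * C * w beta^-1 by rewrite !mulr_gt0 // wp.
(* From w(1/beta) <= m w(g): the factor [g = 1 / (beta * m)] in front of the bound [M] is then at
   most a constant times [w g]. *)
pose M1 := M / (beta * C * w beta^-1).
have M10 : 0 <= M1 by rewrite divr_ge0 // ltW.
have [K K0 HK] := sum_block_powR b0 r1 q0 M10.
exists (K * (C `^ q * beta)); first by rewrite !mulr_gt0 // powR_gt0.
move=> m m0; set g := (beta * m%:R)^-1.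
have mR : 0 < m%:R :> R by rewrite ltr0n.
have g0 : 0 < g by rewrite invr_gt0 mulr_gt0.
have gm : g * m%:R = beta^-1 by rewrite /g; field; rewrite !gt_eqF.
have Cw : 0 < C * w g by rewrite mulr_gt0 // wp.
have m1 : 1 <= m%:R :> R by rewrite ler1n.
have gb : g <= beta^-1 by rewrite -gm ler_peMr // ltW.
have -> : K * (C `^ q * beta) * (m%:R * w g `^ q) = K * ((C * w g) `^ q / g).
  rewrite (powRM q (ltW C0) (ltW (wp g g0))) /g invrK; ring.
apply: (HK g (C * w g) s (index_iota m.-1 m.*2)) => //.
- by move=> d d0; have := @part_shift_integral_le g d; rewrite gtr0_norm //; apply.
- by move=> d d0; have := @part_shift_integral_le (- g) d; rewrite normrN gtr0_norm //; apply.
- move=> d gd; have d0 : 0 < d by exact: lt_le_trans gd.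
  apply: (le_trans (part_integral_le d0)); rewrite lee_fin ler_wpM2r ?(ltW d0) //.
  have z1 : 0 <= C * w d by rewrite mulr_ge0 ?w0 // ltW.
  have z2 : C * w d <= 2 * d / g * (C * w g).
    by rewrite mulrCA ler_pM2l //; apply: (modulus_scale hw g0 gd).
  exact: (ge0_ler_powR (ltW (lt_trans ltr01 r1)) z1 (le_trans z1 z2) z2).
- move=> t; apply: (@le_trans _ _ (g * M)); first by rewrite ler_wpM2l // ltW.
  have -> : M1 * (C * w g) = M * (w g / (beta * w beta^-1)).
    by rewrite /M1; field; rewrite !gt_eqF // wp.
  rewrite mulrC ler_wpM2l // ler_pdivlMr; last by rewrite mulr_gt0 // wp.
  have := modulus_natmul hw m (ltW g0); rewrite mulrC gm => h1.
  have -> : g * (beta * w beta^-1) = m%:R^-1 * w beta^-1.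
    by rewrite /g; field; rewrite !gt_eqF.
  by rewrite ler_pdivrMl.
- exact: iota_uniq.
- rewrite size_iota; have szn : (m.*2 - m.-1 <= 2 * m)%N by move: m0; clear; lia.
  have sz : (m.*2 - m.-1)%:R <= 2 * m%:R :> R by rewrite -natrM ler_nat.
  have := ler_wpM2r (ltW g0) sz; rewrite -mulrA (mulrC m%:R) gm; lra.
- move=> k; rewrite mem_index_iota => /andP[k1 k2]; rewrite /half_freq.
  have -> : beta * (k%:R + 2^-1) * g = (k%:R + 2^-1) / m%:R.
    by rewrite /g; field; rewrite !gt_eqF.
  (* For [m - 1 <= k < 2 m] the ratio of [k + 1/2] to [m] stays between 1/2 and 2, even with
     [k = m - 1] and [m = 1]. *)
  have k1' : m%:R <= k%:R + 1 :> R by rewrite natr1 ler_nat; move: k1 m0; clear; lia.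
  have k2' : k%:R + 1 <= 2 * m%:R :> R by rewrite natr1 -natrM ler_nat; move: k2; clear; lia.
  by split; [rewrite ler_pdivlMr // | rewrite ler_pdivrMr //]; lra.
Qed.

Lemma Rintegral_sym_diff_eq0 (l e : R) : (forall t, 0 <= t -> w t = 0) ->
  \int[mu]_(t in `[0, +oo[) (s t * trap_kernel l e t) = 0.
Proof.
move=> wz.
have r0 : r != 0 by rewrite gt_eqF // (lt_trans ltr01).
have msr : measurable_fun setT (fun t => `|s t| `^ r).
  apply: (measurableT_comp (measurable_powR r)); exact: measurableT_comp.
have zero (n : nat) : {ae mu, forall t, `]0%R, n.+1%:R[%classic t -> s t = 0}.
  have n0 : 0 < n.+1%:R :> R by rewrite ltr0n.
  have := part_integral_le n0; rewrite (wz _ (ltW n0)) (mulr0 C) (powR0 r0) mul0r => H.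
  have mm : measurable_fun `]0%R, (n.+1%:R : R)[%classic (fun t => (`|s t| `^ r)%:E).
    by apply/measurable_EFinP; exact: measurable_funTS.
  have H2 : ae_eq mu `]0%R, (n.+1%:R : R)[%classic (fun t => (`|s t| `^ r)%:E) (cst 0%E).
    apply/ae_eq_integral_abs => //.
    apply/eqP; rewrite eq_le; apply/andP; split; last by apply: integral_ge0.
    by under eq_integral do rewrite gee0_abs ?lee_fin ?powR_ge0 //.
  apply: (ae_imply H2) => t ht /ht /= [] /eqP.
  by rewrite powR_eq0 normr_eq0 r0 andbT => /eqP.
have all0 : {ae mu, forall t, 0 < t -> s t = 0}.
  have := negligible_bigcup zero; apply: negligibleS => t /= ht.
  have [t0 st] : 0 < t /\ s t <> 0 by split; [apply: contrapT => ?; apply: ht|move=> ?; apply: ht].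
  have /andP[_ tn] := truncn_itv (ltW t0).
  by exists (Num.truncn t) => //= ht'; apply: st; apply: ht'; rewrite in_itv /= t0.
transitivity (\int[mu]_t (cst 0 t : R)); last by rewrite /Rintegral /= integral0.
rewrite Rintegral_mkcond; apply: ae_eq_Rintegral_lower; apply: (ae_imply all0) => t ht.
rewrite patchE; case: ifPn => //; rewrite inE /= in_itv /= andbT le_eqVlt => /orP[/eqP<-|/ht->].
  (* At the endpoint the inverse of zero is zero, so the kernel vanishes there. *)
  have -> : trap_kernel l e 0 = 0 by rewrite /trap_kernel /osc expr0n /= invr0 !mulr0 subr0 mul0r.
  by rewrite mulr0.
by rewrite mul0r.
Qed.

End PartOfLocalModulus.

(** * General monotone weights *)

Section GeneralMonotone.
Variable R : realType.
Implicit Types (b f s v : nat -> R) (c : R).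

Lemma ler_sum_nat_widen (m n N : nat) (P Q : pred nat) f : (n <= N)%N ->
  (forall i, 0 <= f i) -> (forall i, (m <= i < n)%N -> P i -> Q i) ->
  \sum_(m <= i < n | P i) f i <= \sum_(0 <= i < N | Q i) f i.
Proof.
move=> nN f0 PQ; rewrite (@big_nat_widenl _ _ _ m 0%N) // (@big_nat_widen _ _ _ _ n N) //.
rewrite big_mkcond [leRHS]big_mkcond /=; apply: ler_sum => i _.
case: ifPn => [/andP[/andP[Pi mi] iN]|_]; last by case: ifP.
by rewrite PQ // mi.
Qed.

(** Wide enough for both ranges involved: an index [i >= 1] not below the integer part of [m / c]
    satisfies m / c < i + 1 <= 2 i, and [c + 2] dominates both [c] and 2, so the block of [m] is
    included. *)
Definition near_scale c (m i : nat) : bool :=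
  [&& (0 < i)%N, m%:R < 2 * c * i%:R & i%:R <= (c + 2) * m%:R].

Lemma variation_ge b (m j k : nat) : (m <= j < m.*2)%N -> (m <= k < m.*2)%N ->
  b k <= b j + \sum_(m <= i < m.*2) `|b i - b i.+1|.
Proof.
have tele (u v : nat) : (m <= u)%N -> (u <= v)%N -> (v < m.*2)%N ->
    `|b v - b u| <= \sum_(m <= i < m.*2) `|b i - b i.+1|.
  move=> mu uv vm; rewrite -telescope_sumr //.
  apply: (le_trans (ler_norm_sum _ _ _)).
  rewrite [leRHS](@big_cat_nat _ _ _ u) //=; last by rewrite (leq_trans uv) // ltnW.
  rewrite [X in _ <= _ + X](@big_cat_nat _ _ _ v) //=; last exact: ltnW.
  have -> : \sum_(u <= i < v) `|b i.+1 - b i| = \sum_(u <= i < v) `|b i - b i.+1|.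
    by apply: eq_bigr => i _; rewrite distrC.
  have h (x y : nat) : 0 <= \sum_(x <= i < y) `|b i - b i.+1| by exact: sumr_ge0.
  by rewrite addrCA lerDl addr_ge0.
move=> /andP[mj jm] /andP[mk km]; rewrite -lerBlDl.
case: (leqP j k) => jk; first by rewrite (le_trans (ler_norm _)) // tele.
by rewrite (le_trans (ler_norm _)) // distrC tele // ltnW.
Qed.

(** Averaging [variation_ge] over [j] bounds [b k * m] by the block sum plus [m] times the
    variation. The GM condition turns the latter into a sum of [b i * m / i], where
    [m / i < 2 * c]. *)
Lemma GM_max_le c (K0 : R) b (m k N : nat) : 1 < c -> 0 <= K0 -> (forall i, 0 <= b i) ->
  GM_2beta c K0 b -> (0 < m)%N -> (m <= k < m.*2)%N -> (m.*2 <= N)%N ->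
  (Num.truncn (c * m%:R) < N)%N ->
  b k * m%:R <= (1 + 2 * c * K0) * \sum_(0 <= i < N | near_scale c m i) b i.
Proof.
move=> c1 K00 b0 GM m0 km mN tN.
have mR : 0 < m%:R :> R by rewrite ltr0n.
set V := \sum_(m <= i < m.*2) `|b i - b i.+1|.
have h1 : b k * m%:R <= \sum_(m <= j < m.*2) b j + V * m%:R.
  have -> : b k * m%:R = \sum_(m <= j < m.*2) b k.
    by rewrite sumr_const_nat -addnn addnK mulr_natr.
  have -> : V * m%:R = \sum_(m <= j < m.*2) V by rewrite sumr_const_nat -addnn addnK mulr_natr.
  rewrite -big_split /= big_nat [leRHS]big_nat; apply: ler_sum => j mj.
  exact: variation_ge.
have h2 : \sum_(m <= j < m.*2) b j <= \sum_(0 <= i < N | near_scale c m i) b i.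
  apply: ler_sum_nat_widen => // i /andP[mi im] _; apply/and3P; split.
  - exact: leq_trans mi.
  - have : m%:R <= i%:R :> R by rewrite ler_nat.
    nra.
  - have : i%:R <= 2 * m%:R :> R by rewrite -natrM ler_nat mul2n ltnW.
    nra.
have h3 : V * m%:R <= 2 * c * K0 * \sum_(0 <= i < N | near_scale c m i) b i.
  have := ler_wpM2r (ltW mR) (GM m m0); rewrite -/V => h; apply: (le_trans h).
  rewrite -[leLHS]mulrA.
  have -> : 2 * c * K0 * \sum_(0 <= i < N | near_scale c m i) b i =
     K0 * (2 * c * \sum_(0 <= i < N | near_scale c m i) b i) by ring.
  apply: ler_wpM2l => //.
  have z0 : 0 <= m%:R / c by rewrite divr_ge0 // ltW // (lt_trans ltr01).
  have c0 : 0 < c by exact: lt_trans c1.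
  have /andP[_ t2] := truncn_itv z0.
  have big i : (Num.truncn (m%:R / c) <= i)%N -> (0 < i)%N -> m%:R < 2 * c * i%:R.
    move=> ti i0; have i1 : 1 <= i%:R :> R by rewrite ler1n.
    have ti' : (Num.truncn (m%:R / c)).+1%:R <= i%:R + 1 :> R by rewrite natr1 ler_nat ltnS.
    have : m%:R / c < 2 * i%:R by apply: (lt_le_trans t2); apply: (le_trans ti'); lra.
    rewrite ltr_pdivrMr //; lra.
  apply: (@le_trans _ _ (2 * c *
      \sum_(Num.truncn (m%:R / c) <= k0 < (Num.truncn (c * m%:R)).+1 | (0 < k0)%N) b k0)).
    rewrite mulr_suml mulr_sumr big_nat_cond [leRHS]big_nat_cond; apply: ler_sum => i /andP[/andP[ti _] i0].
    have iR : 0 < i%:R :> R by rewrite ltr0n.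
    rewrite -[leLHS]mulrA [leRHS]mulrC ler_wpM2l // ler_pdivrMl // [leRHS]mulrC; exact: ltW (big i ti i0).
  rewrite ler_pM2l ?mulr_gt0 //; apply: ler_sum_nat_widen => // i /andP[ti it] i0.
  apply/and3P; split => //; first exact: big.
  have cm0 : 0 <= c * m%:R by rewrite mulr_ge0 // ltW.
  have /andP[t1 _] := truncn_itv cm0.
  have : i%:R <= (Num.truncn (c * m%:R))%:R :> R by rewrite ler_nat -ltnS.
  lra.
rewrite mulrDl mul1r; lra.
Qed.

(* Together with [i <= (c + 2) 2^l], this bounds the number of dyadic scales
   comparable with [i] without computing logarithms. *)
Lemma sum_pow2_lt (n : nat) (X : R) : 0 <= X ->
  \sum_(0 <= l < n | (2 ^ l)%:R < X) (2 ^ l)%:R <= 2 * X.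
Proof.
move=> X0; elim: n => [|n IH]; first by rewrite big_geq // mulr_ge0.
rewrite big_mkcond big_nat_recr //= -big_mkcond /=; case: ifPn => [nX|_]; last by rewrite addr0.
apply: (@le_trans _ _ (\sum_(0 <= l < n.+1) (2 ^ l)%:R)).
  rewrite big_nat_recr //= lerD2r; exact: ler_sum_nat_widen.
have -> : \sum_(0 <= l < n.+1) (2 ^ l)%:R = 2 * (2 ^ n)%:R - 1 :> R.
  elim: n {IH nX} => [|n IH]; first by rewrite big_nat1 expn0; lra.
  by rewrite big_nat_recr //= IH expnS natrM; lra.
lra.
Qed.

(** The weight [(c + 2) * 2 ^ l / i] is at least 1 at each comparable scale, so the number of scales
    is at most a geometric sum up to [2 * c * i]. *)
Lemma near_scale_count c (n i : nat) : 1 < c ->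
  \sum_(0 <= l < n) (near_scale c (2 ^ l) i)%:R <= 4 * c * (c + 2).
Proof.
move=> c1; have c0 : 0 < c by exact: lt_trans c1.
have [->|i0] := eqVneq i 0%N.
  by rewrite big1 // ?mulr_ge0 // ?addr_ge0 // ?mulr_ge0 // ltW.
have iR : 0 < i%:R :> R by rewrite ltr0n lt0n.
have ci : 0 <= 2 * c * i%:R by rewrite !mulr_ge0 // ltW.
apply: (@le_trans _ _ ((c + 2) / i%:R * \sum_(0 <= l < n | (2 ^ l)%:R < 2 * c * i%:R) (2 ^ l)%:R)).
  rewrite mulr_sumr [leRHS]big_mkcond /=; apply: ler_sum => l _.
  rewrite /near_scale lt0n i0 /=; case: ifPn => //= _.
  have [h|_] := boolP (i%:R <= (c + 2) * (2 ^ l)%:R); first by rewrite mulrAC ler_pdivlMr // mul1r.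
  by rewrite !mulr_ge0 // ?invr_ge0 ?(ltW iR) // addr_ge0 // ltW.
have k0 : 0 <= (c + 2) / i%:R by rewrite divr_ge0 ?(ltW iR) // addr_ge0 // ltW.
apply: (le_trans (ler_wpM2l k0 (sum_pow2_lt n ci))).
have -> // : (c + 2) / i%:R * (2 * (2 * c * i%:R)) = 4 * c * (c + 2).
by field; rewrite gt_eqF.
Qed.

Lemma GM_weighted_sum_le c (K0 K1 K2 : R) b s v (W : nat -> R) (n : nat) :
  1 < c -> 0 <= K0 -> 0 <= K1 -> 0 <= K2 ->
  (forall i, 0 <= b i) -> (forall i, 0 <= s i) -> (forall i, 0 <= v i) -> (forall m, 0 <= W m) ->
  GM_2beta c K0 b ->
  (forall m, (0 < m)%N -> \sum_(m <= k < m.*2) s k <= K1 * (m%:R * W m)) ->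
  (forall m i, (0 < m)%N -> near_scale c m i -> W m <= K2 * v i) ->
  \sum_(1 <= k < 2 ^ n) b k * s k <= K1 * (1 + 2 * c * K0) * K2 * (4 * c * (c + 2)) *
    \sum_(0 <= i < 2 ^ n * (Num.truncn c).+2) b i * v i.
Proof.
move=> c1 K00 K10 K20 b0 s0 v0 W0 GM hs hW.
have c0 : 0 < c by exact: lt_trans c1.
(* Large enough to contain the window of the GM condition, up to the integer part of [c * m], for
   every block below [2 ^ n]. *)
set N := (2 ^ n * (Num.truncn c).+2)%N.
set L := K1 * (1 + 2 * c * K0) * K2.
have z1 : 0 <= 1 + 2 * c * K0 by rewrite addr_ge0 // !mulr_ge0 // ltW.
have L0 : 0 <= L by rewrite !mulr_ge0.
have blk (l : nat) : (l < n)%N -> \sum_(2 ^ l <= k < 2 ^ l.+1) b k * s k <=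
    L * \sum_(0 <= i < N | near_scale c (2 ^ l) i) b i * v i.
  move=> ln; set m := (2 ^ l)%N; have m0 : (0 < m)%N by rewrite expn_gt0.
  have mR : 0 < m%:R :> R by rewrite ltr0n.
  have -> : (2 ^ l.+1)%N = m.*2 by rewrite expnS mul2n.
  have mn : (m.*2 <= 2 ^ n)%N by rewrite -mul2n -expnS leq_pexp2l.
  have mN : (m.*2 <= N)%N by rewrite (leq_trans mn) // leq_pmulr.
  have tN : (Num.truncn (c * m%:R) < N)%N.
    have cm0 : 0 <= c * m%:R by rewrite mulr_ge0 // ltW.
    have /andP[t1 _] := truncn_itv cm0; have /andP[_ t2] := truncn_itv (ltW c0).
    rewrite -(ltr_nat R); apply: (le_lt_trans t1).
    apply: (@lt_le_trans _ _ (((Num.truncn c).+1 * m)%:R)); first by rewrite natrM ltr_pM2r.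
    rewrite ler_nat /N mulnC leq_mul //; apply: leq_trans mn; rewrite -addnn; exact: leq_addr.
  set S := \sum_(0 <= i < N | near_scale c m i) b i.
  apply: (@le_trans _ _ ((1 + 2 * c * K0) * S / m%:R * \sum_(m <= k < m.*2) s k)).
    rewrite mulr_sumr big_nat [leRHS]big_nat; apply: ler_sum => k km.
    by rewrite ler_wpM2r // ler_pdivlMr //; exact: GM_max_le.
  have S0 : 0 <= S by exact: sumr_ge0.
  have q0 : 0 <= (1 + 2 * c * K0) * S / m%:R by rewrite divr_ge0 ?(ltW mR) // mulr_ge0.
  apply: (le_trans (ler_wpM2l q0 (hs m m0))).
  have -> : (1 + 2 * c * K0) * S / m%:R * (K1 * (m%:R * W m)) = K1 * (1 + 2 * c * K0) * (S * W m).
    by field; rewrite gt_eqF.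
  rewrite /L -[leRHS]mulrA ler_wpM2l ?mulr_ge0 // mulr_suml mulr_sumr; apply: ler_sum => i hi.
  by rewrite mulrCA ler_wpM2l // hW.
have tot : \sum_(1 <= k < 2 ^ n) b k * s k <=
    \sum_(0 <= l < n) L * \sum_(0 <= i < N | near_scale c (2 ^ l) i) b i * v i.
  have step j : (j <= n)%N -> \sum_(1 <= k < 2 ^ j) b k * s k <=
      \sum_(0 <= l < j) L * \sum_(0 <= i < N | near_scale c (2 ^ l) i) b i * v i.
    elim: j => [|j IH] jn; first by rewrite !big_geq.
    rewrite (@big_cat_nat _ _ _ (2 ^ j)) /= ?expn_gt0 //; last by rewrite leq_exp2l.
    by rewrite big_nat_recr //= lerD ?blk // IH // ltnW.
  exact: step.
apply: (le_trans tot); rewrite -mulr_sumr -mulrA ler_wpM2l //.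
have -> : \sum_(0 <= l < n) \sum_(0 <= i < N | near_scale c (2 ^ l) i) b i * v i =
    \sum_(0 <= i < N) (b i * v i) * \sum_(0 <= l < n) (near_scale c (2 ^ l) i)%:R.
  under eq_bigr do rewrite big_mkcond /=.
  rewrite exchange_big /=; apply: eq_bigr => i _; rewrite mulr_sumr; apply: eq_bigr => l _.
  by case: ifP; rewrite ?mulr1 ?mulr0.
rewrite mulr_sumr; apply: ler_sum => i _; rewrite mulrC.
by rewrite ler_wpM2r ?mulr_ge0 // near_scale_count.
Qed.

End GeneralMonotone.

(** * From finite sums to series *)

Section PowerMeans.
Variable R : realType.

Lemma Sp_norm_ge0 (p : \bar R) (g : R -> R[i]) : (0 <= Sp_norm p g)%E.
Proof.
case: p => [r||] //=; apply: ereal_sup_ge.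
  eexists; first by exists 0 => //.
  exact: poweR_ge0.
eexists; first by exists 0 => //.
by rewrite lee_fin cabs_ge0.
Qed.

Lemma best_approx_ge0 (sigma : R) (p : \bar R) (g : R -> R[i]) : (0 <= best_approx sigma p g)%E.
Proof. by apply: le_ereal_inf_tmp => _ [h _ <-]; exact: Sp_norm_ge0. Qed.

(** The right-hand series may be infinite. Each partial sum on the left along powers of 2 is at most
    [K] times that series, and the supremum is taken before the monotone power 1/q. *)
Lemma nneseries_poweR_le (q K : R) (b s v : nat -> R) (E : nat -> \bar R) :
  0 < q -> 0 < K -> (forall k, 0 <= b k) -> (forall k, 0 <= v k) -> (forall k, 0 <= E k)%E ->
  (forall k, 0 <= s k) ->
  (forall n, exists N, \sum_(0 <= k < 2 ^ n) b k * s k <= K * \sum_(0 <= i < N) b i * v i `^ q) ->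
  ((\sum_(0 <= k <oo) (b k * s k)%:E) `^ q^-1 <=
   (K `^ q^-1)%:E * (\sum_(0 <= k <oo) (b k)%:E * ((v k)%:E + E k) `^ q) `^ q^-1)%E.
Proof.
move=> q0 K0 b0 v0 E0 s0 H.
have t0 k : (0 <= (b k)%:E * ((v k)%:E + E k) `^ q)%E.
  by rewrite mule_ge0 ?lee_fin // poweR_ge0.
have u0 k : (0 <= (b k * s k)%:E)%E by rewrite lee_fin mulr_ge0.
set Y := (\sum_(0 <= k <oo) (b k)%:E * _)%E.
have Y0 : (0 <= Y)%E by apply: nneseries_ge0.
rewrite -poweR_EFin -poweRM ?lee_fin ?(ltW K0) //.
apply: gt0_ler_poweR; rewrite ?invr_ge0 ?(ltW q0) //.
- by rewrite in_itv /= leey andbT nneseries_ge0.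
- by rewrite in_itv /= leey andbT mule_ge0 // lee_fin ltW.
apply: lime_le; first by apply: is_cvg_nneseries.
apply: nearW => n; have [N HN] := H n.
apply: (@le_trans _ _ (\sum_(0 <= k < 2 ^ n) b k * s k)%:E).
  rewrite -sumEFin lee_sum_nneg_natr //; exact: ltnW (ltn_expl _ _).
apply: (@le_trans _ _ (K * \sum_(0 <= i < N) b i * v i `^ q)%:E); first by rewrite lee_fin.
rewrite EFinM -sumEFin lee_wpmul2l ?lee_fin ?(ltW K0) //.
apply: (@le_trans _ _ (\sum_(0 <= k < N) (b k)%:E * ((v k)%:E + E k) `^ q)%E).
  apply: lee_sum => i _; rewrite EFinM lee_wpmul2l ?lee_fin // -poweR_EFin.
  apply: gt0_ler_poweR; rewrite ?(ltW q0) //.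
  - by rewrite in_itv /= leey andbT lee_fin.
  - by rewrite in_itv /= leey andbT adde_ge0 // lee_fin.
  - by rewrite leeDl.
exact: nneseries_lim_ge.
Qed.

End PowerMeans.

(** Whether the kernel of index [k] or [k - 1] occurs depends on [k], so both are counted. *)
Lemma sum_add_pred_le (R : realType) (T : nat -> R) m : (0 < m)%N -> (forall j, 0 <= T j) ->
  \sum_(m <= k < m.*2) (T k + T k.-1) <= 2 * \sum_(m.-1 <= k < m.*2) T k.
Proof.
case: m => // m _ T0; rewrite big_split /= [X in _ + X]big_add1 /=.
have h1 : \sum_(m.+1 <= k < m.+1.*2) T k <= \sum_(m <= k < m.+1.*2) T k.
  have mm : (m < m.+1.*2)%N by clear; lia.
  by rewrite [leRHS](big_ltn mm) lerDr.
have h2 : \sum_(m <= k < m.*2.+1) T k <= \sum_(m <= k < m.+1.*2) T k.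
  have mm : (m <= m.*2.+1)%N by clear; lia.
  by rewrite doubleS [leRHS](big_nat_recr _ _ _ mm) /= lerDl.
lra.
Qed.

(** * Deviations of the partial sums over a block *)

Section PartialSumDeviation.
Variables (R : realType) (alpha : R) (p : \bar R) (x : R) (w : R -> R).
Hypotheses (a0 : 0 < alpha) (p1 : (1 < p)%E) (hw : modulus_type w).
Variables (f : R -> R[i]) (hf : Omega_w alpha p x w f) (lam : int -> R)
  (hlam : fourier_exponents f lam).
Local Notation mu := (@lebesgue_measure R).

Definition deviation (k : nat) := cabs (fourier_sum f lam (alpha * k%:R / 2) x - f x).

Lemma deviation_powR_le (q : R) k : 0 < q -> deviation k `^ q <=
  2 `^ q * (`|complex.Re (fourier_sum f lam (alpha * k%:R / 2) x - f x)| `^ q +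
            `|complex.Im (fourier_sum f lam (alpha * k%:R / 2) x - f x)| `^ q).
Proof.
move=> q0; apply: le_trans (powRD2_le q0 (normr_ge0 _) (normr_ge0 _)).
by apply: ge0_ler_powR; rewrite ?nnegrE ?cabs_ge0 ?addr_ge0 ?(ltW q0) ?cabs_le.
Qed.

Let part_lin : (forall a b c : R[i], complex.Re (a + b - 2 * c) = complex.Re a + complex.Re b - 2 * complex.Re c) /\
  (forall a b c : R[i], complex.Im (a + b - 2 * c) = complex.Im a + complex.Im b - 2 * complex.Im c).
Proof.
have two : (2 : R[i]) = (2 +i* 0)%C by rewrite -[2]/(1 + 1); congr (_ +i* _)%C; rewrite ?addr0.
by split=> -[a1 a2] [b1 b2] [c1 c2]; rewrite two /= mul0r ?subr0 ?addr0.
Qed.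

Let ReB (a b : R[i]) : complex.Re (a - b) = complex.Re a - complex.Re b.
Proof. by case: a; case: b. Qed.

Let ImB (a b : R[i]) : complex.Im (a - b) = complex.Im a - complex.Im b.
Proof. by case: a; case: b. Qed.

Lemma deviation_eq0 k : (forall t, 0 <= t -> w t = 0) -> deviation k = 0.
Proof.
move=> wz; have [hO [C C0 bound]] := hf.
have [hr [hi [br bi aeri ar ai]]] := Omega_parts p1 hO.
have [_ _ [lam' hlam' gap']] := hO.
have gap := exponent_gap hlam hlam' gap'.
have aer : {ae mu, forall t, complex.Re (f t) = hr t} by apply: (ae_imply aeri) => t [].
have aei : {ae mu, forall t, complex.Im (f t) = hi t} by apply: (ae_imply aeri) => t [].
have Zr l e := Rintegral_sym_diff_eq0 p1 hw C0 bound part_lin.1 (@normr_Re_le R) br aer l e wz.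
have Zi l e := Rintegral_sym_diff_eq0 p1 hw C0 bound part_lin.2 (@normr_Im_le R) bi aei l e wz.
have [e1 e2] : complex.Re (fourier_sum f lam (alpha * k%:R / 2) x - f x) = 0 /\
    complex.Im (fourier_sum f lam (alpha * k%:R / 2) x - f x) = 0.
  have [->|k0] := posnP k.
    by rewrite mulr0 mul0r; have [e _ [-> ->]] := fourier_dev_parts0 x hlam br bi aeri ar ai.
  have [j _ [-> ->]] := fourier_dev_parts x a0 hlam br bi aeri ar ai gap k0.
  by rewrite /dev_coef.
by apply/eqP; rewrite /deviation cabs_eq0 eq_complex e1 e2 !eqxx.
Qed.

Lemma sum_deviation_le (q : R) : 0 < q -> 0 < w 1 -> exists2 K, 0 < K &
  forall m, (0 < m)%N -> \sum_(m <= k < m.*2) deviation k `^ q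
    <= K * (m%:R * w (alpha / 2 * m%:R)^-1 `^ q).
Proof.
move=> q0 w1; have [hO [C C0 bound]] := hf.
have [hr [hi [br bi aeri ar ai]]] := Omega_parts p1 hO.
have [_ _ [lam' hlam' gap']] := hO.
have gap := exponent_gap hlam hlam' gap'.
have aer : {ae mu, forall t, complex.Re (f t) = hr t} by apply: (ae_imply aeri) => t [].
have aei : {ae mu, forall t, complex.Im (f t) = hi t} by apply: (ae_imply aeri) => t [].
have b0 : 0 < alpha / 2 by rewrite divr_gt0.
have [Kr Kr0 hKr] := sum_dev_coef_le p1 hw C0 bound part_lin.1 ReB (@normr_Re_le R) br aer b0 q0 w1.
have [Ki Ki0 hKi] := sum_dev_coef_le p1 hw C0 bound part_lin.2 ImB (@normr_Im_le R) bi aei b0 q0 w1.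
exists (2 `^ q * (2 * (Kr + Ki))).
  by rewrite mulr_gt0 ?powR_gt0 // mulr_gt0 // addr_gt0.
move=> m m0.
pose T j := `|dev_coef hr (complex.Re (f x)) x (alpha / 2) j| `^ q +
            `|dev_coef hi (complex.Im (f x)) x (alpha / 2) j| `^ q.
have T0 j : 0 <= T j by rewrite addr_ge0 ?powR_ge0.
have dT k : (0 < k)%N -> deviation k `^ q <= 2 `^ q * (T k + T k.-1).
  move=> k0; apply: (le_trans (deviation_powR_le k q0)); rewrite ler_wpM2l ?powR_ge0 //.
  have [j jk [-> ->]] := fourier_dev_parts x a0 hlam br bi aeri ar ai gap k0.
  change (T j <= T k + T k.-1).
  by case: jk => ->; [rewrite lerDl; exact: T0|rewrite lerDr; exact: T0].
set X := m%:R * _.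
have sT : \sum_(m.-1 <= k < m.*2) T k <= (Kr + Ki) * X.
  by rewrite big_split /= mulrDl; apply: lerD; [exact: hKr|exact: hKi].
apply: (@le_trans _ _ (\sum_(m <= k < m.*2) 2 `^ q * (T k + T k.-1))).
  rewrite big_nat [leRHS]big_nat; apply: ler_sum => k /andP[mk _].
  by apply: dT; exact: leq_trans mk.
rewrite -mulr_sumr -mulrA ler_wpM2l ?powR_ge0 //.
apply: (le_trans (sum_add_pred_le m0 T0)).
by rewrite -mulrA ler_pM2l.
Qed.

End PartialSumDeviation.

Lemma sum_pow2_head (R : realType) (f : nat -> R) n :
  \sum_(0 <= k < 2 ^ n) f k = f 0%N + \sum_(1 <= k < 2 ^ n) f k.
Proof. by rewrite big_ltn ?expn_gt0. Qed.

Lemma modulus_near_scale (R : realType) (w : R -> R) (c beta : R) : modulus_type w ->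
  1 < c -> 0 < beta -> exists2 K, 0 <= K &
  forall m i, (0 < m)%N -> near_scale c m i -> w (beta * m%:R)^-1 <= K * w (pi / i.+1%:R).
Proof.
move=> hw c1 b0; have p0 := pi_gt0 R.
(* From [i <= (c + 2) * m] and [m >= 1] follows i + 1 <= (c + 3) m, that is, 1 / (beta m) <= z pi /
   (i + 1); [modulus_natmul] absorbs [z]. *)
pose z := (c + 3) / (pi * beta).
have z0 : 0 <= z by rewrite divr_ge0 ?addr_ge0 ?mulr_ge0 ?(ltW b0) ?(ltW p0) // ltW // (lt_trans ltr01).
have /andP[_ t2] := truncn_itv z0.
exists (Num.truncn z).+1%:R => // m i m0 /and3P[_ _ im].
have mR : 1 <= m%:R :> R by rewrite ler1n.
have iR : 0 < i.+1%:R :> R by rewrite ltr0n.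
have bm : 0 < beta * m%:R by rewrite mulr_gt0 // (lt_le_trans ltr01).
apply: le_trans (modulus_natmul hw _ (ltW (divr_gt0 p0 iR))).
apply: modulus_homo => //; first by rewrite invr_ge0 ltW.
apply: (@le_trans _ _ (z * (pi / i.+1%:R))); last by rewrite ler_wpM2r ?divr_ge0 // ltW.
have -> : z * (pi / i.+1%:R) = (c + 3) / (beta * i.+1%:R).
  have gen (y t b : R) : 0 < y -> 0 < t -> 0 < b -> (c + 3) / (t * b) * (t / y) = (c + 3) / (b * y).
    by move=> y0 t0 bb; field; rewrite !gt_eqF.
  exact: gen.
rewrite ler_pdivlMr ?mulr_gt0 // ler_pdivrMl //.
have -> : beta * m%:R * (c + 3) = beta * (m%:R * (c + 3)) by ring.
rewrite ler_pM2l // -natr1; lra.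
Qed.

Theorem theorem5 (R : realType) (alpha : R) (p : \bar R) (x : R) (w : R -> R)
    (halpha : 0 < alpha) (hp : (1 < p)%E) (hw : modulus_type w)
    (hne : Omega_w alpha p x w !=set0)
    (a : nat -> nat -> R)
    (ha0 : forall n k, 0 <= a n k)
    (ha1 : forall n, (\sum_(0 <= k <oo) (a n k)%:E = 1)%E)
    (halim : a n 0%N @[n --> \oo] --> 0)
    (c K0 : R) (hc : 1 < c) (hK0 : 0 <= K0)
    (hGM : forall n, GM_2beta c K0 (a n))
    (f : R -> R[i]) (hf : Omega_w alpha p x w f)
    (lam : int -> R) (hlam : fourier_exponents f lam)
    (q : R) (hq : 0 < q) :
  exists2 K : R, 0 < K &
    forall n : nat,
      ((\sum_(0 <= k <oo)
          (a n k * cabs (fourier_sum f lam (alpha * k%:R / 2)%R x - f x)%R `^ q)%:E)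
         `^ q^-1
       <= K%:E *
          (\sum_(0 <= k <oo)
             (a n k)%:E *
             ((w (pi / k.+1%:R)%R)%:E
              + best_approx (alpha * k%:R / 2 ^+ (1 + Num.truncn c)%N)%R p f) `^ q)
         `^ q^-1)%E.
Proof.
have p0 := pi_gt0 R.
pose s k := deviation alpha x f lam k `^ q.
pose v (k : nat) := w (pi / k.+1%:R).
have s0 k : 0 <= s k by exact: powR_ge0.
have pk k : 0 < pi / k.+1%:R :> R by rewrite divr_gt0 // ltr0n.
have v0 k : 0 <= v k by apply: (modulus_ge0 hw); exact: ltW.
suff [K K00 HK] : exists2 K, 0 < K & forall n m : nat, exists N : nat,
    \sum_(0 <= k < 2 ^ m) a n k * s k <= K * \sum_(0 <= i < N) a n i * v i `^ q.
  exists (K `^ q^-1); first exact: powR_gt0.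
  by move=> n; apply: nneseries_poweR_le => // k; exact: best_approx_ge0.
(* If [w] vanishes identically, then phi_x is zero almost everywhere on the half-line and all
   deviations are zero; otherwise [w] is positive off 0 and serves as a normalisation. *)
have [w1|w1] := ltP 0 (w 1); last first.
  have wz t : 0 <= t -> w t = 0.
    move=> t0; apply/eqP; rewrite eq_le (modulus_ge0 hw t0) andbT leNgt; apply/negP => wt.
    have [t00|t00] := eqVneq t 0; first by have [_ _ w00 _] := hw; move: wt; rewrite t00 w00 ltxx.
    have tp : 0 < t by rewrite lt_neqAle eq_sym t00.
    by move: w1; rewrite leNgt (modulus_gt0 hw tp wt ltr01).
  exists 1 => // n m; exists 0%N; rewrite [X in _ <= _ * X]big_geq // mulr0 big1 // => k _.
  by rewrite /s (deviation_eq0 halpha hp hw hf hlam k wz) powR0 ?mulr0 // gt_eqF.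
have [K1 K10 HK1] := sum_deviation_le halpha hp hw hf hlam hq w1.
have b0 : 0 < alpha / 2 by rewrite divr_gt0.
have [K2 K20 HK2] := modulus_near_scale hw hc b0.
have c0 : 0 < c by exact: lt_trans hc.
pose L := K1 * (1 + 2 * c * K0) * K2 `^ q * (4 * c * (c + 2)).
have L0 : 0 <= L.
  rewrite !mulr_ge0 ?powR_ge0 ?(ltW K10) ?(ltW c0) // addr_ge0 ?(ltW c0) //.
  by rewrite !mulr_ge0 // ltW.
have vq : 0 < v 0%N `^ q by rewrite powR_gt0 //; apply: (modulus_gt0 hw ltr01 w1).
have k00 : 0 <= s 0%N / v 0%N `^ q by rewrite divr_ge0 // ltW.
(* The index 0 belongs to no dyadic block. Its term is absorbed by the term of index 0 on the right,
   with a ratio that does not involve [n]. *)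
exists (s 0%N / v 0%N `^ q + L + 1); first by rewrite ltr_wpDl // addr_ge0.
move=> n m; pose N := (2 ^ m * (Num.truncn c).+2)%N.
have N0 : (0 < N)%N by rewrite muln_gt0 expn_gt0.
exists N; rewrite sum_pow2_head.
have vq0 k : 0 <= v k `^ q by exact: powR_ge0.
have wq0 k : 0 <= w (alpha / 2 * k%:R)^-1 `^ q by exact: powR_ge0.
have := GM_weighted_sum_le m hc hK0 (ltW K10) (powR_ge0 K2 q) (ha0 n) s0 vq0 wq0 (hGM n) HK1 _.
rewrite -/L -/N => H.
have {H} H : \sum_(1 <= k < 2 ^ m) a n k * s k <= L * \sum_(0 <= i < N) a n i * v i `^ q.
  apply: H => k i kk ns.
  have e1 := HK2 k i kk ns.
  rewrite -powRM //; apply: ge0_ler_powR => //; first exact: ltW.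
    by rewrite nnegrE (modulus_ge0 hw) // invr_ge0 mulr_ge0 // ltW.
  by rewrite nnegrE mulr_ge0.
set Y := \sum_(0 <= i < N) _ in H *.
have Y0 : a n 0%N * v 0%N `^ q <= Y.
  by rewrite /Y big_ltn // lerDl sumr_ge0 // => i _; rewrite mulr_ge0.
have YY : 0 <= Y by apply: le_trans Y0; rewrite mulr_ge0.
have e0 : a n 0%N * s 0%N <= s 0%N / v 0%N `^ q * Y.
  apply: le_trans (ler_wpM2l k00 Y0).
  by rewrite mulrCA mulfVK ?gt_eqF // mulrC.
lra.
Qed.
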